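(* Let $n\ge1$ be an integer. There exists $\delta>0$ such that for every integer $k\ge0$, $$b(n,2k+1;v)\sim\frac{1}{2^k4^n(n-1)!}\,v^{n-k-1}e^{-\pi v}\qquad\text{as } \Re v\to+\infty \text{ in } \left\{v\in\mathbb{C}:|\Im v|<\left(\tfrac23\right)^k\delta\right\},$$ and for every integer $k\ge1$, $$b(n,2k;v)\sim\frac{\sqrt2}{2^k4^n(n-1)!}\,v^{n-k-\frac12}e^{-\pi v}\qquad\text{as } v\to+\infty \text{ on the real line}.$$ Here $\sim$ means that the ratio of the two sides tends to $1$.
   Context: For integers $n,m\ge1$ and $v\ge 0$, $$b(n,m;v)=\frac{2}{(4\pi)^{n+\frac m2}}\int_0^\infty s^{m-1}\left(\frac{s}{\sinh s}\right)^n\left(\frac{sv}{2}\right)^{-\frac{m-2}{2}}J_{\frac{m-2}{2}}(sv)\,ds,$$ where $J_\nu$ is the Bessel function of the first kind. The function $x\mapsto (x/2)^{-\nu}J_\nu(x)$ is entire, and for $v$ complex in a sufficiently thin strip $|\Im v|<\delta$, $b(n,m;v)$ denotes the analytic extension given by the same formula; in particular $$b(n,1;v)=\frac{1}{(4\pi)^{n+\frac12}\sqrt\pi}\int_{\mathbb{R}}\left(\frac{s}{\sinh s}\right)^ne^{\mathrm{i}vs}\,ds.$$ (The heat kernel at time $h>0$ on the H-type group $\mathbb{R}^{2n}\times\mathbb{R}^m$ at a point $(0,t)$ is $h^{-n-m}b(n,m;|t|/h)$.) *)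

(* Defs.v *)
From HB Require Import structures.
From mathcomp Require Import all_boot all_order all_algebra.
From mathcomp Require Import complex.
From mathcomp Require Import all_classical all_reals all_analysis.
From mathcomp Require Import ring.

Set Implicit Arguments.
Unset Strict Implicit.
Unset Printing Implicit Defensive.

Import Order.TTheory GRing.Theory Num.Theory.
Import numFieldNormedType.Exports.

Local Open Scope classical_set_scope.
Local Open Scope complex_scope.
Local Open Scope ring_scope.

(* The topology on [R[i]] is the one given by its modulus; the library only
   attaches it to the regular module [R[i]^o]. *)
HB.instance Definition _ (R : realType) := NormedModule.copy R[i] R[i]^o.

Section Functions.
Context {R : realType}.
Implicit Types (nu x : R) (z v : R[i]) (n m : nat).

Definition sinh x : R := (expR x - expR (- x)) / 2.

(* Euler's integral; it is only used below at arguments [x > 0]. *)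
Definition Gamma x : R :=
  (\int[lebesgue_measure]_(t in `]0%R, +oo[) (t `^ (x - 1) * expR (- t)))%R.

Definition cexp z : R[i] :=
  (expR (complex.Re z))%:C *
  (cos (complex.Im z) +i* sin (complex.Im z)).

(* Principal argument, in [(-pi, pi]] (for [z != 0]). *)
Definition carg z : R :=
  let c := acos (complex.Re z / Normc.normc z) in
  if 0 <= complex.Im z then c else - c.

Definition clog z : R[i] := ln (Normc.normc z) +i* carg z.

(* Principal branch of [z ^ nu]; only meant for [z != 0]. *)
Definition cpow z nu : R[i] := cexp (nu%:C * clog z).

Definition bessel_series nu z : R[i] :=
  limn (series (fun j : nat =>
    (-1) ^+ j / (j`!%:R * (Gamma (nu + j%:R + 1))%:C) * (z / 2) ^+ j.*2)).

Definition besselJ nu z : R[i] := cpow (z / 2) nu * bessel_series nu z.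

(* The entire function [(z / 2) ^ (- nu) * J_nu(z)], with its removable
   singularity at [0] filled in; see [besselJ_entireE]. *)
Definition besselJ_entire nu z : R[i] :=
  if z == 0 then (Gamma (nu + 1))^-1%:C
  else cpow (z / 2) (- nu) * besselJ nu z.

Definition cintegral (D : set R) (f : R -> R[i]) : R[i] :=
  (\int[lebesgue_measure]_(s in D) complex.Re (f s))%R +i*
  (\int[lebesgue_measure]_(s in D) complex.Im (f s))%R.

(* For [1 <= n] and [1 <= m], the integral converges absolutely as soon as
   [`|Im v| < n]; in particular for every real [v]. *)
Definition b n m v : R[i] :=
  (2 / (4 * pi) `^ (n%:R + m%:R / 2))%:C *
  cintegral `]0, +oo[ (fun s =>
    (s ^+ m.-1 * (s / sinh s) ^+ n)%:C *
    besselJ_entire ((m%:R - 2) / 2) (s%:C * v)).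

(* [Re v --> +oo] within the strip [`|Im v| < d]. *)
Definition strip_pinfty (d : R) : set_system R[i] :=
  within [set v | `|complex.Im v| < d]
    (filter_from setT (fun M : R => [set v | M < complex.Re v])).

Definition equiv_at (T : Type) (F : set_system T) (f g : T -> R[i]) : Prop :=
  f x / g x @[x --> F] --> (1 : R[i]).

Global Instance strip_pinfty_filter (d : R) : Filter (strip_pinfty d).
Proof.
apply: within_filter; apply: filter_from_filter; first by exists 0.
move=> M N _ _; exists (Num.max M N) => // v /=.
by rewrite gt_max => /andP[].
Qed.

Lemma cexpD z v : cexp (z + v) = cexp z * cexp v.
Proof.
case: z => a c; case: v => a' c'; rewrite /cexp /= expRD cosD sinD.
by apply/eqP; rewrite eq_complex /=; apply/andP; split; apply/eqP; ring.
Qed.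

Lemma cexp0 : cexp 0 = 1.
Proof. by rewrite /cexp /= expR0 cos0 sin0 mul1r. Qed.

Lemma clogK z : z != 0 -> cexp (clog z) = z.
Proof.
case: z => a c z0; rewrite /cexp /clog /carg /=.
set N := Num.sqrt _.
have N0 : 0 < N.
  rewrite sqrtr_gt0 lt0r addr_ge0 ?sqr_ge0 // andbT.
  by rewrite paddr_eq0 ?sqr_ge0 // !sqrf_eq0; move: z0; rewrite eq_complex.
have NE : N ^+ 2 = a ^+ 2 + c ^+ 2 by rewrite sqr_sqrtr // addr_ge0 ?sqr_ge0.
have aN : `|a / N| <= 1.
  rewrite -(ler_pXn2r (n := 2)) ?nnegrE // expr1n real_normK ?num_real //.
  by rewrite expr_div_n ler_pdivrMr ?exprn_gt0 // mul1r NE lerDl sqr_ge0.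
have hc : -1 <= a / N <= 1 by rewrite -ler_norml.
have lnN : expR (ln N) = N by apply: lnK; rewrite posrE; exact: N0.
rewrite lnN.
have hs : sin (acos (a / N)) = `|c| / N.
  have hcN : 0 <= `|c| / N by rewrite divr_ge0 // ltW.
  rewrite sin_acos // -[RHS](ger0_norm hcN) -sqrtr_sqr.
  congr Num.sqrt; rewrite !expr_div_n real_normK ?num_real //.
  by rewrite -[1](@divff _ (N ^+ 2)) ?gt_eqF ?exprn_gt0 // -mulrBl NE addrAC subrr add0r.
apply/eqP; rewrite eq_complex /= !mul0r subr0 addr0.
have NV x : N * (x / N) = x by rewrite mulrC divfK ?gt_eqF.
case: ifP => hcs; rewrite ?cosN ?sinN acosK ?in_itv //= hs.
  by rewrite ger0_norm // !NV !eqxx.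
by rewrite ltr0_norm ?ltNge ?hcs // mulNr opprK !NV !eqxx.
Qed.

Lemma besselJ_entireE nu z : besselJ_entire nu z = bessel_series nu z.
Proof.
rewrite /besselJ_entire /besselJ; case: eqVneq => [->|z0].
  rewrite /bessel_series; apply/esym.
  apply: (@cvg_lim _ (@norm_hausdorff _ R[i])).
  apply: cvg_near_cst; near=> k.
  have -> : k = k.-1.+1 by rewrite prednK //; near: k; exists 1%N.
  rewrite /series /= big_nat_recl //= big1 ?addr0.
    by rewrite !expr0 fact0 !mul1r mulr1 fmorphV.
  by move=> i _; rewrite doubleS mul0r expr0n mulr0.
by rewrite mulrA -cexpD -mulrDl -rmorphD addNr mul0r cexp0 mul1r.
Unshelve. all: by end_near. Qed.

End Functions.

(* Main.v *)
(** Odd [m].  On the line [Im z = pi / 2] set [k_q = int z^q e^(ivz) / sinh^n z].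
    Since [sinh (z - i pi) = - sinh z], the same integral on [Im z = - pi / 2] is
    [(-1)^n e^(pi v)] times a combination of [k_0, ..., k_q].  The two lines can be
    exchanged for numerators vanishing to order [n] at [0], hence for [z^q] times
    the Taylor remainder of [e^(ivz)]; the Taylor polynomial that is left out
    contributes a polynomial in [v] whose top coefficient is the residue at [0].
    Solving for [k_q] by induction on [q] gives its asymptotics, of order
    [v^(n-1) e^(- pi v)], uniformly in the strip.  For half-integral order the Bessel
    kernel reduces, by its three-term recurrence, to [cos] and [sin], so
    [b n (2k+1)] is a combination of these moments.

    Even [m], real [v].  Integrating the kernel of dimension [m + 1] at
    [sqrt (v^2 + u^2)] over [u] in [R] yields [2 sqrt pi] times the kernel of
    dimension [m] at [v] (descent): both sides solve the same second order equation,
    whose regular solutions are determined by their value at [0] because an energy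
    is monotone, and testing against a Gaussian gives the constant.  The asymptotics
    for [m + 1] then give those for [m] by Laplace's method. *)
Require Import Defs.
From mathcomp Require Import all_boot all_order all_algebra.
From mathcomp Require Import complex.
From mathcomp Require Import all_classical all_reals all_analysis.
From mathcomp Require Import measurable_realfun lebesgue_integral.
From mathcomp Require Import ring lra zify.
Import Order.TTheory GRing.Theory Num.Theory.
Import numFieldNormedType.Exports.
Set Implicit Arguments.
Unset Strict Implicit.
Unset Printing Implicit Defensive.
Local Open Scope classical_set_scope.
Local Open Scope complex_scope.
Local Open Scope ring_scope.

(** * Integrals over the line and the half-line *)

(** On the real axis z^q / sinh^n z has a pole when q < n, while it is regular for 0 < Im z < pi;
    this is why the moments live on Im z = pi / 2. The size e^(- pi v) is that of e^(ivz) at the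
    next pole, i pi, and v^(n-1) reflects its order n. No residue theorem enters: integrals over
    lines are constant because their derivative in Im z integrates an exact derivative, and the one
    residue needed is found by replacing z^(n-1) with sinh^(n-1) z. For |Im v| < 1 / 2 the
    numerators grow more slowly than sinh^n for every n >= 1, whence delta = 1 / 2. For even m the
    Bessel kernel has integral order and is no combination of exponentials, so nothing can be
    shifted. Descent replaces this: with all constants, the integral over u of b(n, m + 1; sqrt (v^2
    + u^2)) is b(n, m; v). The obstacle is m = 2, where the Bessel kernel decays too slowly in u for
    Fubini. In Laplace's method sqrt (v^2 + u^2) - v is close to u^2 / (2 v), and e^(- pi u^2 / (2
    v)) has integral sqrt (2 v). *)

Section RealIntegrals.
Context {R : realType}.
Local Notation mu := (@lebesgue_measure R).
Local Notation ibl D f := (mu.-integrable D (EFin \o f)).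
Implicit Types (f g F : R -> R) (D : set (measurableTypeR R)) (a b x : R).

Lemma integrable_dominated D f g : measurable D -> measurable_fun D f ->
  ibl D g -> (forall x, D x -> `|f x| <= g x) -> ibl D f.
Proof.
move=> mD mf ig fg; apply: (le_integrable mD _ _ ig) => /=.
  exact/measurable_EFinP.
move=> x Dx /=; rewrite lee_fin [X in _ <= X]ger0_norm ?fg//.
by rewrite (le_trans _ (fg x Dx)).
Qed.

Lemma integrable_scale D f (c : R) : measurable D -> ibl D f ->
  ibl D (fun x => c * f x).
Proof.
move=> mD fi; have := integrableZl mD c fi.
by congr (mu.-integrable _ _); apply/funext => x /=; rewrite EFinM.
Qed.

Lemma integrable_add D f g : measurable D -> ibl D f -> ibl D g ->
  ibl D (fun x => f x + g x).
Proof.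
move=> mD fi gi; have := integrableD mD fi gi.
by congr (mu.-integrable _ _); apply/funext => x /=; rewrite EFinD.
Qed.

Lemma integrable_subset (E D : set (measurableTypeR R)) f : measurable E -> measurable D ->
  D `<=` E -> ibl E f -> ibl D f.
Proof. by move=> mE mD DE; exact: integrableS. Qed.

Lemma dominated_limit_integrable D (f_ : nat -> R -> R) f g :
  measurable D -> (forall n, measurable_fun D (f_ n)) ->
  (forall x, D x -> f_ n x @[n --> \oo] --> f x) ->
  ibl D g -> (forall n x, D x -> `|f_ n x| <= g x) -> ibl D f.
Proof.
move=> mD mf cf ig fg.
apply: (lebesgue_integral_dominated_convergence.dominated_integrable mD
  (fun n x => (f_ n x)%:E) _ (EFin \o g)) => //.
- by move=> n; exact/measurable_EFinP.
- by move=> x Dx; apply: cvg_EFin; [exact: nearW|exact: cf].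
Qed.

Lemma Rintegral_dominated_cvg D (f_ : nat -> R -> R) f g :
  measurable D -> (forall n, measurable_fun D (f_ n)) ->
  (forall x, D x -> f_ n x @[n --> \oo] --> f x) ->
  ibl D g -> (forall n x, D x -> `|f_ n x| <= g x) ->
  (\int[mu]_(x in D) f_ n x)%R @[n --> \oo] --> (\int[mu]_(x in D) f x)%R.
Proof.
move=> mD mf cf ig fg; apply: fine_cvg.
have fi := dominated_limit_integrable mD mf cf ig fg.
rewrite fineK; last exact: integrable_fin_num.
apply: (@dominated_cvg _ _ _ mu D mD (fun n x => (f_ n x)%:E) _ (EFin \o g)) => //.
- by move=> n; exact/measurable_EFinP.
- by move=> x Dx; apply: cvg_EFin; [exact: nearW|exact: cf].
Qed.

Lemma is_derive_continuous_at F x d :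
  is_derive x (1 : R) F d -> {for x, continuous F}.
Proof.
by move=> dF; apply/differentiable_continuous/derivable1_diffP; have [] := dF.
Qed.

Lemma FTC2_segment F f a b : a < b ->
  (forall x, a <= x <= b -> is_derive x (1 : R) F (f x)) ->
  (forall x, a <= x <= b -> {for x, continuous f}) ->
  \int[mu]_(x in `[a, b]) f x = F b - F a.
Proof.
move=> ab dF cf; rewrite /Rintegral (@continuous_FTC2 _ f F)//.
- apply: continuous_in_subspaceT => x; rewrite inE/= in_itv/= => xab.
  exact: cf.
- split.
  + by move=> x; rewrite in_itv/= => /andP[ax xb]; have [] := dF x _;
      rewrite ?(ltW ax) ?(ltW xb).
  + have /dF/is_derive_continuous_at : a <= a <= b by rewrite lexx ltW.
    exact: cvg_at_right_filter.
  + have /dF/is_derive_continuous_at : a <= b <= b by rewrite lexx ltW.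
    exact: cvg_at_left_filter.
- move=> x; rewrite in_itv/= => /andP[ax xb].
  have dx : is_derive x (1:R) F (f x) by apply: dF; rewrite (ltW ax) (ltW xb).
  by rewrite derive1E derive_val.
Qed.

(** The fundamental theorem is used on the compact intervals only; the restrictions of [f] to them
    are dominated by [|f|], so dominated convergence reaches all of [D]. This serves both the line
    and the open half-line. *)
Lemma FTC2_exhaust D F f (a b : nat -> R) (l0 l1 : R) :
  measurable D ->
  (forall n, a n < b n) -> (forall n, `[a n, b n] `<=` D) ->
  (forall x, D x -> \forall n \near \oo, x \in `[a n, b n]) ->
  (forall x, D x -> is_derive x (1 : R) F (f x)) ->
  (forall x, D x -> {for x, continuous f}) ->
  ibl D f ->
  F (a n) @[n --> \oo] --> l0 -> F (b n) @[n --> \oo] --> l1 ->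
  \int[mu]_(x in D) f x = l1 - l0.
Proof.
move=> mD ab abD Dab dF cf fi Fa Fb.
have : (\int[mu]_(x in D) (f \_ `[a n, b n]) x) @[n --> \oo]
    --> \int[mu]_(x in D) f x.
  apply: (@Rintegral_dominated_cvg _ _ _ (fun x => `|f x|)) => //.
  - move=> n; apply: (measurable_funS measurableT) => //.
    apply/(measurable_restrictT _ _).1 => //.
    apply: (measurable_funS mD) => //.
    by apply/measurable_EFinP; case/integrableP: fi.
  - move=> x Dx; apply: cvg_near_cst; near=> n; rewrite patchE ifT// inE/=.
    by near: n; exact: Dab.
  - have := integrable_norm fi.
    by [].
  - move=> n x Dx; rewrite patchE; case: ifP => // _; rewrite normr0.
    exact: normr_ge0.
have E n : \int[mu]_(x in D) (f \_ `[a n, b n]) x = F (b n) - F (a n).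
  rewrite -Rintegral_mkcondr setIidr//; apply: FTC2_segment => //.
    by move=> x xab; apply: dF; apply: (abD n); rewrite /= in_itv.
  by move=> x xab; apply: cf; apply: (abD n); rewrite /= in_itv.
under eq_fun do rewrite E.
move=> h; apply: (@cvg_unique _ (@Rhausdorff R) _ _ _ _ h).
exact: cvgB.
Unshelve. all: by end_near. Qed.

Lemma FTC2_line F f (l0 l1 : R) :
  (forall x, is_derive x (1 : R) F (f x)) -> continuous f -> ibl setT f ->
  F x @[x --> -oo] --> l0 -> F x @[x --> +oo] --> l1 ->
  \int[mu]_x f x = l1 - l0.
Proof.
move=> dF cf fi F0 F1.
have ny : (n.+1%:R : R) @[n --> \oo] --> +oo.
  by rewrite (cvg_shiftS (fun n => n%:R : R)); exact: cvgr_idn.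
apply: (@FTC2_exhaust setT F f (fun n => - n.+1%:R) (fun n => n.+1%:R)) => //.
- by move=> n; rewrite -subr_gt0 opprK -natrD ltr0n addnS.
- move=> x _; near=> n; rewrite in_itv/= -ler_norml.
  by near: n; move/cvgryPge: ny; exact.
- by move=> x _; exact: cf.
- apply: (cvg_comp (fun n => - n.+1%:R : R) F _ F0); exact/cvgNrNy.
- exact: cvg_comp F1.
Unshelve. all: by end_near. Qed.

Lemma FTC2_half_line F f (l0 l1 : R) :
  (forall x : R, 0 < x -> is_derive x (1 : R) F (f x)) ->
  (forall x : R, 0 < x -> {for x, continuous f}) -> ibl `]0, +oo[ f ->
  F x @[x --> 0^'+] --> l0 -> F x @[x --> +oo] --> l1 ->
  \int[mu]_(x in `]0, +oo[) f x = l1 - l0.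
Proof.
move=> dF cf fi F0 F1.
have ny : (n.+2%:R : R) @[n --> \oo] --> +oo.
  rewrite (cvg_shiftS (fun n => n.+1%:R : R)).
  by rewrite (cvg_shiftS (fun n => n%:R : R)); exact: cvgr_idn.
have n0 : (n.+2%:R^-1 : R) @[n --> \oo] --> 0.
  by apply/gtr0_cvgV0 => //; apply: nearW => n; rewrite ltr0n.
apply: (@FTC2_exhaust `]0, +oo[ F f (fun n => n.+2%:R^-1) (fun n => n.+2%:R)) => //.
- move=> n; rewrite (@lt_trans _ _ 1)// ?ltr1n//.
  by rewrite invf_lt1// ltr1n.
- move=> n x /=; rewrite !in_itv/= andbT => /andP[+ _]; exact: lt_le_trans.
- move=> x /=; rewrite in_itv/= andbT => x0; near=> n; rewrite in_itv/=.
  apply/andP; split; last by near: n; move/cvgryPge: ny; exact.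
  near: n; exact: (cvgr_le 0).
- by move=> x /=; rewrite in_itv/= andbT; exact: dF.
- by move=> x /=; rewrite in_itv/= andbT; exact: cf.
- move/cvg_at_rightP: F0; apply; split => // n; by rewrite invr_gt0.
- exact: cvg_comp F1.
Unshelve. all: by end_near. Qed.

End RealIntegrals.

Section RealSubstitutions.
Context {R : realType}.
Local Notation mu := (@lebesgue_measure R).
Local Notation ibl D f := (mu.-integrable D (EFin \o f)).
Implicit Types (f g F : R -> R) (D : set (measurableTypeR R)) (a b x : R).

Let derive1_scale a : ((fun x => a * x : R)^`() = cst a)%classic.
Proof. by apply/funext => x; rewrite derive1E derive_val [LHS]mulr1. Qed.

Lemma ge0_integral_scale f a : 0 < a -> continuous f -> (forall x, 0 <= f x) ->
  (\int[mu]_x (f x)%:E = \int[mu]_x (a * f (a * x))%:E)%E.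
Proof.
move=> a0 cf f0.
rewrite (@increasing_ge0_integration_by_substitutionT R (fun x => a * x))//.
- by apply: eq_integral => x _; rewrite derive1_scale/= mulrC.
- by move=> x y xy; rewrite ltr_pM2l.
- by rewrite derive1_scale; exact: cst_continuous.
- by rewrite derive1_scale; exact: is_cvg_cst.
- by rewrite derive1_scale; exact: is_cvg_cst.
- exact: gt0_cvgMrNy.
- exact: gt0_cvgMry.
Qed.

(** Substitution is available for nonnegative integrands, hence the split into positive and negative
    parts; multiplication by [a] commutes with taking them because [a] is positive. *)
Lemma Rintegral_scale f a : 0 < a -> continuous f ->
  \int[mu]_x (a * f (a * x)) = \int[mu]_x f x.
Proof.
move=> a0 cf; rewrite /Rintegral; congr fine; apply/esym.
rewrite integralE [in RHS]integralE.
have pE : (EFin \o f)^\+%E = EFin \o (f \max cst 0)%R.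
  by apply/funext => x; rewrite funeposE/= -EFin_max.
have nE : (EFin \o f)^\-%E = EFin \o ((\- f) \max cst 0)%R.
  by apply/funext => x; rewrite funenegE/= -EFin_max.
congr (_ - _)%E.
  transitivity (\int[mu]_x ((f \max cst 0) x)%:E)%E.
    by apply: eq_integral => x _; rewrite -[LHS]/((EFin \o f)^\+%E x) pE.
  rewrite (@ge0_integral_scale _ a)//.
  - apply: eq_integral => x _; rewrite funeposE/= -EFin_max.
    by congr (_ %:E); rewrite maxr_pMr ?mulr0 ?ltW.
  - by move=> x; apply: continuous_max; [exact: cf|exact: cst_continuous].
  - by move=> x /=; rewrite le_max lexx orbT.
transitivity (\int[mu]_x (((\- f) \max cst 0) x)%:E)%E.
  by apply: eq_integral => x _; rewrite -[LHS]/((EFin \o f)^\-%E x) nE.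
rewrite (@ge0_integral_scale _ a)//.
- apply: eq_integral => x _; rewrite funenegE/= -EFin_max.
  by congr (_ %:E); rewrite maxr_pMr ?mulr0 ?mulrN ?ltW.
- move=> x; apply: continuous_max; last exact: cst_continuous.
  by apply: continuousN; exact: cf.
- by move=> x /=; rewrite le_max lexx orbT.
Qed.

Lemma integrable_opp_arg f : measurable_fun [set: measurableTypeR R] f -> ibl setT f ->
  ibl setT (fun x => f (- x)).
Proof.
move=> mf fi.
have mo : measurable_fun [set: measurableTypeR R] (-%R : _ -> measurableTypeR R).
  by apply: continuous_measurable_fun; exact: opp_continuous.
have mfo : measurable_fun setT (fun x => f (- x)) by exact: measurableT_comp.
apply/integrableP; split; first exact/measurable_EFinP.
case/integrableP: fi => _; congr (_ < _)%E.
transitivity (\int[pushforward mu (-%R : _ -> measurableTypeR R)]_x (`|f x|)%:E)%E.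
  by apply: eq_measure_integral => A mA _; exact/esym/lebesgue_measureN.
rewrite ge0_integral_pushforward//=.
by apply/measurable_EFinP; exact: measurableT_comp.
Qed.

(** Lebesgue measure is its own image under [-%R], so reflection is a change of measure and applies
    to measurable [f]. *)
Lemma Rintegral_opp_arg D f : measurable D -> measurable_fun [set: measurableTypeR R] f -> ibl setT f ->
  \int[mu]_(x in -%R @^-1` D) f (- x) = \int[mu]_(x in D) f x.
Proof.
move=> mD mf fi.
have mo : measurable_fun [set: measurableTypeR R] (-%R : _ -> measurableTypeR R).
  by apply: continuous_measurable_fun; exact: opp_continuous.
congr fine.
transitivity (\int[pushforward mu (-%R : _ -> measurableTypeR R)]_(x in D) (f x)%:E)%E.
  rewrite (@integral_pushforward _ _ _ _ _ _ mo mu D (EFin \o f))//.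
    exact/measurable_EFinP.
  apply: (integrable_subset measurableT) => //.
    by rewrite -[X in measurable X]setTI; exact: mo.
  exact: integrable_opp_arg.
apply: eq_measure_integral => A mA _; exact/lebesgue_measureN.
Qed.

Lemma Rintegral_setT_opp f : measurable_fun [set: measurableTypeR R] f -> ibl setT f ->
  \int[mu]_x f (- x) = \int[mu]_x f x.
Proof. by move=> mf fi; rewrite -[RHS]Rintegral_opp_arg// preimage_setT. Qed.

Lemma Rintegral_fold f : measurable_fun [set: measurableTypeR R] f -> ibl setT f ->
  \int[mu]_x f x = \int[mu]_(x in `]0, +oo[) (f x + f (- x)).
Proof.
move=> mf fi.
have mi (i : interval R) : measurable ([set` i] : set (measurableTypeR R)).
  exact: measurable_itv.
have fi2 (i : interval R) : ibl [set` i] f.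
  exact: (integrable_subset measurableT).
have -> : [set: measurableTypeR R] = `]-oo, 0] `|` `]0, +oo[.
  by rewrite -itv_bndbnd_setU// set_itvNyy.
rewrite Rintegral_setU//; first 1 last.
- by apply: (integrable_subset measurableT) => //; exact: measurableU.
- by apply/disj_setPS => y [/=]; rewrite 2!in_itv/= andbT => y0 /(le_lt_trans y0); rewrite ltxx.
rewrite addrC RintegralD//; last first.
  by apply: (integrable_subset measurableT) => //; exact: integrable_opp_arg.
congr (_ + _); rewrite -Rintegral_opp_arg//.
have -> : -%R @^-1` `]-oo, 0] = [set` `[0, +oo[] :> set (measurableTypeR R).
  by apply/seteqP; split => x /=; rewrite !in_itv/= andbT oppr_le0.
rewrite -Rintegral_itv_obnd_cbnd//.
by apply: (integrable_subset measurableT) => //; exact: integrable_opp_arg.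
Qed.

(** The common majorant: exponential bounds are compared with it through [expR_cauchy], and it
    dominates the Bessel kernels along lines in the descent. *)
Lemma cauchy_integrable : ibl setT (fun x => (1 + x ^+ 2)^-1).
Proof.
apply/integrableP; split.
  apply/measurable_EFinP; apply: continuous_measurable_fun.
  exact: continuous_oneDsqrV.
under eq_integral do rewrite /=.
rewrite (_ : (\int[mu]_x _)%E = (\int[mu]_x ((oneDsqr x)^-1)%:E)%E); last first.
  by apply: eq_integral => x _ /=; rewrite ger0_norm// invr_ge0 addr_ge0// sqr_ge0.
rewrite ge0_symfun_integralT.
- rewrite (_ : [set x | _] = `[0, +oo[%classic); last first.
    by apply/seteqP; split => x/=; rewrite in_itv/= andbT.
  by rewrite integral0y_oneDsqr -EFinM ltry.
- by move=> x; rewrite invr_ge0.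
- exact: continuous_oneDsqrV.
- by move=> x /=; rewrite /oneDsqr sqrrN.
Qed.

Lemma expR_cauchy a : 0 < a -> exists2 C : R, 0 < C &
  forall x, expR (- (a * `|x|)) <= C / (1 + x ^+ 2).
Proof.
(* With t = a |x|, the summand 1 is covered by e^t >= 1 + t and the summand x^2 by e^t >= t^2 / 2,
   which costs 2 / a^2. *)
move=> a0; exists (1 + 2 / a ^+ 2).
  by rewrite ltr_pwDl// divr_ge0// sqr_ge0.
move=> x; rewrite ler_pdivlMr ?ltr_pwDl ?sqr_ge0// expRN mulrC ler_pdivrMr ?expR_gt0//.
set t := a * `|x|; have t0 : 0 <= t by rewrite mulr_ge0// ltW.
have e1 : 1 + t <= expR t by exact: expR_ge1Dx.
have e2 : t ^+ 2 / 2 <= expR t.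
  by have := expR_ge1Dxn 1 t0; rewrite (_ : 2`! = 2)%N//; lra.
rewrite mulrDl mul1r lerD//; first by rewrite (le_trans _ e1)// lerDl.
rewrite mulrAC ler_pdivlMr ?exprn_gt0//.
have : t ^+ 2 = a ^+ 2 * x ^+ 2 by rewrite exprMn real_normK ?num_real.
by move=> tE; move: e2; rewrite tE; lra.
Qed.

Lemma expr_le_expR (j : nat) a : 0 < a -> exists2 C : R, 0 < C &
  forall x, `|x| ^+ j <= C * expR (a * `|x|).
Proof.
move=> a0; case: j => [|j].
  exists 1 => // x; rewrite expr0 mul1r -expR0 ler_expR mulr_ge0// ltW//.
exists (j.+1`!%:R / a ^+ j.+1).
  by rewrite divr_gt0 ?exprn_gt0// ltr0n fact_gt0.
move=> x; have t0 : 0 <= a * `|x| by rewrite mulr_ge0// ltW.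
have : (a * `|x|) ^+ j.+1 / j.+1`!%:R <= expR (a * `|x|).
  by rewrite (le_trans _ (expR_ge1Dxn j t0))// lerDr.
rewrite ler_pdivrMr ?ltr0n ?fact_gt0// exprMn => h.
by rewrite mulrAC ler_pdivlMr ?exprn_gt0// mulrC (le_trans h)// mulrC.
Qed.

Lemma integrable_le_expR D f (a C : R) : measurable D -> measurable_fun D f ->
  0 < a -> (forall x, D x -> `|f x| <= C * expR (- (a * `|x|))) -> ibl D f.
Proof.
move=> mD mf a0 fC; have [K K0 eK] := expR_cauchy a0.
apply: (@integrable_dominated _ _ _ (fun x => (`|C| * K) * (1 + x ^+ 2)^-1)) => //.
  apply: integrable_scale => //; apply: (integrable_subset measurableT) => //.
  exact: cauchy_integrable.
move=> x Dx; rewrite (le_trans (fC x Dx))// (le_trans (ler_wpM2r _ (ler_norm C)))//.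
by rewrite -mulrA ler_wpM2l.
Qed.

Lemma cst_on_itv_derive0 F (u v : R) : (forall x, u < x < v -> is_derive x (1 : R) F 0) ->
  forall x y, u < x < v -> u < y < v -> F x = F y.
Proof.
move=> dF.
suff h x y : x < y -> u < x -> y < v -> F x = F y.
  move=> x y /andP[ux xv] /andP[uy yv]; have [xy|yx|->//] := ltgtP x y.
    exact: h.
  by apply/esym/h.
move=> xy ux yv.
have dI z : x <= z <= y -> is_derive z (1 : R) F 0.
  by move=> /andP[xz zy]; apply: dF; rewrite (lt_le_trans ux) ?(le_lt_trans zy).
have [||c _] := @MVT R F (fun=> 0) x y xy.
- by move=> z; rewrite in_itv/= => /andP[/ltW ? /ltW ?]; apply: dI; apply/andP.
- apply: continuous_in_subspaceT => z; rewrite inE/= in_itv/= => /dI.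
  exact: is_derive_continuous_at.
- by rewrite mul0r => /eqP; rewrite subr_eq0 => /eqP.
Qed.

Lemma is_derive_under_integral D (f f' : R -> R -> R) (G : R -> R) a (u v : R) :
  measurable D -> u < a < v ->
  (forall x, u < x < v -> ibl D (f x)) ->
  (forall x y, u < x < v -> D y -> is_derive x (1 : R) (f ^~ y) (f' x y)) ->
  ibl D G -> (forall x y, u < x < v -> D y -> `|f' x y| <= G y) ->
  is_derive a (1 : R) (fun x => \int[mu]_(y in D) f x y) (\int[mu]_(y in D) f' a y).
Proof.
move=> mD uav fi df Gi fG.
have Ia : `]u, v[%classic a by rewrite /= in_itv.
have h1 x : `]u, v[%classic x -> ibl D (f x) by rewrite /= in_itv; exact: fi.
have h2 x y : `]u, v[%classic x -> D y -> derivable (f ^~ y) x 1.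
  by rewrite /= in_itv/= => ux Dy; have [] := df x y ux Dy.
pose G' y := `|G y|.
have h3 x y : `]u, v[%classic x -> D y -> `|partial1of2 f x y| <= G' y.
  rewrite /= in_itv/= => ux Dy; have dfx := df x y ux Dy.
  rewrite partial1of2E derive_val (le_trans (fG x y ux Dy))//; exact: ler_norm.
have G0 y : 0 <= G' y by exact: normr_ge0.
have iG' : ibl D G' by exact: integrable_norm.
have dF := derivable_under_integral mD Ia h1 h2 G0 iG' h3.
apply: DeriveDef => //.
rewrite -derive1E (differentiation_under_integral mD Ia h1 h2 G0 iG' h3).
apply: eq_Rintegral => y /set_mem Dy.
have dfx := df a y uav Dy.
by rewrite partial1of2E derive_val.
Qed.

End RealSubstitutions.

(** * Holomorphic functions on horizontal lines *)

Section ComplexCalculus.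
Context {R : realType}.
Implicit Types (z w : R[i]) (x y t : R).
Local Notation Re := (@complex.Re R).
Local Notation Im := (@complex.Im R).
Local Notation normc := (@Normc.normc R).

Lemma cplx_eq z w : Re z = Re w -> Im z = Im w -> z = w.
Proof. by case: z w => a b [c d] /= -> ->. Qed.

Lemma cReD z w : Re (z + w) = Re z + Re w. Proof. by case: z w => a b [c d]. Qed.
Lemma cImD z w : Im (z + w) = Im z + Im w. Proof. by case: z w => a b [c d]. Qed.
Lemma cReN z : Re (- z) = - Re z. Proof. by case: z. Qed.
Lemma cImN z : Im (- z) = - Im z. Proof. by case: z. Qed.
Lemma cReM z w : Re (z * w) = Re z * Re w - Im z * Im w.
Proof. by case: z w => a b [c d]. Qed.
Lemma cImM z w : Im (z * w) = Re z * Im w + Im z * Re w.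
Proof. by case: z w => a b [c d]. Qed.
Lemma cReV z : Re z^-1 = Re z / (Re z ^+ 2 + Im z ^+ 2).
Proof. by case: z. Qed.
Lemma cImV z : Im z^-1 = - Im z / (Re z ^+ 2 + Im z ^+ 2).
Proof. by case: z => a b /=; rewrite mulNr. Qed.

Definition cReImE := (cReD, cImD, cReN, cImN, cReM, cImM).

Lemma sumsq_neq0 z : z != 0 -> Re z ^+ 2 + Im z ^+ 2 != 0.
Proof.
case: z => a b; rewrite eq_complex /= negb_and => ab.
by rewrite paddr_eq0 ?sqr_ge0// !sqrf_eq0 negb_and.
Qed.

Lemma normcE2 z : normc z = Num.sqrt (Re z ^+ 2 + Im z ^+ 2).
Proof. by case: z. Qed.

Lemma normc_ge0 z : 0 <= normc z.
Proof. by rewrite normcE2 sqrtr_ge0. Qed.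

Lemma normc_sqr z : normc z ^+ 2 = Re z ^+ 2 + Im z ^+ 2.
Proof. by rewrite normcE2 sqr_sqrtr// addr_ge0 ?sqr_ge0. Qed.

Lemma Re_le_normc z : `|Re z| <= normc z.
Proof. by rewrite -sqrtr_sqr normcE2 ler_wsqrtr// lerDl sqr_ge0. Qed.

Lemma Im_le_normc z : `|Im z| <= normc z.
Proof. by rewrite -sqrtr_sqr normcE2 ler_wsqrtr// lerDr sqr_ge0. Qed.

Lemma normc_real x : normc x%:C = `|x|.
Proof. by rewrite normcE2 /= expr0n addr0 sqrtr_sqr. Qed.

Lemma normc_i : normc 'i = 1.
Proof. by rewrite normcE2 /= expr0n expr1n add0r sqrtr1. Qed.

Lemma normcX z (n : nat) : normc (z ^+ n) = normc z ^+ n.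
Proof.
elim: n => [|n IH]; first by rewrite !expr0 -[1]/(1%:C) normc_real normr1.
by rewrite !exprS Normc.normcM IH.
Qed.

Lemma normc_le_ReIm z : normc z <= `|Re z| + `|Im z|.
Proof.
rewrite -[X in X <= _]ger0_norm ?normc_ge0// -[X in _ <= X]ger0_norm ?addr_ge0//.
rewrite -ler_sqr ?nnegrE// !real_normK ?num_real// normc_sqr.
rewrite sqrrD !real_normK ?num_real//.
have : 0 <= `|Re z| * `|Im z| by rewrite mulr_ge0.
by rewrite mulr2n; lra.
Qed.

Lemma normc_eq0 z : (normc z == 0) = (z == 0).
Proof.
apply/eqP/eqP => [|->]; first exact: Normc.eq0_normc.
by rewrite -[0]/(0%:C) normc_real normr0.
Qed.

Lemma normc_cexp z : normc (cexp z) = expR (Re z).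
Proof.
rewrite /cexp Normc.normcM normc_real ger0_norm ?expR_ge0//.
by rewrite normcE2 /= cos2Dsin2 sqrtr1 mulr1.
Qed.

Lemma cexp_neq0 z : cexp z != 0.
Proof. by rewrite -normc_eq0 normc_cexp gt_eqF// expR_gt0. Qed.

Lemma cexpN z : cexp (- z) = (cexp z)^-1.
Proof.
apply: (mulfI (cexp_neq0 z)); rewrite -cexpD subrr cexp0 divff//.
exact: cexp_neq0.
Qed.

Lemma cexp_real x : cexp x%:C = (expR x)%:C.
Proof. by rewrite /cexp /= cos0 sin0 mulr1. Qed.

(** Derivative along a real curve, taken by coordinates so that real calculus applies to each
    part. *)
Definition cder (f : R -> R[i]) x (d : R[i]) :=
  is_derive x (1 : R) (fun t => Re (f t)) (Re d) /\
  is_derive x (1 : R) (fun t => Im (f t)) (Im d).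

Lemma cder_eq f x d d' : cder f x d -> d = d' -> cder f x d'.
Proof. by move=> ? <-. Qed.

Lemma cder_cst z x : cder (fun=> z) x 0.
Proof. by split; exact: is_derive_cst. Qed.

Lemma cder_realid x : cder (fun t => t%:C) x 1.
Proof. by split => /=; [exact: is_derive_id|exact: is_derive_cst]. Qed.

Lemma cder_add f g x d e : cder f x d -> cder g x e ->
  cder (fun t => f t + g t) x (d + e).
Proof.
move=> [fr fi] [gr gi]; split; rewrite !cReImE.
  by under eq_fun do rewrite cReD; exact: is_deriveD.
by under eq_fun do rewrite cImD; exact: is_deriveD.
Qed.

Lemma cder_mul f g x d e : cder f x d -> cder g x e ->
  cder (fun t => f t * g t) x (d * g x + f x * e).
Proof.
move=> [fr fi] [gr gi]; split; rewrite !cReImE.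
  under eq_fun do rewrite cReM.
  apply: (is_derive_eq (is_deriveB (is_deriveM fr gr) (is_deriveM fi gi))).
  by rewrite /GRing.scale /=; ring.
under eq_fun do rewrite cImM.
apply: (is_derive_eq (is_deriveD (is_deriveM fr gi) (is_deriveM fi gr))).
by rewrite /GRing.scale /=; ring.
Qed.

Lemma cder_opp f x d : cder f x d -> cder (fun t => - f t) x (- d).
Proof.
move=> fd; have := cder_mul (cder_cst (-1) x) fd.
by under eq_fun do rewrite mulN1r; rewrite mul0r add0r mulN1r.
Qed.

Lemma cder_cexp f x d : cder f x d ->
  cder (fun t => cexp (f t)) x (cexp (f x) * d).
Proof.
move=> [fr fi].
have er : is_derive x (1 : R) (fun t => expR (Re (f t))) (Re d * expR (Re (f x))).
  have h := is_derive_expR (Re (f x)).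
  by apply: (is_derive_eq (is_derive1_comp h fr)); rewrite mulrC.
have ci : is_derive x (1 : R) (fun t => cos (Im (f t))) (- (Im d * sin (Im (f x)))).
  have h := is_derive_cos (Im (f x)).
  by apply: (is_derive_eq (is_derive1_comp h fi)); rewrite mulNr mulrC.
have si : is_derive x (1 : R) (fun t => sin (Im (f t))) (Im d * cos (Im (f x))).
  have h := is_derive_sin (Im (f x)).
  by apply: (is_derive_eq (is_derive1_comp h fi)); rewrite mulrC.
have Rc z : Re (cexp z) = expR (Re z) * cos (Im z).
  by rewrite /cexp cReM /= mul0r subr0.
have Ic z : Im (cexp z) = expR (Re z) * sin (Im z).
  by rewrite /cexp cImM /= mul0r addr0.
split.
  rewrite cReM !(Rc, Ic); under eq_fun do rewrite Rc.
  apply: (is_derive_eq (is_deriveM er ci)).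
  by rewrite /GRing.scale /=; ring.
rewrite cImM !(Rc, Ic); under eq_fun do rewrite Ic.
apply: (is_derive_eq (is_deriveM er si)).
by rewrite /GRing.scale /=; ring.
Qed.

Lemma cder_inv f x d : f x != 0 -> cder f x d ->
  cder (fun t => (f t)^-1) x (- d / (f x) ^+ 2).
Proof.
move=> f0 [fr fi]; have s0 := sumsq_neq0 f0.
have nd : is_derive x (1 : R) (fun t => Re (f t) ^+ 2 + Im (f t) ^+ 2)
    (2 * Re (f x) * Re d + 2 * Im (f x) * Im d).
  under eq_fun do rewrite !expr2.
  apply: (is_derive_eq (is_deriveD (is_deriveM fr fr) (is_deriveM fi fi))).
  by rewrite /GRing.scale /=; ring.
pose q t := Re (f t) ^+ 2 + Im (f t) ^+ 2.
have vd := @is_deriveV _ q x _ _ s0 nd; rewrite /q in vd.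
have -> : - d / f x ^+ 2 = - d * ((f x)^-1 * (f x)^-1) by rewrite expr2 invfM.
split.
  under eq_fun do rewrite cReV.
  apply: (is_derive_eq (is_deriveM fr vd)).
  rewrite !cReImE !(cReV, cImV) /GRing.scale /=.
  by move: (Re (f x)) (Im (f x)) (Re d) (Im d) s0 => A B C D s0; field.
under eq_fun do rewrite cImV.
apply: (is_derive_eq (is_deriveM (is_deriveN fi) vd)).
rewrite !cReImE !(cReV, cImV) /GRing.scale /= -[(- _) x]/(- Im (f x)).
by move: (Re (f x)) (Im (f x)) (Re d) (Im d) s0 => A B C D s0; field.
Qed.

Lemma cder_continuous f x d : cder f x d ->
  {for x, continuous (fun t => Re (f t))} /\ {for x, continuous (fun t => Im (f t))}.
Proof. by move=> [/is_derive_continuous_at ? /is_derive_continuous_at ?]. Qed.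

(* Holomorphy as a chain rule along curves: it composes without any calculus in
   two real variables. *)
Definition holo_at (F : R[i] -> R[i]) z (d : R[i]) :=
  forall (g : R -> R[i]) t e, g t = z -> cder g t e -> cder (fun u => F (g u)) t (d * e).

Lemma holo_at_eq F z d d' : holo_at F z d -> d = d' -> holo_at F z d'.
Proof. by move=> ? <-. Qed.

Lemma holo_cst c z : holo_at (fun=> c) z 0.
Proof. by move=> g t e _ _; rewrite mul0r; exact: cder_cst. Qed.

Lemma holo_id z : holo_at id z 1.
Proof. by move=> g t e _; rewrite mul1r. Qed.

Lemma holo_add F G z d e : holo_at F z d -> holo_at G z e ->
  holo_at (fun w => F w + G w) z (d + e).
Proof.
by move=> dF dG g t h gt dg; rewrite mulrDl; apply: cder_add; [exact: dF|exact: dG].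
Qed.

Lemma holo_mul F G z d e : holo_at F z d -> holo_at G z e ->
  holo_at (fun w => F w * G w) z (d * G z + F z * e).
Proof.
move=> dF dG g t h gt dg.
apply: (cder_eq (cder_mul (dF _ _ _ gt dg) (dG _ _ _ gt dg))).
by rewrite gt; ring.
Qed.

Lemma holo_exp F z d : holo_at F z d ->
  holo_at (fun w => cexp (F w)) z (cexp (F z) * d).
Proof.
move=> dF g t h gt dg; apply: (cder_eq (cder_cexp (dF _ _ _ gt dg))).
by rewrite gt mulrA.
Qed.

Lemma holo_inv F z d : F z != 0 -> holo_at F z d ->
  holo_at (fun w => (F w)^-1) z (- d / (F z) ^+ 2).
Proof.
move=> F0 dF g t h gt dg.
have Fg0 : F (g t) != 0 by rewrite gt.
apply: (cder_eq (@cder_inv (fun u => F (g u)) _ _ Fg0 (dF _ _ _ gt dg))).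
by rewrite gt; ring.
Qed.

Lemma holo_expn F z d (n : nat) : holo_at F z d ->
  holo_at (fun w => F w ^+ n) z (n%:R * F z ^+ n.-1 * d).
Proof.
move=> dF; elim: n => [|n IH]; first by rewrite !mul0r; exact: holo_cst.
under [X in holo_at X]eq_fun do rewrite exprS.
apply: (holo_at_eq (holo_mul dF IH)).
by case: n {IH} => [|n]; rewrite /= ?expr0 ?exprS -?[in RHS]nat1r; ring.
Qed.

End ComplexCalculus.

(** * Taylor remainders of the exponential and the complex hyperbolic sine *)

Section ComplexExp.
Context {R : realType}.
Implicit Types (z w : R[i]) (x y t : R).
Local Notation Re := (@complex.Re R).
Local Notation Im := (@complex.Im R).
Local Notation normc := (@Normc.normc R).

Lemma ge0_derive_le (F F' : R -> R) (a b : R) : a <= b ->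
  (forall t, a <= t <= b -> is_derive t (1 : R) F (F' t)) ->
  (forall t, a <= t <= b -> 0 <= F' t) -> F a <= F b.
Proof.
rewrite le_eqVlt => /predU1P[->//|ab] dF F0.
have [||c cab] := @MVT R F F' a b ab.
- by move=> z; rewrite in_itv/= => /andP[/ltW ? /ltW ?]; apply: dF; apply/andP.
- apply: continuous_in_subspaceT => z; rewrite inE/= in_itv/= => /dF.
  exact: is_derive_continuous_at.
- move=> E; rewrite -subr_ge0 E; apply: mulr_ge0; last by rewrite subr_ge0 ltW.
  by apply: F0; move: cab; rewrite in_itv/= => /andP[/ltW -> /ltW ->].
Qed.

Definition exp_poly (N : nat) z : R[i] := \sum_(r < N) z ^+ r / r`!%:R.
Definition cexp_rem (N : nat) z : R[i] := cexp z - exp_poly N z.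

Lemma factC_neq0 (n : nat) : (n`!%:R : R[i]) != 0.
Proof. by rewrite pnatr_eq0 -lt0n fact_gt0. Qed.

Lemma holo_exp_poly (N : nat) z : holo_at (exp_poly N) z (exp_poly N.-1 z).
Proof.
elim: N => [|N IH].
  rewrite /exp_poly big_ord0.
  by under [X in holo_at X]eq_fun do rewrite big_ord0; exact: holo_cst.
rewrite /exp_poly; under [X in holo_at X]eq_fun do rewrite big_ord_recr.
have h := holo_mul (holo_expn N (@holo_id _ z)) (@holo_cst _ (N`!%:R^-1) z).
apply: (holo_at_eq (holo_add IH h)) => /=.
case: N {IH h} => [|N] /=; first by rewrite /exp_poly !big_ord0; ring.
rewrite /exp_poly big_ord_recr /= factS natrM; congr (_ + _).
have := factC_neq0 N; have : (N.+1%:R : R[i]) != 0 by rewrite pnatr_eq0.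
by move: (N.+1%:R) N`!%:R => a b h1 h2; field; rewrite h1 h2.
Qed.

Lemma holo_cexp_rem (N : nat) z : holo_at (cexp_rem N) z (cexp_rem N.-1 z).
Proof.
rewrite /cexp_rem -mulN1r; under [X in holo_at X]eq_fun do rewrite -mulN1r.
have h := holo_mul (@holo_cst _ (-1) z) (@holo_exp_poly N z).
apply: (holo_at_eq (holo_add (holo_exp (@holo_id _ z)) h)).
by rewrite mulr1 mul0r add0r.
Qed.

Lemma cexp_rem0 (N : nat) : cexp_rem N.+1 0 = 0.
Proof.
rewrite /cexp_rem /exp_poly big_ord_recl cexp0 big1 ?addr0 => [|i _].
  by rewrite expr0 fact0 divr1 subrr.
by rewrite /= /bump /= add1n expr0n mul0r.
Qed.

Lemma derive_monomial (c K : R) (N : nat) t :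
  is_derive t (1 : R) (fun t => K * ((c * t) ^+ N.+1 / N.+1`!%:R))
    (K * (c * ((c * t) ^+ N / N`!%:R))).
Proof.
have -> : (fun t => K * ((c * t) ^+ N.+1 / N.+1`!%:R)) =
  (fun t => (K * c ^+ N.+1 / N.+1`!%:R) * t ^+ N.+1).
  by apply/funext => u; rewrite exprMn; ring.
have h := is_deriveM (is_derive_cst (K * c ^+ N.+1 / N.+1`!%:R) t 1)
  (is_deriveX N.+1 (is_derive_id t (1 : R))).
rewrite !fctE in h; apply: (is_derive_eq h).
rewrite /GRing.scale /= factS natrM exprMn exprS.
have : (N`!%:R : R) != 0 by rewrite pnatr_eq0 -lt0n fact_gt0.
have : (N.+1%:R : R) != 0 by rewrite pnatr_eq0.
by move: (N.+1%:R) (N`!%:R : R) => a b h1 h2; field; rewrite h1 h2.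
Qed.

(** Along the segment from 0 to [z] the derivative of the remainder of order N + 1 is [z] times the
    remainder of order N, so the bound follows by induction and comparison of derivatives. The base
    2 |z| instead of |z| pays for the two products in each coordinate of a complex
    multiplication. *)
Lemma cexp_rem_ReIm_le (N : nat) z t : 0 <= t <= 1 ->
  `|Re (cexp_rem N (z * t%:C))| <=
     expR (normc z) * ((2 * normc z * t) ^+ N / N`!%:R) /\
  `|Im (cexp_rem N (z * t%:C))| <=
     expR (normc z) * ((2 * normc z * t) ^+ N / N`!%:R).
Proof.
elim: N t => [|N IH] t /andP[t0 t1].
  rewrite expr0 fact0 divr1 mulr1 /cexp_rem /exp_poly big_ord0 subr0.
  have h : normc (cexp (z * t%:C)) <= expR (normc z).
    rewrite normc_cexp ler_expR cReM /= mulr0 subr0.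
    rewrite (le_trans (ler_norm _))// normrM (ger0_norm t0).
    rewrite (le_trans (ler_wpM2r t0 (Re_le_normc z)))//.
    by rewrite ler_piMr// normc_ge0.
  by split; rewrite (le_trans _ h)// ?Re_le_normc ?Im_le_normc.
pose F s := cexp_rem N.+1 (z * s%:C).
have dF s : cder F s (cexp_rem N (z * s%:C) * z).
  apply: (@holo_cexp_rem N.+1 _ (fun s => z * s%:C) s z) => //.
  by apply: (cder_eq (cder_mul (cder_cst z s) (cder_realid s))); ring.
pose K := expR (normc z); pose c := 2 * normc z.
have F0 : F 0 = 0 by rewrite /F mulr0 cexp_rem0.
have bd s : 0 <= s <= t -> `|Re (cexp_rem N (z * s%:C) * z)| <=
    K * (c * ((c * s) ^+ N / N`!%:R)) /\
   `|Im (cexp_rem N (z * s%:C) * z)| <= K * (c * ((c * s) ^+ N / N`!%:R)).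
  move=> /andP[s0 st]; have [|h1 h2] := IH s; first by rewrite s0 (le_trans st).
  have Rz := Re_le_normc z; have Iz := Im_le_normc z.
  set B := K * ((c * s) ^+ N / N`!%:R).
  have -> : K * (c * ((c * s) ^+ N / N`!%:R)) = B * normc z + B * normc z.
    by rewrite /B /c; ring.
  by split; rewrite ?cReM ?cImM; apply: (le_trans (ler_normD _ _));
    rewrite ?normrN !normrM lerD// ler_pM.
have fin (u : R[i] -> R) : u 0 = 0 ->
   (forall s, 0 <= s <= t ->
     is_derive s (1 : R) (fun s => u (F s)) (u (cexp_rem N (z * s%:C) * z)) /\
    `|u (cexp_rem N (z * s%:C) * z)| <= K * (c * ((c * s) ^+ N / N`!%:R))) ->
   `|u (F t)| <= K * ((c * t) ^+ N.+1 / N.+1`!%:R).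
  move=> u0 h.
  have dm s := derive_monomial c K N s.
  rewrite ler_norml -subr_ge0 opprK addrC; apply/andP; split.
    have := @ge0_derive_le (fun s => K * ((c * s) ^+ N.+1 / N.+1`!%:R) + u (F s)) _ 0 t t0
      (fun s hs => is_deriveD (dm s) (h s hs).1).
    rewrite F0 u0 mulr0 expr0n mul0r mulr0 addr0; apply => s /h[_].
    by rewrite ler_norml => /andP[+ _]; lra.
  rewrite -subr_ge0.
  have := @ge0_derive_le (fun s => K * ((c * s) ^+ N.+1 / N.+1`!%:R) - u (F s)) _ 0 t t0
      (fun s hs => is_deriveB (dm s) (h s hs).1).
  rewrite F0 u0 mulr0 expr0n mul0r mulr0 subr0; apply => s /h[_].
  by rewrite ler_norml => /andP[_]; lra.
split; apply: fin => // s hs; have [dr di] := dF s; have [] := bd s hs; split => //.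
Qed.

Lemma cexp_rem_le (N : nat) z :
  normc (cexp_rem N z) <= 2 * (expR (normc z) * ((2 * normc z) ^+ N / N`!%:R)).
Proof.
have [|h1 h2] := @cexp_rem_ReIm_le N z 1; first by rewrite ler01 lexx.
rewrite !mulr1 in h1 h2; rewrite (le_trans (normc_le_ReIm _))//.
by rewrite mulr_natl mulr2n lerD.
Qed.

Definition csinh z : R[i] := (cexp z - cexp (- z)) / 2.
Definition ccosh z : R[i] := (cexp z + cexp (- z)) / 2.

Lemma csinhN z : csinh (- z) = - csinh z.
Proof. by rewrite /csinh opprK -[in RHS]mulNr opprB. Qed.

Lemma csinh_real x : csinh x%:C = (sinh x)%:C.
Proof.
rewrite /csinh /sinh -rmorphN !cexp_real -rmorphB.
by rewrite -(rmorph_nat (real_complex R) 2) -fmorph_div.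
Qed.

Lemma cexp_ipi : cexp (pi *i : R[i]) = -1.
Proof.
rewrite /cexp /= expR0 mul1r cospi sinpi.
by apply/eqP; rewrite eq_complex /= oppr0 !eqxx.
Qed.

Lemma csinh_sub_ipi z : csinh (z - pi *i) = - csinh z.
Proof.
rewrite /csinh opprB [pi *i + _]addrC !cexpD !cexpN cexp_ipi invrN invr1.
by ring.
Qed.

Lemma holo_csinh z : holo_at csinh z (ccosh z).
Proof.
have hN : holo_at (fun w => - w) z (-1).
  under [X in holo_at X]eq_fun do rewrite -mulN1r.
  by apply: (holo_at_eq (holo_mul (@holo_cst _ (-1) z) (@holo_id _ z))); ring.
have e1 := holo_exp (@holo_id _ z); have e2 := holo_exp hN.
rewrite /csinh; under [X in holo_at X]eq_fun do rewrite -[- cexp _]mulN1r.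
apply: (holo_at_eq (holo_mul (holo_add e1 (holo_mul (@holo_cst _ (-1) z) e2)) (@holo_cst _ 2^-1 z))).
by rewrite /ccosh; ring.
Qed.

Lemma sinhE2 x : (expR x + expR (- x)) ^+ 2 = 4 * sinh x ^+ 2 + 4.
Proof.
have h : expR x * expR (- x) = 1 by rewrite -expRD subrr expR0.
by rewrite /sinh exprMn sqrrB sqrrD h; field.
Qed.

(** Source of the lower bounds for sinh: [sin y] keeps it away from 0 on interior lines, [sinh x]
    gives growth at infinity, and the two together give a multiple of |z| near 0. *)
Lemma normc_csinh_sqr x y : normc (csinh (x +i* y)) ^+ 2 = sinh x ^+ 2 + sin y ^+ 2.
Proof.
have -> : csinh (x +i* y) = (sinh x * cos y) +i* ((expR x + expR (- x)) / 2 * sin y).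
  rewrite /csinh /sinh /cexp /= cosN sinN.
  have -> : (2 : R[i])^-1 = (2^-1)%:C by rewrite fmorphV rmorph_nat.
  by apply: cplx_eq; rewrite /=; ring.
rewrite normc_sqr /=; move: (sinhE2 x) (cos2Dsin2 y).
move: (sinh x) (expR x + expR (- x)) (cos y) (sin y) => S C c d hC hc.
rewrite !exprMn hC.
have -> : c ^+ 2 = 1 - d ^+ 2 by rewrite -hc addrK.
by field.
Qed.

End ComplexExp.

(** * Exponential growth of entire functions in a strip *)

Section GrowthClasses.
Context {R : realType}.
Implicit Types (z w : R[i]) (x y t a b : R) (F G : R[i] -> R[i]).
Local Notation Re := (@complex.Re R).
Local Notation Im := (@complex.Im R).
Local Notation normc := (@Normc.normc R).

Definition strip_growth a F := exists2 M : R, 0 <= M &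
  forall x y, `|y| <= pi -> normc (F (x +i* y)) <= M * expR (a * `|x|).

Lemma strip_growth_le a b F : a <= b -> strip_growth a F -> strip_growth b F.
Proof.
move=> ab [M M0 h]; exists M => // x y yp; rewrite (le_trans (h x y yp))// ler_wpM2l//.
by rewrite ler_expR ler_wpM2r.
Qed.

Lemma strip_growth_add a F G : strip_growth a F -> strip_growth a G ->
  strip_growth a (fun z => F z + G z).
Proof.
move=> [M M0 h] [K K0 k]; exists (M + K); first exact: addr_ge0.
move=> x y yp; rewrite (le_trans (le_normcD _ _))// mulrDl lerD//; [exact: h|exact: k].
Qed.

Lemma strip_growth_mul a b F G : strip_growth a F -> strip_growth b G ->
  strip_growth (a + b) (fun z => F z * G z).
Proof.
move=> [M M0 h] [K K0 k]; exists (M * K); first exact: mulr_ge0.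
move=> x y yp; rewrite Normc.normcM mulrDl expRD mulrACA ler_pM ?normc_ge0//.
- exact: h.
- exact: k.
Qed.

Lemma strip_growth_cst a z : 0 <= a -> strip_growth a (fun=> z).
Proof.
move=> a0; exists (normc z); first exact: normc_ge0.
by move=> x y _; rewrite ler_peMr ?normc_ge0// -expR0 ler_expR mulr_ge0.
Qed.

Lemma strip_growth_id a : 0 < a -> strip_growth a id.
Proof.
move=> a0; have [C C0 h] := expr_le_expR 1 a0.
exists (C + pi); first by rewrite addr_ge0 ?pi_ge0 ?ltW.
move=> x y yp; rewrite (le_trans (normc_le_ReIm _))//= mulrDl lerD//.
  by have := h x; rewrite expr1.
by rewrite (le_trans yp)// ler_peMr ?pi_ge0// -expR0 ler_expR mulr_ge0// ltW.
Qed.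

Lemma strip_growth_exp w : strip_growth `|Re w| (fun z => cexp (w * z)).
Proof.
exists (expR (`|Im w| * pi)); first exact: expR_ge0.
move=> x y yp; rewrite normc_cexp -expRD ler_expR cReM /=.
rewrite (le_trans (ler_norm _))// (le_trans (ler_normD _ _))// normrN !normrM addrC.
by rewrite lerD// ler_wpM2l.
Qed.

(* [F2] only serves to make [F1] continuous along lines. *)
Definition entire_growth a F := exists F1 F2 : R[i] -> R[i],
  [/\ forall z, holo_at F z (F1 z), forall z, holo_at F1 z (F2 z),
      strip_growth a F & strip_growth a F1].

Lemma entire_growth_le a b F : a <= b -> entire_growth a F -> entire_growth b F.
Proof.
by move=> ab [F1 [F2 [h1 h2 h3 h4]]]; exists F1, F2; split => //; exact: strip_growth_le ab _.
Qed.

Lemma entire_growth_add a F G : entire_growth a F -> entire_growth a G ->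
  entire_growth a (fun z => F z + G z).
Proof.
move=> [F1 [F2 [f1 f2 f3 f4]]] [G1 [G2 [g1 g2 g3 g4]]].
exists (fun z => F1 z + G1 z), (fun z => F2 z + G2 z); split.
- by move=> z; exact: holo_add.
- by move=> z; exact: holo_add.
- exact: strip_growth_add.
- exact: strip_growth_add.
Qed.

Lemma entire_growth_mul a b F G : entire_growth a F -> entire_growth b G ->
  entire_growth (a + b) (fun z => F z * G z).
Proof.
move=> [F1 [F2 [f1 f2 f3 f4]]] [G1 [G2 [g1 g2 g3 g4]]].
exists (fun z => F1 z * G z + F z * G1 z); eexists; split.
- by move=> z; exact: holo_mul.
- by move=> z; apply: holo_add; exact: holo_mul.
- exact: strip_growth_mul.
- by apply: strip_growth_add; exact: strip_growth_mul.
Qed.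

Lemma entire_growth_cst a z : 0 <= a -> entire_growth a (fun=> z).
Proof.
move=> a0; exists (fun=> 0), (fun=> 0); split.
- by move=> w; exact: holo_cst.
- by move=> w; exact: holo_cst.
- exact: strip_growth_cst.
- exact: strip_growth_cst.
Qed.

Lemma entire_growth_id a : 0 < a -> entire_growth a id.
Proof.
move=> a0; exists (fun=> 1), (fun=> 0); split.
- by move=> w; exact: holo_id.
- by move=> w; exact: holo_cst.
- exact: strip_growth_id.
- by apply: strip_growth_cst; exact: ltW.
Qed.

Lemma entire_growth_exp w : entire_growth `|Re w| (fun z => cexp (w * z)).
Proof.
have h z : holo_at (fun z => w * z) z w.
  by apply: (holo_at_eq (holo_mul (@holo_cst _ w z) (@holo_id _ z))); ring.
exists (fun z => cexp (w * z) * w); eexists; split.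
- by move=> z; exact: holo_exp.
- move=> z; apply: (holo_mul _ (@holo_cst _ w z)).
  exact: (holo_exp (h z)).
- exact: strip_growth_exp.
- rewrite -[X in strip_growth X _]addr0; apply: strip_growth_mul.
    exact: strip_growth_exp.
  exact: strip_growth_cst.
Qed.

Lemma entire_growth_expn a F (q : nat) : 0 <= a -> entire_growth a F ->
  entire_growth (q%:R * a) (fun z => F z ^+ q).
Proof.
move=> a0 Fa; elim: q => [|q IH].
  by apply: entire_growth_cst; rewrite mul0r.
rewrite -nat1r mulrDl mul1r; under [X in entire_growth _ X]eq_fun do rewrite exprS.
exact: entire_growth_mul.
Qed.

(** Powers cost an arbitrarily small exponential rate: each of the q factors receives a / (q +
    1). *)
Lemma entire_growth_pow a (q : nat) : 0 < a -> entire_growth a (fun z => z ^+ q).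
Proof.
move=> a0; have b0 : 0 < a / q.+1%:R by rewrite divr_gt0.
have := entire_growth_expn q (ltW b0) (entire_growth_id b0).
apply: entire_growth_le; rewrite mulrCA ler_piMr ?(ltW a0)//.
by rewrite ler_pdivrMr// mul1r ler_nat.
Qed.

Lemma entire_growth_csinh : entire_growth 1 (@csinh R).
Proof.
have e1 := entire_growth_exp 1; have e2 := entire_growth_exp (-1).
rewrite /= normrN normr1 in e1 e2.
have c w : entire_growth 0 (fun=> w) by exact: entire_growth_cst.
have e3 := entire_growth_mul (c (-1)) e2; rewrite add0r in e3.
have := entire_growth_mul (entire_growth_add e1 e3) (c 2^-1); rewrite addr0.
congr entire_growth; apply/funext => z; rewrite /csinh mul1r [-1 * z]mulN1r.
by rewrite mulN1r.
Qed.

Lemma strip_growth_ccosh : strip_growth 1 (@ccosh R).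
Proof.
have e1 := strip_growth_exp 1; have e2 := strip_growth_exp (-1).
rewrite /= ?oppr0 ?normrN normr1 in e1 e2.
have c : strip_growth 0 (fun=> 2^-1) by exact: strip_growth_cst.
have := strip_growth_mul (strip_growth_add e1 e2) c; rewrite addr0.
by congr strip_growth; apply/funext => z; rewrite /ccosh mul1r mulN1r.
Qed.

End GrowthClasses.

Ltac nonneg := repeat first [ done | exact: ler0n | exact: expR_ge0
  | exact: normc_ge0 | exact: sqr_ge0 | exact: normr_ge0 | exact: ltW
  | apply: addr_ge0 | apply: mulr_ge0 | apply: exprn_ge0 ].

(** * Lower bounds for sinh and sin *)

Section SinhBounds.
Context {R : realType}.
Implicit Types (z w : R[i]) (x y t a b c : R) (F G : R[i] -> R[i]).
Local Notation Re := (@complex.Re R).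
Local Notation Im := (@complex.Im R).
Local Notation normc := (@Normc.normc R).
Local Notation mu := (@lebesgue_measure R).
Local Notation ibl D f := (mu.-integrable D (EFin \o f)).

Definition cintegrable (D : set (measurableTypeR R)) (f : R -> R[i]) :=
  ibl D (fun x => Re (f x)) /\ ibl D (fun x => Im (f x)).

Lemma expR_abs_le_cosh x : expR `|x| <= expR x + expR (- x).
Proof. by case: (ger0P x) => _; rewrite ?lerDl ?lerDr expR_ge0. Qed.

Lemma sinh_ge_expR x : 1 <= `|x| -> expR `|x| / 4 <= `|sinh x|.
Proof.
have h t : 1 <= t -> expR t / 4 <= sinh t.
  move=> t1; rewrite /sinh.
  have : expR (- t) <= expR t / 2.
    rewrite ler_pdivlMr// expRN -ler_pdivlMl ?invr_gt0 ?expR_gt0// invrK.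
    have := expR_ge1Dx t; have := expR_gt0 t; nra.
  lra.
have sN t : sinh (- t) = - sinh t by rewrite /sinh opprK -mulNr opprB.
move=> x1; case: (ger0P x) x1 => x0 x1.
  by rewrite (le_trans (h _ x1))// ler_norm.
by rewrite (le_trans (h _ x1))// sN -normrN ler_norm.
Qed.

(** Since (e cosh x)^2 = e^2 sinh^2 x + e^2, it is at most sinh^2 x + sin^2 y, while cosh x >= e^|x|
    / 2. *)
Lemma csinh_lower (e x y : R) : 0 <= e -> e <= 1 -> e <= sin y ->
  e / 2 * expR `|x| <= normc (csinh (x +i* y)).
Proof.
move=> e0 e1 ey; rewrite -ler_sqr ?nnegrE ?normc_ge0 ?mulr_ge0 ?expR_ge0 ?divr_ge0//.
rewrite normc_csinh_sqr.
have h : (e * (expR x + expR (- x)) / 2) ^+ 2 <= sinh x ^+ 2 + sin y ^+ 2.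
  have := sinhE2 x; move: (sinh x) (expR x + expR (- x)) => S C hC.
  have -> : (e * C / 2) ^+ 2 = e ^+ 2 * S ^+ 2 + e ^+ 2.
    by rewrite !exprMn hC; field.
  have e21 : e ^+ 2 <= 1 by rewrite expr_le1.
  have eq2 : e ^+ 2 <= sin y ^+ 2 by rewrite ler_sqr ?nnegrE ?(le_trans e0).
  by rewrite lerD// ler_piMl ?sqr_ge0.
rewrite (le_trans _ h)// ler_sqr ?nnegrE ?mulr_ge0 ?expR_ge0 ?divr_ge0 ?addr_ge0 ?expR_ge0//.
by have := expR_abs_le_cosh x; nra.
Qed.

Lemma expR_decay_cvg0 (F : R -> R) (b C : R) : 0 < b ->
  (forall x, `|F x| <= C * expR (- (b * `|x|))) ->
  F x @[x --> +oo] --> 0 /\ F x @[x --> -oo] --> 0.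
Proof.
move=> bp; suff h (G : R -> R) : (forall x, `|G x| <= C * expR (- (b * `|x|))) -> G x @[x --> +oo] --> 0.
  move=> FC; split; first exact: h.
  by apply/cvgNy_compNP; apply: h => x /=; rewrite (le_trans (FC _))// normrN.
move=> GC; apply/cvgr0Pnorm_le => e e0; near=> x.
have x1 : 0 < x by near: x; exact: nbhs_pinfty_gt.
have C0 : 0 <= C.
  by have := le_trans (normr_ge0 _) (GC 0); rewrite normr0 mulr0 oppr0 expR0 mulr1.
rewrite (le_trans (GC x))// (ger0_norm (ltW x1)) expRN -ler_pdivlMr ?invr_gt0 ?expR_gt0//.
have h : b^-1 * (e^-1 * C) <= x by near: x; apply: nbhs_pinfty_ge; exact: num_real.
move: h; rewrite ler_pdivrMl// ler_pdivrMl// => h.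
rewrite invrK (le_trans h)// ler_pM2l//.
by rewrite (le_trans _ (expR_ge1Dx _))// lerDr.
Unshelve. all: by end_near. Qed.

Lemma is_derive_sinh x : is_derive x (1 : R) sinh ((expR x + expR (- x)) / 2).
Proof.
have [h _] := @holo_csinh R x%:C (fun t => t%:C) x 1 erefl (cder_realid x).
have E : (fun t => Re (csinh t%:C)) = sinh by apply/funext => t; rewrite csinh_real.
rewrite E in h; apply: (is_derive_eq h).
rewrite mulr1 /ccosh -rmorphN !cexp_real -rmorphD -(rmorph_nat (real_complex R) 2).
by rewrite -fmorph_div.
Qed.

Lemma expR_addN_ge2 x : 2 <= expR x + expR (- x).
Proof. by have := expR_ge1Dx x; have := expR_ge1Dx (- x); lra. Qed.

Lemma sinh_ge_id x : 0 <= x -> x <= sinh x.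
Proof.
move=> x0; rewrite -subr_ge0.
have := @ge0_derive_le R (fun t => sinh t - t) _ 0 x x0
  (fun t _ => is_deriveB (is_derive_sinh t) (is_derive_id t 1)).
have -> : sinh 0 - 0 = 0 :> R by rewrite subr0 /sinh oppr0 subrr mul0r.
apply => t _.
by have := expR_addN_ge2 t; lra.
Qed.

Lemma sinhN x : sinh (- x) = - sinh x.
Proof. by rewrite /sinh opprK -mulNr opprB. Qed.

Lemma sqr_le_sinh_sqr x : x ^+ 2 <= sinh x ^+ 2.
Proof.
wlog x0 : x / 0 <= x.
  move=> h; have [/h//|/ltW x0] := leP 0 x.
  by rewrite -sqrrN -[leRHS]sqrrN -sinhN h// oppr_ge0.
by rewrite ler_sqr ?nnegrE ?(le_trans x0)// sinh_ge_id.
Qed.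

(** The difference has derivative cos t - cos 1, nonnegative on [0, 1] because cos decreases on
    [0, pi]. *)
Lemma cos1_mul_le_sin y : 0 <= y <= 1 -> cos 1 * y <= sin y.
Proof.
move=> /andP[y0 y1]; rewrite -subr_ge0.
have d t : is_derive t (1 : R) (fun t => sin t - cos 1 * t) (cos t - cos 1).
  apply: (is_derive_eq (is_deriveB (is_derive_sin t)
    (is_deriveM (is_derive_cst (cos 1 : R) t 1) (is_derive_id t (1 : R))))).
  by rewrite /GRing.scale /=; ring.
have := @ge0_derive_le R _ _ 0 y y0 (fun t _ => d t).
rewrite sin0 mulr0 subrr; apply => t /andP[t0 ty].
have t1 := le_trans ty y1; have p1 : 1 <= pi :> R.
  by rewrite (le_trans _ (pi_ge2 R))// ler1n.
by rewrite subr_ge0 leNgt ltr_cos ?in_itv/= ?ler01 ?t0 ?(le_trans t1) ?p1// -leNgt.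
Qed.

End SinhBounds.

(** * Moving the line [Im z = pi / 2] to the real axis *)

Section ContourShift.
Context {R : realType}.
Implicit Types (z w : R[i]) (x y t a b c : R) (F G : R[i] -> R[i]).
Local Notation Re := (@complex.Re R).
Local Notation Im := (@complex.Im R).
Local Notation normc := (@Normc.normc R).
Local Notation mu := (@lebesgue_measure R).
Local Notation ibl D f := (mu.-integrable D (EFin \o f)).

Variables (n : nat) (N : R[i] -> R[i]) (a : R).
Hypotheses (n0 : (0 < n)%N) (an : a < n%:R) (gN : entire_growth a N).

Let g z := N z * (csinh z)^-1 ^+ n.

Let sin_itv_lower c : 0 < c < pi -> exists e u v : R,
  [/\ 0 < e, e <= 1, 0 <= u /\ v <= pi, u < c < v &
      forall y, u < y < v -> e <= sin y].
Proof.
move=> /andP[c0 cpi]; have sc : 0 < sin c by rewrite sin_gt0_pi// c0 cpi.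
have : \forall y \near c, sin c / 2 < sin y.
  by apply: (cvgr_gt (sin c) (@continuous_sin R c)); lra.
move=> [d /= d0 hd].
exists (sin c / 2), (Num.max 0 (c - d)), (Num.min pi (c + d)); split.
- by rewrite divr_gt0.
- by rewrite ler_pdivrMr// mul1r (le_trans (sin_le1 c))// ler1n.
- by rewrite le_max lexx ge_min lexx.
- by rewrite gt_max lt_min c0 cpi/= ltrBlDr !ltrDl d0.
- move=> y; rewrite gt_max lt_min => /andP[/andP[_ cy] /andP[_ yc]].
  by apply/ltW/hd; rewrite /= ltr_norml; apply/andP; split; lra.
Qed.

Let csinh_neq0 x y : 0 < sin y -> csinh (x +i* y) != 0.
Proof.
move=> sy; rewrite -normc_eq0 -sqrf_eq0 normc_csinh_sqr.
by rewrite paddr_eq0 ?sqr_ge0// [sin y ^+ 2 == 0]sqrf_eq0 (gt_eqF sy) andbF.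
Qed.

Let cder_x c x : cder (fun t => t +i* c) x 1.
Proof. by split => /=; [exact: is_derive_id|exact: is_derive_cst]. Qed.

Let cder_y x c : cder (fun t => x +i* t) c 'i.
Proof. by split => /=; [exact: is_derive_cst|exact: is_derive_id]. Qed.

(** The second derivative [g2] serves to make [g1] continuous along lines. Both [g] and [g1] decay
    at the rate n - a: the factor cosh / sinh^(n+1) in [g1] costs no more at infinity than 1 /
    sinh^n. *)
Lemma quotient_derivative : exists g1 g2 : R[i] -> R[i],
  [/\ forall z, csinh z != 0 -> holo_at g z (g1 z),
      forall z, csinh z != 0 -> holo_at g1 z (g2 z) &
      forall e, 0 < e -> e <= 1 -> exists2 C : R, 0 <= C &
        forall x y, `|y| <= pi -> e <= sin y ->
        normc (g (x +i* y)) <= C * expR (- ((n%:R - a) * `|x|)) /\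
        normc (g1 (x +i* y)) <= C * expR (- ((n%:R - a) * `|x|))].
Proof.
have [N1 [N2 [dN dN1 [M M0 hM] [M1 M10 hM1]]]] := gN.
have [K K0 hK] := @strip_growth_ccosh R.
pose h z := (csinh z)^-1.
have dh z : csinh z != 0 -> holo_at h z (- ccosh z * h z * h z).
  move=> s0; apply: (holo_at_eq (holo_inv s0 (@holo_csinh _ z))).
  by rewrite /h expr2 invfM mulrA.
have dcc z : holo_at ccosh z (csinh z).
  have hN : holo_at (fun w => - w) z (-1).
    under [X in holo_at X]eq_fun do rewrite -mulN1r.
    by apply: (holo_at_eq (holo_mul (@holo_cst _ (-1) z) (@holo_id _ z))); ring.
  have e1 := holo_exp (@holo_id _ z); have e2 := holo_exp hN.
  apply: (holo_at_eq (holo_mul (holo_add e1 e2) (@holo_cst _ 2^-1 z))).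
  by rewrite /csinh; ring.
pose g1 z := N1 z * h z ^+ n + N z * (n%:R * h z ^+ n.-1 * (- ccosh z * h z * h z)).
exists g1; eexists; split.
- by move=> z s0; exact: (holo_mul (dN z) (holo_expn n (dh z s0))).
- move=> z s0; rewrite /g1; apply: holo_add.
    exact: (holo_mul (dN1 z) (holo_expn n (dh z s0))).
  apply: (holo_mul (dN z)); apply: holo_mul.
    exact: (holo_mul (@holo_cst _ n%:R z) (holo_expn n.-1 (dh z s0))).
  apply: (holo_mul _ (dh z s0)); apply: (holo_mul _ (dh z s0)).
  under [X in holo_at X]eq_fun do rewrite -mulN1r.
  exact: (holo_mul (@holo_cst _ (-1) z) (dcc z)).
(* By [csinh_lower], |1 / sinh z| <= (2 / e) e^(-|x|). *)
move=> e e0 e1; pose H : R := 2 / e.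
have H0 : 0 < H by rewrite divr_gt0.
pose C0 := M * H ^+ n; pose C1 := M1 * H ^+ n + M * (n%:R * H ^+ n.-1 * (K * H * H)).
have C00 : 0 <= C0 by rewrite mulr_ge0// exprn_ge0// ltW.
have C10 : 0 <= C1.
  by rewrite /C1; nonneg.
exists (C0 + C1); first exact: addr_ge0.
move=> x y yp ey; set E := expR (- ((n%:R - a) * `|x|)).
have hb : normc (h (x +i* y)) <= H * expR (- `|x|).
  rewrite Normc.normcV expRN.
  have L := csinh_lower x (ltW e0) e1 ey.
  rewrite -[H]invrK -invfM lef_pV2 ?posrE ?mulr_gt0 ?invr_gt0 ?expR_gt0//; last first.
    by rewrite (lt_le_trans _ L)// mulr_gt0 ?divr_gt0// expR_gt0.
  by rewrite /H invf_div.
have hbn q : normc (h (x +i* y) ^+ q) <= H ^+ q * expR (- (q%:R * `|x|)).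
  rewrite normcX -mulrN expRM_natl -exprMn.
  by rewrite lerXn2r ?nnegrE ?normc_ge0// mulr_ge0 ?expR_ge0 ?ltW.
have nE : normc (n%:R : R[i]) = n%:R.
  by rewrite -(rmorph_nat (real_complex R)) normc_real ger0_norm.
have EE : expR (a * `|x|) * expR (- (n%:R * `|x|)) = E by rewrite -expRD /E; congr expR; ring.
have ge : normc (g (x +i* y)) <= C0 * E.
  rewrite /g Normc.normcM -EE /C0 mulrACA ler_pM ?normc_ge0//; exact: hM.
split.
  by rewrite (le_trans ge)// ler_wpM2r ?expR_ge0// lerDl.
apply: (@le_trans _ _ (C1 * E)); last by rewrite ler_wpM2r ?expR_ge0// lerDr.
rewrite /g1 (le_trans (le_normcD _ _))// mulrDl lerD//.
  rewrite Normc.normcM -EE mulrACA ler_pM ?normc_ge0//; exact: hM1.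
rewrite !Normc.normcM normcN nE.
have EE2 : E = expR (a * `|x|) * (expR (- (n.-1%:R * `|x|)) * (expR `|x| * expR (- `|x|) * expR (- `|x|))).
  rewrite -EE; congr (_ * _); rewrite -!expRD; congr expR.
  by rewrite -[in LHS](prednK n0) -nat1r; ring.
have -> : M * (n%:R * H ^+ n.-1 * (K * H * H)) * E =
  (M * expR (a * `|x|)) * ((n%:R * (H ^+ n.-1 * expR (- (n.-1%:R * `|x|)))) *
   ((K * expR `|x|) * (H * expR (- `|x|)) * (H * expR (- `|x|)))).
  by rewrite EE2; ring.
apply: ler_pM; [by nonneg|by nonneg|exact: hM|].
apply: ler_pM; [by nonneg|by nonneg|by rewrite ler_wpM2l|].
apply: ler_pM; [by nonneg|by nonneg| |by []].
apply: ler_pM; [by nonneg|by nonneg| |by []].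
by have := hK x y yp; rewrite mul1r.
Qed.

Let b0 : 0 < n%:R - a. Proof. by rewrite subr_gt0. Qed.

Let sin_pos c : 0 < c < pi -> 0 < sin c.
Proof. by move=> cpi; rewrite sin_gt0_pi. Qed.

Let abs_le_pi c : 0 < c < pi -> `|c| <= pi.
Proof. by move=> /andP[c0 cp]; rewrite ger0_norm ltW. Qed.

Lemma quotient_line_integrable c : 0 < c < pi -> cintegrable setT (fun x => g (x +i* c)).
Proof.
move=> cpi; have sc := sin_pos cpi; have [g1 [g2 [dg _ bd]]] := quotient_derivative.
have [C C0 hC] := bd (sin c) sc (sin_le1 c).
have dgx x : cder (fun t => g (t +i* c)) x (g1 (x +i* c) * 1).
  by apply: dg => //; exact: csinh_neq0.
have bx x : normc (g (x +i* c)) <= C * expR (- ((n%:R - a) * `|x|)).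
  by have [] := hC x c (abs_le_pi cpi) (lexx _).
have cR : continuous (fun x => Re (g (x +i* c))) by move=> x; have [] := cder_continuous (dgx x).
have cI : continuous (fun x => Im (g (x +i* c))) by move=> x; have [] := cder_continuous (dgx x).
split; apply: (integrable_le_expR measurableT _ b0) => //.
- exact: continuous_measurable_fun.
- by move=> x _; rewrite (le_trans (Re_le_normc _)).
- exact: continuous_measurable_fun.
- by move=> x _; rewrite (le_trans (Im_le_normc _)).
Qed.

(** Plays the role of Cauchy's theorem on a rectangle: the derivative in c of the integral is the
    integral over x of i g'(x + ic), which vanishes because g tends to 0 at both ends. *)
Lemma quotient_integral_cst c1 c2 : 0 < c1 < pi -> 0 < c2 < pi ->
  cintegral setT (fun x => g (x +i* c1)) = cintegral setT (fun x => g (x +i* c2)).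
Proof.
move=> h1 h2; have [g1 [g2 [dg dg1 bd]]] := quotient_derivative.
suff H (u : R[i] -> R) : (forall z, `|u z| <= normc z) ->
   (forall f x d, cder f x d -> is_derive x (1 : R) (fun t => u (f t)) (u d)) ->
   \int[mu]_x u (g (x +i* c1)) = \int[mu]_x u (g (x +i* c2)).
  apply: (congr2 (@Complex R)).
    by apply: H; [exact: Re_le_normc|move=> f x d []].
  by apply: H; [exact: Im_le_normc|move=> f x d []].
move=> un ud; pose J c := \int[mu]_x u (g (x +i* c)).
apply: (@cst_on_itv_derive0 R J 0 pi) => // c cpi.
(* Differentiation under the integral asks for one majorant for all lines near [c], hence an
   interval on which the sine stays above a fixed [e]. *)
have [e [u' [v [e0 e1 [u0 vp] ucv ev]]]] := sin_itv_lower cpi.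
have [C C0 hC] := bd e e0 e1.
have yp y : u' < y < v -> 0 < y < pi.
  by move=> /andP[uy yv]; rewrite (le_lt_trans u0 uy) (lt_le_trans yv vp).
have sy y : u' < y < v -> 0 < sin y by move=> /ev; exact: lt_le_trans.
have dgx y x : u' < y < v -> cder (fun t => g (t +i* y)) x (g1 (x +i* y)).
  move=> uyv; rewrite -[g1 _]mulr1.
  by apply: dg => //; apply: csinh_neq0; exact: sy.
have dg1x y x : u' < y < v -> cder (fun t => g1 (t +i* y)) x (g2 (x +i* y)).
  move=> uyv; rewrite -[g2 _]mulr1.
  by apply: dg1 => //; apply: csinh_neq0; exact: sy.
have dgy y x : u' < y < v -> cder (fun t => g (x +i* t)) y (g1 (x +i* y) * 'i).
  by move=> uyv; apply: dg => //; apply: csinh_neq0; exact: sy.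
have bg y x : u' < y < v -> normc (g (x +i* y)) <= C * expR (- ((n%:R - a) * `|x|)).
  by move=> uyv; have [] := hC x y (abs_le_pi (yp _ uyv)) (ev _ uyv).
have bg1 y x : u' < y < v -> normc (g1 (x +i* y)) <= C * expR (- ((n%:R - a) * `|x|)).
  by move=> uyv; have [] := hC x y (abs_le_pi (yp _ uyv)) (ev _ uyv).
have iF (F F' : R -> R[i]) : (forall x, cder F x (F' x)) ->
    (forall x, normc (F x) <= C * expR (- ((n%:R - a) * `|x|))) -> ibl setT (fun x => u (F x)).
  move=> dF hF; apply: (integrable_le_expR measurableT _ b0 (C := C)) => //.
    apply: continuous_measurable_fun => x.
    exact: (is_derive_continuous_at (ud _ _ _ (dF x))).
  by move=> x _; rewrite (le_trans (un _)).
have iE : ibl setT (fun x => C * expR (- ((n%:R - a) * `|x|))).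
  apply: (integrable_le_expR measurableT _ b0 (C := C)) => //.
    apply: continuous_measurable_fun => x.
    apply: cvgM; first exact: cvg_cst.
    apply: (cvg_comp _ expR); last exact: continuous_expR.
    apply: cvgN; apply: cvgM; first exact: cvg_cst.
    by apply: cvg_norm; exact: cvg_id.
  by move=> x _; rewrite ger0_norm// mulr_ge0// expR_ge0.
have bgi y x : u' < y < v -> setT x ->
    `|u (g1 (x +i* y) * 'i)| <= C * expR (- ((n%:R - a) * `|x|)).
  move=> uyv _; rewrite (le_trans (un _))// Normc.normcM normc_i mulr1.
  exact: bg1.
have D := @is_derive_under_integral R setT (fun y x => u (g (x +i* y)))
  (fun y x => u (g1 (x +i* y) * 'i)) _ c u' v measurableT ucv
  (fun y uyv => iF _ _ (fun x => dgx y x uyv) (fun x => bg y x uyv))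
  (fun y x uyv _ => ud _ _ _ (dgy y x uyv)) iE bgi.
apply: (is_derive_eq D).
have dF x : cder (fun t => g (t +i* c) * 'i) x (g1 (x +i* c) * 'i).
  by apply: (cder_eq (cder_mul (dgx c x ucv) (cder_cst 'i x))); ring.
have dF' x : cder (fun t => g1 (t +i* c) * 'i) x (g2 (x +i* c) * 'i).
  by apply: (cder_eq (cder_mul (dg1x c x ucv) (cder_cst 'i x))); ring.
have bF x : `|u (g (x +i* c) * 'i)| <= C * expR (- ((n%:R - a) * `|x|)).
  by rewrite (le_trans (un _))// Normc.normcM normc_i mulr1; exact: bg.
have [Fy FNy] := expR_decay_cvg0 b0 bF.
have cF' : continuous (fun x => u (g1 (x +i* c) * 'i)).
  by move=> x; exact: (is_derive_continuous_at (ud _ _ _ (dF' x))).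
have iF' : ibl setT (fun x => u (g1 (x +i* c) * 'i)).
  by apply: (iF _ _ dF') => x; rewrite Normc.normcM normc_i mulr1; exact: bg1.
by rewrite (FTC2_line (fun x => ud _ _ _ (dF x)) cF' iF' FNy Fy) subrr.
Qed.

(* The zero of order [n] cancels the pole of [1 / sinh^n], so that the line may
   be pushed down to the real axis. *)
Variable M0 : R.
Hypothesis vanN : forall x y, `|x| <= 1 -> 0 <= y <= 1 ->
  normc (N (x +i* y)) <= M0 * normc (x +i* y) ^+ n.

(** Uniform down to y = 0: for |x| > 1 one has |sinh z| >= |sinh x|, and for |x| <= 1 one has |sinh
    z| >= cos 1 |z|, against which the zero of [N] is spent. The factor e^(n - a) in [C2] offsets
    the exponential weight, which is at least e^(-(n - a)) for |x| <= 1. *)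
Let near_bound : exists2 C, 0 <= C & forall x y, 0 <= y <= 1 -> x +i* y != 0 ->
  normc (g (x +i* y)) <= C * expR (- ((n%:R - a) * `|x|)).
Proof.
have [_ [_ [_ _ [M Mge hM] _]]] := gN.
pose C1 := M * 4 ^+ n; pose C2 := `|M0| * (cos 1)^-1 ^+ n * expR (n%:R - a).
have C10 : 0 <= C1 by rewrite /C1; nonneg.
have c1 : 0 < cos 1 :> R by exact: cos1_gt0.
have C20 : 0 <= C2.
  by rewrite /C2; apply: mulr_ge0; [apply: mulr_ge0|]; rewrite ?expR_ge0// exprn_ge0// invr_ge0 ltW.
exists (C1 + C2); first exact: addr_ge0.
move=> x y /andP[y0 y1] xy0.
have y1pi : `|y| <= pi by rewrite ger0_norm// (le_trans y1)// (le_trans _ (pi_ge2 R))// ler1n.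
have gE : normc (g (x +i* y)) = normc (N (x +i* y)) * (normc (csinh (x +i* y)))^-1 ^+ n.
  by rewrite /g Normc.normcM normcX Normc.normcV.
have [x1|x1] := leP `|x| 1; last first.
  apply: (@le_trans _ _ (C1 * expR (- ((n%:R - a) * `|x|)))); last first.
    by rewrite ler_wpM2r ?expR_ge0// lerDl.
  have L : expR `|x| / 4 <= normc (csinh (x +i* y)).
    rewrite (le_trans (sinh_ge_expR (ltW x1)))// -sqrtr_sqr -[leRHS](ger0_norm (normc_ge0 _)).
    by rewrite -[leRHS]sqrtr_sqr ler_wsqrtr// normc_csinh_sqr lerDl sqr_ge0.
  have e4 : 0 < expR `|x| / 4 by rewrite divr_gt0// expR_gt0.
  have Li : (normc (csinh (x +i* y)))^-1 <= 4 * expR (- `|x|).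
    rewrite expRN -[4 * _]invrK invfM invrK mulrC lef_pV2 ?posrE//.
    exact: lt_le_trans L.
  rewrite gE /C1 (_ : _ * expR _ = (M * expR (a * `|x|)) * (4 * expR (- `|x|)) ^+ n); last first.
    have -> : expR (- ((n%:R - a) * `|x|)) = expR (a * `|x|) * expR (n%:R * - `|x|).
      by rewrite -expRD; congr expR; ring.
    by rewrite exprMn -expRM_natl; ring.
  apply: ler_pM; [by nonneg| |exact: hM|].
    by rewrite exprn_ge0// invr_ge0 normc_ge0.
  by rewrite lerXn2r ?nnegrE ?invr_ge0 ?normc_ge0// mulr_ge0// expR_ge0.
apply: (@le_trans _ _ (C2 * expR (- ((n%:R - a) * `|x|)))); last first.
  by rewrite ler_wpM2r ?expR_ge0// lerDr.
have s0 : 0 < normc (x +i* y) by rewrite lt_neqAle eq_sym normc_eq0 xy0 normc_ge0.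
have L : cos 1 * normc (x +i* y) <= normc (csinh (x +i* y)).
  rewrite -ler_sqr ?nnegrE ?normc_ge0 ?mulr_ge0 ?normc_ge0 ?(ltW c1)//.
  rewrite normc_csinh_sqr exprMn normc_sqr/= mulrDr lerD//.
    rewrite (@le_trans _ _ (x ^+ 2))//.
      by rewrite ler_piMl ?sqr_ge0// expr_le1// ?cos_le1 ?(ltW c1).
    exact: sqr_le_sinh_sqr.
  rewrite -exprMn ler_sqr ?nnegrE ?mulr_ge0 ?(ltW c1)//.
    by rewrite cos1_mul_le_sin// y0.
  by rewrite sin_ge0_pi// y0 (le_trans (ler_norm y)).
have Li : (normc (csinh (x +i* y)))^-1 <= (cos 1)^-1 * (normc (x +i* y))^-1.
  rewrite -invfM lef_pV2 ?posrE// ?mulr_gt0//.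
  by rewrite (lt_le_trans _ L)// mulr_gt0.
rewrite gE (@le_trans _ _ (`|M0| * (cos 1)^-1 ^+ n))//.
  rewrite (@le_trans _ _ (`|M0| * normc (x +i* y) ^+ n * ((cos 1)^-1 * (normc (x +i* y))^-1) ^+ n))//.
    apply: ler_pM; [by nonneg| | |].
    - by rewrite exprn_ge0// invr_ge0 normc_ge0.
    - rewrite (le_trans (vanN _ _))// ?y0 ?y1// ler_wpM2r ?exprn_ge0 ?normc_ge0//.
      exact: ler_norm.
    - rewrite lerXn2r ?nnegrE ?invr_ge0 ?normc_ge0// mulr_ge0// invr_ge0 ?normc_ge0//.
      exact: ltW.
  rewrite exprMn mulrACA -[(normc _)^-1 ^+ n]mulr1.
  have -> : normc (x +i* y) ^+ n * ((normc (x +i* y))^-1 ^+ n * 1) = 1.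
    by rewrite mulr1 -exprMn divff ?gt_eqF// expr1n.
  by rewrite mulr1.
rewrite /C2 -mulrA -expRD ler_peMr//; last first.
  rewrite -[leLHS]expR0 ler_expR.
  have -> : n%:R - a - (n%:R - a) * `|x| = (n%:R - a) * (1 - `|x|) by ring.
  by rewrite mulr_ge0 ?subr_ge0// ?(ltW an).
by rewrite mulr_ge0// exprn_ge0// invr_ge0 ltW.
Qed.

(** The lines descend through the heights 1 / (k + 2); the integrals do not depend on the height and
    converge by domination. Folding onto the half-line removes x = 0, the only point where the
    pointwise limit may fail. *)
Lemma contour_shift :
  cintegrable `]0, +oo[ (fun x => g x%:C + g (- x)%:C) /\
  cintegral setT (fun x => g (x +i* (pi / 2))) =
  cintegral `]0, +oo[ (fun x => g x%:C + g (- x)%:C).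
Proof.
have [C C0 hC] := near_bound; have [g1 [g2 [dg _ _]]] := quotient_derivative.
have mI : measurable (`]0, +oo[%classic : set (measurableTypeR R)) by exact: measurable_itv.
pose c_ k : R := k.+2%:R^-1.
have c01 k : 0 < c_ k < 1 by rewrite invr_gt0 ltr0n invf_lt1// ltr1n.
have pi2 := pi_ge2 R.
have c0pi k : 0 < c_ k < pi by have /andP[-> /=] := c01 k; lra.
have h2 : (0 < (pi : R) / 2) && ((pi : R) / 2 < (pi : R)).
  by rewrite divr_gt0 ?pi_gt0//= ltr_pdivrMr// ltr_pMr ?pi_gt0// ltr1n.
have c_0 : c_ k @[k --> \oo] --> 0.
  apply/gtr0_cvgV0; first by apply: nearW => k; rewrite ltr0n.
  rewrite (cvg_shiftS (fun k => k.+1%:R : R)).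
  by rewrite (cvg_shiftS (fun k => k%:R : R)); exact: cvgr_idn.
suff H (u : R[i] -> R) : (forall z, `|u z| <= normc z) -> (forall z w, u (z + w) = u z + u w) ->
   (forall f x d, cder f x d -> is_derive x (1 : R) (fun t => u (f t)) (u d)) ->
   (forall c, 0 < c < pi -> ibl setT (fun x => u (g (x +i* c)))) ->
   (forall k, \int[mu]_x u (g (x +i* c_ k)) = \int[mu]_x u (g (x +i* (pi / 2)))) ->
   ibl `]0, +oo[ (fun x => u (g x%:C + g (- x)%:C)) /\
   \int[mu]_x u (g (x +i* (pi / 2))) = \int[mu]_(x in `]0, +oo[) u (g x%:C + g (- x)%:C).
  have eqc k : cintegral setT (fun x => g (x +i* c_ k)) = cintegral setT (fun x => g (x +i* (pi / 2))).
    exact: quotient_integral_cst.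
  have [HR1 HR2] := H Re (@Re_le_normc R) (@cReD R) (fun f x d h => h.1)
    (fun c cp => (quotient_line_integrable cp).1) (fun k => congr1 Re (eqc k)).
  have [HI1 HI2] := H Im (@Im_le_normc R) (@cImD R) (fun f x d h => h.2)
    (fun c cp => (quotient_line_integrable cp).2) (fun k => congr1 Im (eqc k)).
  by split=> //; exact: (congr2 (@Complex R)).
move=> un uD ud ui uE.
pose f_ k x := u (g (x +i* c_ k)) + u (g ((- x) +i* c_ k)).
have gx k x : cder (fun t => g (t +i* c_ k)) x (g1 (x +i* c_ k) * 1).
  by apply: dg => //; apply: csinh_neq0; exact: sin_pos.
have cg k : continuous (fun x => u (g (x +i* c_ k))).
  by move=> x; exact: (is_derive_continuous_at (ud _ _ _ (gx k x))).
have mg k : measurable_fun [set: measurableTypeR R] (fun x => u (g (x +i* c_ k))).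
  exact: continuous_measurable_fun.
have mf k : measurable_fun (`]0, +oo[ : set (measurableTypeR R)) (f_ k).
  apply: measurable_funTS; apply: continuous_measurable_fun => x.
  apply: cvgD; first exact: cg.
  apply: (cvg_comp (-%R) (fun x => u (g (x +i* c_ k)))); last exact: cg.
  exact: opp_continuous.
have bG k x : `|u (g (x +i* c_ k))| <= C * expR (- ((n%:R - a) * `|x|)).
  rewrite (le_trans (un _))// hC//; first by have /andP[/ltW -> /ltW ->] := c01 k.
  by rewrite eq_complex /= negb_and orbC; have /andP[/gt_eqF -> _] := c01 k.
have bf k x : `]0, +oo[%classic x -> `|f_ k x| <= (C * 2) * expR (- ((n%:R - a) * `|x|)).
  move=> _; rewrite (le_trans (ler_normD _ _))// mulrAC mulr_natr mulr2n lerD//.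
  by have := bG k (- x); rewrite normrN.
have iG : ibl `]0, +oo[ (fun x => (C * 2) * expR (- ((n%:R - a) * `|x|))).
  apply: (integrable_le_expR mI _ b0 (C := C * 2)) => //.
    apply: measurable_funTS; apply: continuous_measurable_fun => x.
    apply: cvgM; first exact: cvg_cst.
    apply: (cvg_comp _ expR); last exact: continuous_expR.
    apply: cvgN; apply: cvgM; first exact: cvg_cst.
    by apply: cvg_norm; exact: cvg_id.
  by move=> x _; rewrite ger0_norm// mulr_ge0 ?expR_ge0// mulr_ge0.
have cs x : x != 0 -> csinh (x +i* 0) != 0.
  move=> x0; rewrite -normc_eq0 -sqrf_eq0 normc_csinh_sqr sin0 expr0n addr0.
  by rewrite gt_eqF// (lt_le_trans _ (sqr_le_sinh_sqr x))// exprn_even_gt0.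
have cv x : x != 0 -> u (g (x +i* c_ k)) @[k --> \oo] --> u (g x%:C).
  move=> x0; have dx : cder (fun t => g (x +i* t)) 0 (g1 (x +i* 0) * 'i).
    by apply: dg => //; exact: cs.
  have := is_derive_continuous_at (ud _ _ _ dx).
  exact: cvg_comp.
have cf x : `]0, +oo[%classic x -> f_ k x @[k --> \oo] --> u (g x%:C + g (- x)%:C).
  rewrite /= in_itv/= andbT => x0; rewrite uD; apply: cvgD; apply: cv.
    by rewrite gt_eqF.
  by rewrite oppr_eq0 gt_eqF.
split; first exact: (dominated_limit_integrable mI mf cf iG bf).
have := Rintegral_dominated_cvg mI mf cf iG bf.
have E k : \int[mu]_(x in `]0, +oo[) f_ k x = \int[mu]_x u (g (x +i* (pi / 2))).
  by rewrite -(uE k) Rintegral_fold//; exact: ui.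
under eq_fun do rewrite E.
by move=> h; apply: (@cvg_unique _ (@Rhausdorff R) _ _ _ _ _ h); exact: cvg_cst.
Qed.

End ContourShift.

(** * Linearity of complex-valued integrals *)

Section ComplexIntegral.
Context {R : realType}.
Implicit Types (z w : R[i]) (x y t a b c : R) (f g : R -> R[i]).
Implicit Types (D : set (measurableTypeR R)).
Local Notation Re := (@complex.Re R).
Local Notation Im := (@complex.Im R).
Local Notation mu := (@lebesgue_measure R).
Local Notation ibl D f := (mu.-integrable D (EFin \o f)).

Lemma eq_cintegral D f g : {in D, f =1 g} -> cintegral D f = cintegral D g.
Proof.
by move=> fg; apply: (congr2 (@Complex R)); apply: eq_Rintegral => x /fg ->.
Qed.

Lemma eq_cintegrable D f g : f =1 g -> cintegrable D f -> cintegrable D g.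
Proof. by move=> /funext ->. Qed.

Lemma cintegrableD D f g : measurable D -> cintegrable D f -> cintegrable D g ->
  cintegrable D (fun x => f x + g x).
Proof.
move=> mD [f1 f2] [g1 g2]; split.
  by under eq_fun do rewrite cReD; exact: integrable_add.
by under eq_fun do rewrite cImD; exact: integrable_add.
Qed.

Lemma cintegralD D f g : measurable D -> cintegrable D f -> cintegrable D g ->
  cintegral D (fun x => f x + g x) = cintegral D f + cintegral D g.
Proof.
move=> mD [f1 f2] [g1 g2]; apply: (congr2 (@Complex R)).
  by under eq_Rintegral do rewrite cReD; exact: RintegralD.
by under eq_Rintegral do rewrite cImD; exact: RintegralD.
Qed.

Let integrable_sub D (f g : R -> R) : measurable D -> ibl D f -> ibl D g ->
  ibl D (fun x => f x - g x).
Proof.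
move=> mD fi gi; have := integrable_add mD fi (integrable_scale (-1) mD gi).
by congr (mu.-integrable D _); apply/funext => x /=; rewrite mulN1r.
Qed.

Lemma cintegrableZ D f z : measurable D -> cintegrable D f ->
  cintegrable D (fun x => z * f x).
Proof.
move=> mD [f1 f2]; split.
  under eq_fun do rewrite cReM.
  by apply: integrable_sub => //; exact: integrable_scale.
under eq_fun do rewrite cImM.
by apply: integrable_add => //; exact: integrable_scale.
Qed.

Lemma cintegralZ D f z : measurable D -> cintegrable D f ->
  cintegral D (fun x => z * f x) = z * cintegral D f.
Proof.
move=> mD [f1 f2]; apply: cplx_eq; rewrite ?cReM ?cImM /=.
  under eq_Rintegral do rewrite cReM.
  rewrite RintegralB//; [|exact: integrable_scale|exact: integrable_scale].
  by rewrite !RintegralZl.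
under eq_Rintegral do rewrite cImM.
rewrite RintegralD//; [|exact: integrable_scale|exact: integrable_scale].
by rewrite !RintegralZl.
Qed.

Lemma cintegrable0 D : measurable D -> cintegrable D (fun=> 0).
Proof. by move=> mD; split; exact: integrable0. Qed.

Lemma cintegral0 D : cintegral D (fun=> 0) = 0.
Proof.
by apply: cplx_eq => /=; rewrite /Rintegral integral0.
Qed.

Lemma cintegrable_sum D (F : nat -> R -> R[i]) (k : nat) : measurable D ->
  (forall r, (r < k)%N -> cintegrable D (F r)) -> cintegrable D (fun x => \sum_(r < k) F r x).
Proof.
move=> mD; elim: k => [|k IH] h.
  by apply: (eq_cintegrable _ (cintegrable0 mD)) => x; rewrite big_ord0.
apply: (eq_cintegrable _ (cintegrableD mD (IH _) (h k _))) => // [x|r rk].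
  by rewrite big_ord_recr.
by apply: h; rewrite ltnS ltnW.
Qed.

Lemma cintegral_sum D (F : nat -> R -> R[i]) (k : nat) : measurable D ->
  (forall r, (r < k)%N -> cintegrable D (F r)) ->
  cintegral D (fun x => \sum_(r < k) F r x) = \sum_(r < k) cintegral D (F r).
Proof.
move=> mD; elim: k => [|k IH] h.
  by rewrite big_ord0 -[RHS](cintegral0 D); apply: eq_cintegral => x _; rewrite big_ord0.
have hk r : (r < k)%N -> cintegrable D (F r) by move=> rk; apply: h; rewrite ltnS ltnW.
rewrite big_ord_recr /= -IH// -cintegralD//; last 2 first.
- exact: cintegrable_sum.
- exact: h.
by apply: eq_cintegral => x _; rewrite big_ord_recr.
Qed.

Lemma cintegral_setT_opp f : measurable_fun [set: measurableTypeR R] (fun x => Re (f x)) ->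
  measurable_fun [set: measurableTypeR R] (fun x => Im (f x)) -> cintegrable setT f ->
  cintegral setT (fun x => f (- x)) = cintegral setT f.
Proof.
move=> mr mi [fr fi]; apply: (congr2 (@Complex R)).
  exact: (@Rintegral_setT_opp R (fun x => Re (f x))).
exact: (@Rintegral_setT_opp R (fun x => Im (f x))).
Qed.

End ComplexIntegral.

(** * Exponential moments of [1 / sinh^n] *)

Section LineIntegrals.
Context {R : realType}.
Implicit Types (z w v : R[i]) (x y t a b c : R) (F G : R[i] -> R[i]).
Local Notation Re := (@complex.Re R).
Local Notation Im := (@complex.Im R).
Local Notation normc := (@Normc.normc R).
Local Notation mu := (@lebesgue_measure R).
Local Notation ibl D f := (mu.-integrable D (EFin \o f)).
Variables (n : nat).
Hypothesis n0 : (0 < n)%N.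

Definition line_quotient F x : R[i] := F (x +i* (pi / 2)) * (csinh (x +i* (pi / 2)))^-1 ^+ n.
Definition line_integral F : R[i] := cintegral setT (line_quotient F).
Definition admissible F := exists2 a, a < n%:R & entire_growth a F.
Definition vanishing F := exists M0 : R, forall x y, `|x| <= 1 -> `|y| <= 1 ->
  normc (F (x +i* y)) <= M0 * normc (x +i* y) ^+ n.

Lemma pihalf_in : (0 < (pi : R) / 2) && ((pi : R) / 2 < (pi : R)).
Proof. by rewrite divr_gt0 ?pi_gt0//= ltr_pdivrMr// ltr_pMr ?pi_gt0// ltr1n. Qed.

Lemma line_quotient_integrable F : admissible F -> cintegrable setT (line_quotient F).
Proof. by move=> [a an Fa]; exact: (quotient_line_integrable n0 an Fa pihalf_in). Qed.

Lemma admissibleD F G : admissible F -> admissible G -> admissible (fun z => F z + G z).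
Proof.
move=> [a an Fa] [b bn Gb]; exists (Num.max a b); first by rewrite gt_max an.
apply: entire_growth_add.
  by apply: entire_growth_le Fa; rewrite le_max lexx.
by apply: entire_growth_le Gb; rewrite le_max lexx orbT.
Qed.

Lemma admissibleZ z0 F : admissible F -> admissible (fun z => z0 * F z).
Proof.
move=> [a an Fa]; exists a => //.
by have := entire_growth_mul (entire_growth_cst z0 (lexx 0)) Fa; rewrite add0r.
Qed.

Lemma admissible0 : admissible (fun=> 0).
Proof. by exists 0; rewrite ?ltr0n//; exact: entire_growth_cst. Qed.

Lemma admissible_sum (F : nat -> R[i] -> R[i]) (k : nat) : (forall r, (r < k)%N -> admissible (F r)) ->
  admissible (fun z => \sum_(r < k) F r z).
Proof.
elim: k => [|k IH] h.
  by under [X in admissible X]eq_fun do rewrite big_ord0; exact: admissible0.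
under [X in admissible X]eq_fun do rewrite big_ord_recr.
apply: admissibleD; last exact: h.
by apply: IH => r rk; apply: h; rewrite ltnS ltnW.
Qed.

Lemma line_integralD F G : admissible F -> admissible G ->
  line_integral (fun z => F z + G z) = line_integral F + line_integral G.
Proof.
move=> aF aG; rewrite /line_integral -cintegralD//; last 2 first.
- exact: line_quotient_integrable.
- exact: line_quotient_integrable.
by apply: eq_cintegral => x _; rewrite /line_quotient mulrDl.
Qed.

Lemma line_integralZ z0 F : admissible F ->
  line_integral (fun z => z0 * F z) = z0 * line_integral F.
Proof.
move=> aF; rewrite /line_integral -cintegralZ//; last exact: line_quotient_integrable.
by apply: eq_cintegral => x _; rewrite /line_quotient mulrA.
Qed.

Lemma line_integral_sum (F : nat -> R[i] -> R[i]) (k : nat) : (forall r, (r < k)%N -> admissible (F r)) ->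
  line_integral (fun z => \sum_(r < k) F r z) = \sum_(r < k) line_integral (F r).
Proof.
move=> h; have hi r : (r < k)%N -> cintegrable setT (line_quotient (F r)).
  by move=> rk; apply: line_quotient_integrable; exact: h.
rewrite /line_integral -(@cintegral_sum R setT (fun r => line_quotient (F r)) k)//.
by apply: eq_cintegral => x _; rewrite /line_quotient mulr_suml.
Qed.

Lemma eq_line_integral F G : F =1 G -> line_integral F = line_integral G.
Proof. by move=> /funext ->. Qed.

Lemma entire_growth_oppz a F : entire_growth a F -> entire_growth a (fun z => F (- z)).
Proof.
have hN z : holo_at (fun w => - w) z (-1).
  under [X in holo_at X]eq_fun do rewrite -mulN1r.
  by apply: (holo_at_eq (holo_mul (@holo_cst R (-1) z) (@holo_id R z))); ring.
have comp (P Q : R[i] -> R[i]) : (forall z, holo_at P z (Q z)) ->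
    forall z, holo_at (fun w => P (- w)) z (- Q (- z)).
  move=> dP z g t e gt dg; have h := hN z g t e gt dg.
  have gt' : - g t = - z by rewrite gt.
  by apply: (cder_eq (dP (- z) (fun u => - g u) t _ gt' h)); ring.
have gr (P : R[i] -> R[i]) : strip_growth a P -> strip_growth a (fun z => P (- z)).
  move=> [M M0 h]; exists M => // x y yp; rewrite -(normrN x).
  by apply: (h (- x) (- y)); rewrite normrN.
have cN (P : R[i] -> R[i]) (Q : R[i] -> R[i]) : (forall z, holo_at P z (Q z)) ->
    forall z, holo_at (fun w => - P w) z (- Q z).
  move=> dP z g t e gt dg; apply: (cder_eq (cder_opp (dP z g t e gt dg))).
  by rewrite mulNr.
move=> [F1 [F2 [h1 h2 h3 h4]]].
exists (fun z => - F1 (- z)), (fun z => - - F2 (- z)); split.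
- exact: comp.
- exact: (cN (fun z => F1 (- z)) (fun z => - F2 (- z)) (comp _ _ h2)).
- exact: gr.
- have [M M0 h] := gr _ h4; exists M => // x y yp.
  by rewrite normcN; exact: h.
Qed.

(* Both sides are pushed down to the real axis, where [z -> - z] is a symmetry. *)
Lemma line_integral_reflect F : admissible F -> vanishing F ->
  line_integral F = (-1) ^+ n * line_integral (fun z => F (- z)).
Proof.
move=> [a an Fa] [M0 vF].
have v1 x y : `|x| <= 1 -> 0 <= y <= 1 -> normc (F (x +i* y)) <= M0 * normc (x +i* y) ^+ n.
  by move=> x1 /andP[y0 y1]; apply: vF; rewrite // ger0_norm.
have v2 x y : `|x| <= 1 -> 0 <= y <= 1 -> normc (F (- (x +i* y))) <= M0 * normc (x +i* y) ^+ n.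
  move=> x1 /andP[y0 y1]; rewrite -(normcN (x +i* y)).
  by apply: (vF (- x) (- y)); rewrite normrN// ger0_norm.
have [_ E1] := contour_shift n0 an Fa v1.
have [i2 E2] := contour_shift n0 an (entire_growth_oppz Fa) v2.
have mI : measurable (`]0, +oo[%classic : set (measurableTypeR R)) by exact: measurable_itv.
rewrite /line_integral /line_quotient E1 E2 -(cintegralZ ((-1) ^+ n) mI i2).
apply: eq_cintegral => x _.
have sN : csinh (- x)%:C = - csinh x%:C :> R[i] by rewrite -csinhN rmorphN.
have e1 : - x%:C = (- x)%:C :> R[i] by rewrite rmorphN.
have e2 : - (- x)%:C = x%:C :> R[i] by rewrite -rmorphN opprK.
rewrite sN e1 e2 invrN -[- (csinh _)^-1]mulN1r exprMn.
have s2 : (-1) ^+ n * (-1) ^+ n = 1 :> R[i] by rewrite -exprMn mulrNN mulr1 expr1n.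
move: s2; move: ((-1) ^+ n) ((csinh x%:C)^-1 ^+ n) (F x%:C) (F (- x)%:C) => e h A B s2.
have -> : e * (B * h + A * (e * h)) = (e * e) * (A * h) + B * (e * h) by ring.
by rewrite s2 mul1r.
Qed.

(** The substitution x -> - x turns z = x + i pi / 2 into - (z - i pi), and sinh (- (z - i pi)) =
    sinh z, so the denominator is unchanged. *)
Lemma line_integral_oppz F : admissible F ->
  line_integral (fun z => F (- z)) = line_integral (fun z => F (z - pi *i)).
Proof.
move=> [a an Fa]; have aN : admissible (fun z => F (- z)) by exists a => //; exact: entire_growth_oppz.
have iN := line_quotient_integrable aN.
have mN : measurable_fun [set: measurableTypeR R] (fun x => Re (line_quotient (fun z => F (- z)) x)).
  by apply/measurable_EFinP; apply: (measurable_int mu); exact: iN.1.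
have mN' : measurable_fun [set: measurableTypeR R] (fun x => Im (line_quotient (fun z => F (- z)) x)).
  by apply/measurable_EFinP; apply: (measurable_int mu); exact: iN.2.
rewrite /line_integral -(cintegral_setT_opp mN mN' iN); apply: eq_cintegral => x _.
have E : (- x) +i* (pi / 2) = - ((x +i* (pi / 2)) - pi *i) :> R[i].
  by apply: cplx_eq => /=; field.
by rewrite /line_quotient E csinhN csinh_sub_ipi !opprK.
Qed.

(** The exchange of the lines Im z = pi / 2 and Im z = - pi / 2, the lower one being read on the
    upper through sinh (z - i pi) = - sinh z. *)
Lemma line_integral_shift F : admissible F -> vanishing F ->
  line_integral F = (-1) ^+ n * line_integral (fun z => F (z - pi *i)).
Proof. by move=> aF vF; rewrite line_integral_reflect// line_integral_oppz. Qed.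

(** The order q of the power and n - q of the remainder add up to n. For q >= n the truncated
    difference is 0, the remainder is the exponential itself, and the surplus power q - n is bounded
    through |z| <= 2. *)
Lemma vanishing_pow_rem q v :
  vanishing (fun z => z ^+ q * cexp_rem (n - q) ('i * v * z)).
Proof.
pose N := (n - q)%N.
exists (2 ^+ (q + N - n) * (2 * (expR (normc v * 2) * ((2 * normc v) ^+ N / N`!%:R)))).
move=> x y x1 y1; set z := x +i* y.
have z2 : normc z <= 2.
  by rewrite (le_trans (normc_le_ReIm _))// -[leRHS]/(1 + 1) lerD.
have f0 : 0 <= (N`!%:R : R)^-1 by rewrite invr_ge0 ler0n.
have nv : normc ('i * v * z) = normc v * normc z by rewrite !Normc.normcM normc_i mul1r.
rewrite Normc.normcM normcX.
have h : normc (cexp_rem N ('i * v * z)) <=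
   2 * (expR (normc v * 2) * ((2 * normc v) ^+ N / N`!%:R)) * normc z ^+ N.
  rewrite (le_trans (cexp_rem_le _ _))// nv.
  have -> : 2 * (expR (normc v * 2) * ((2 * normc v) ^+ N / N`!%:R)) * normc z ^+ N =
    2 * (expR (normc v * 2) * ((2 * normc v * normc z) ^+ N / N`!%:R)).
    by rewrite [in RHS]exprMn; ring.
  rewrite -[2 * normc v * normc z]mulrA ler_wpM2l//.
  rewrite ler_wpM2r ?ler_expR ?ler_wpM2l ?normc_ge0//.
  by nonneg.
apply: (le_trans (ler_wpM2l _ h)); first by nonneg.
have e : (q + N = n + (q + N - n))%N by rewrite /N; lia.
have -> : normc z ^+ q * (2 * (expR (normc v * 2) * ((2 * normc v) ^+ N / N`!%:R)) * normc z ^+ N) =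
   normc z ^+ (q + N - n) * (2 * (expR (normc v * 2) * ((2 * normc v) ^+ N / N`!%:R))) * normc z ^+ n.
  have : normc z ^+ q * normc z ^+ N = normc z ^+ n * normc z ^+ (q + N - n).
    by rewrite -!exprD -e.
  by move: (2 * _) (_ ^+ q) (_ ^+ N) (_ ^+ n) (_ ^+ (q + N - n)) => A B C D E hh; ring: hh.
rewrite ler_wpM2r ?exprn_ge0 ?normc_ge0// ler_wpM2r//; first by nonneg.
by rewrite lerXn2r ?nnegrE ?normc_ge0.
Qed.

(** Follows from z - sinh z = O(z^2) by telescoping. It lets z^(n-1) be traded for sinh^(n-1) z,
    whose quotient by sinh^n can be integrated explicitly. *)
Lemma vanishing_pow_csinh : vanishing (fun z => z ^+ n.-1 - csinh z ^+ n.-1).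
Proof.
pose bound (F : R[i] -> R[i]) (k : nat) := exists2 M : R, 0 <= M & forall x y, `|x| <= 1 -> `|y| <= 1 ->
  normc (F (x +i* y)) <= M * normc (x +i* y) ^+ k.
have bD F G k : bound F k -> bound G k -> bound (fun z => F z + G z) k.
  move=> [M M0 h] [K K0 h']; exists (M + K); first exact: addr_ge0.
  move=> x y x1 y1; rewrite (le_trans (le_normcD _ _))// mulrDl lerD//; [exact: h|exact: h'].
have bM F G k l : bound F k -> bound G l -> bound (fun z => F z * G z) (k + l).
  move=> [M M0 h] [K K0 h']; exists (M * K); first exact: mulr_ge0.
  move=> x y x1 y1; rewrite Normc.normcM exprD mulrACA ler_pM ?normc_ge0//; [exact: h|exact: h'].
have bid k : bound (fun z => z ^+ k) k.
  by exists 1 => // x y _ _; rewrite mul1r normcX.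
have brem k s : normc s = 1 -> bound (fun z => cexp_rem k (s * z)) k.
  move=> s1; exists (2 * (expR 2 * (2 ^+ k / k`!%:R))).
    by apply: mulr_ge0 => //; apply: mulr_ge0; rewrite ?expR_ge0// divr_ge0// exprn_ge0.
  move=> x y x1 y1; rewrite (le_trans (cexp_rem_le _ _))// Normc.normcM s1 mul1r.
  set z := x +i* y.
  have z2 : normc z <= 2 by rewrite (le_trans (normc_le_ReIm _))// -[leRHS]/(1 + 1) lerD.
  have -> : 2 * (expR 2 * (2 ^+ k / k`!%:R)) * normc z ^+ k =
    2 * (expR 2 * ((2 * normc z) ^+ k / k`!%:R)) by rewrite exprMn; ring.
  rewrite ler_wpM2l// ler_wpM2r ?ler_expR// divr_ge0 ?exprn_ge0 ?mulr_ge0 ?normc_ge0//.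
have bc w : bound (fun=> w) 0.
  by exists (normc w); [exact: normc_ge0|move=> x y _ _; rewrite expr0 mulr1].
have beq F G k : F =1 G -> bound F k -> bound G k by move=> /funext ->.
have bs : bound (fun z => z - csinh z) 2.
  have n1 : normc (1 : R[i]) = 1 by rewrite -[1]/(1%:C) normc_real normr1.
  have n2 : normc (- 1 : R[i]) = 1 by rewrite normcN.
  have := bD _ _ _ (bM _ _ 0 2 (bc (- 2^-1)) (brem 2 _ n1)) (bM _ _ 0 2 (bc 2^-1) (brem 2 _ n2)).
  apply: beq => z; rewrite /cexp_rem /exp_poly !big_ord_recr !big_ord0 /csinh /=.
  by rewrite !fact0 !divr1 !expr0 !expr1 !mulN1r !mul1r; field.
have bsinh : bound csinh 1.
  have [M M0 h] := bs; exists (M * 2 + 1); first by rewrite addr_ge0// mulr_ge0.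
  move=> x y x1 y1; set z := x +i* y.
  have z2 : normc z <= 2 by rewrite (le_trans (normc_le_ReIm _))// -[leRHS]/(1 + 1) lerD.
  have -> : csinh z = - (z - csinh z) + z by ring.
  rewrite (le_trans (le_normcD _ _))// normcN mulrDl mul1r expr1 lerD//.
  rewrite (le_trans (h _ _ x1 y1))// -mulrA ler_wpM2l// expr2 ler_wpM2r ?normc_ge0//.
(* With S = sinh z, z^(m+1) - S^(m+1) = z (z^m - S^m) + (z - S) S^m; the second conjunct controls
   S^m. *)
have main m : bound (fun z => z ^+ m - csinh z ^+ m) m.+1 /\ bound (fun z => csinh z ^+ m) m.
  elim: m => [|m [IH1 IH2]].
    split; last by apply: (beq _ _ _ _ (bc 1)) => z; rewrite expr0.
    exists 0 => // x y _ _; rewrite !expr0 subrr mul0r.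
    by rewrite (_ : normc 0 = 0)//; apply/eqP; rewrite normc_eq0.
  split; last first.
    by apply: (beq _ _ _ _ (bM _ _ 1 m bsinh IH2)) => z; rewrite exprS.
  apply: (beq _ _ _ _ (bD _ _ m.+2 (bM _ _ 1 m.+1 (bid 1) IH1) (bM _ _ 2 m bs IH2))) => z.
  by rewrite !exprS expr0; ring.
have [[M M0 h] _] := main n.-1.
by rewrite prednK// in h; exists M.
Qed.

Lemma admissible_pow q : admissible (fun z => z ^+ q).
Proof.
exists (1 / 2); last by apply: entire_growth_pow; lra.
by rewrite (@lt_le_trans _ _ 1)// ?ler1n//; lra.
Qed.

Lemma admissible_shift_pow q : admissible (fun z => (z - pi *i) ^+ q).
Proof.
have h : entire_growth (1 / (4 * q.+1%:R)) (fun z : R[i] => z - pi *i).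
  have a0 : 0 < 1 / (4 * q.+1%:R) :> R by rewrite divr_gt0// mulr_gt0.
  by apply: entire_growth_add; [exact: entire_growth_id|apply: entire_growth_cst; exact: ltW].
have := entire_growth_expn q _ h => /(_ _); set a := 1 / _ in h *.
have a0 : 0 <= a by rewrite /a divr_ge0// mulr_ge0.
move=> /(_ a0) hq; exists (q%:R * a) => //.
rewrite (@lt_le_trans _ _ 1)// ?ler1n// /a mulrCA mul1r ltr_pdivrMr// ?mulr_gt0// mul1r.
by rewrite -natrM ltr_nat; lia.
Qed.

Variable v : R[i].
Hypothesis vstrip : `|Im v| < 1 / 2.

Definition exp_moment q := line_integral (fun z => z ^+ q * cexp ('i * v * z)).
(* [- 2 pi i] times the residue of [z^j / sinh^n z] at [0]. *)
Definition moment_defect j :=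
  line_integral (fun z => z ^+ j) - (-1) ^+ n * line_integral (fun z => (z - pi *i) ^+ j).

Lemma admissible_exp_moment q : admissible (fun z => z ^+ q * cexp ('i * v * z)).
Proof.
(* The power takes the rate 1 / 4 and the exponential takes |Im v| < 1 / 2; the sum stays below 1 <=
   n. *)
exists (1 / 4 + `|Re ('i * v)|).
  rewrite cReM /= mul0r sub0r normrN !mul1r (@lt_le_trans _ _ 1)// ?ler1n//.
  by move: vstrip; lra.
apply: entire_growth_mul; last exact: entire_growth_exp.
by apply: entire_growth_pow; lra.
Qed.

(** This is [line_integral_shift] for z^q times the Taylor remainder of order n - q. Under z -> z -
    i pi the exponential becomes e^(pi v) e^(ivz) and the power expands binomially, which gives the
    left side; the Taylor polynomials on both lines collect into the defects. For q >= n the right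
    side is empty. *)
Lemma exp_moment_recursion q :
  exp_moment q - (-1) ^+ n * cexp (pi%:C * v) *
     \sum_(s < q.+1) (- (pi *i)) ^+ (q - s) * exp_moment s *+ 'C(q, s) =
  \sum_(r < n - q) ('i * v) ^+ r / r`!%:R * moment_defect (q + r).
Proof.
pose T (r : nat) z := (('i * v) ^+ r / r`!%:R) * z ^+ (q + r).
pose T' (r : nat) z := (('i * v) ^+ r / r`!%:R) * (z - pi *i) ^+ (q + r).
have aT r : admissible (T r) by apply: admissibleZ; exact: admissible_pow.
have aT' r : admissible (T' r) by apply: admissibleZ; exact: admissible_shift_pow.
have aS : admissible (fun z => \sum_(r < n - q) T r z) by apply: admissible_sum => r _.
have aS' : admissible (fun z => \sum_(r < n - q) T' r z) by apply: admissible_sum => r _.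
pose F z := z ^+ q * cexp ('i * v * z).
have aF := admissible_exp_moment q.
have NE z : z ^+ q * cexp_rem (n - q) ('i * v * z) = F z + (-1) * (\sum_(r < n - q) T r z).
  rewrite /cexp_rem /exp_poly mulrBr mulN1r /F; congr (_ - _).
  rewrite mulr_sumr; apply: eq_bigr => r _.
  by rewrite /T exprMn exprD; ring.
have vN := @vanishing_pow_rem q v.
have aN : admissible (fun z => z ^+ q * cexp_rem (n - q) ('i * v * z)).
  rewrite (_ : (fun z => _) = (fun z => F z + (-1) * (\sum_(r < n - q) T r z))); last exact/funext.
  by apply: admissibleD => //; exact: admissibleZ.
have := line_integral_shift aN vN.
rewrite (eq_line_integral NE) line_integralD//; last exact: admissibleZ.
rewrite line_integralZ// (@line_integral_sum T)//.
pose G (s : nat) z := (cexp (pi%:C * v) * ((- (pi *i)) ^+ (q - s) *+ 'C(q, s))) * (z ^+ s * cexp ('i * v * z)).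
have aG s : admissible (G s) by apply: admissibleZ; exact: admissible_exp_moment.
have FE z : (z - pi *i) ^+ q * cexp_rem (n - q) ('i * v * (z - pi *i)) =
    \sum_(s < q.+1) G s z + (-1) * (\sum_(r < n - q) T' r z).
  rewrite NE; congr (_ + _); rewrite /F.
  have -> : 'i * v * (z - pi *i) = pi%:C * v + 'i * v * z.
    have -> : pi *i = 'i * pi%:C :> R[i] by apply: cplx_eq => /=; ring.
    have i2 : 'i * 'i = -1 :> R[i] by rewrite -expr2 sqr_i.
    by rewrite mulrBr addrC -[X in X + _]opprK -mulNr; ring: i2.
  rewrite cexpD addrC exprDn !mulr_suml; apply: eq_bigr => s _.
  rewrite /G mulrnAl mulrnAr mulrnAl; congr (_ *+ _).
  by move: ((- pi *i) ^+ _) (z ^+ s) (cexp _) (cexp _) => a1 a2 a3 a4; ring.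
have SG : admissible (fun z => \sum_(s < q.+1) G s z) by apply: admissible_sum => s _.
rewrite (eq_line_integral FE) line_integralD//; last exact: admissibleZ.
rewrite line_integralZ// (@line_integral_sum T')// (@line_integral_sum G)//.
have -> : \sum_(s < q.+1) line_integral (G s) =
    cexp (pi%:C * v) * \sum_(s < q.+1) (- (pi *i)) ^+ (q - s) * exp_moment s *+ 'C(q, s).
  rewrite mulr_sumr; apply: eq_bigr => s _; rewrite /G line_integralZ; last exact: admissible_exp_moment.
  rewrite /exp_moment mulrnAr mulrnAl mulrnAr; congr (_ *+ _).
  by rewrite mulrA.
have TE : \sum_(r < n - q) line_integral (T r) =
   \sum_(r < n - q) ('i * v) ^+ r / r`!%:R * line_integral (fun z => z ^+ (q + r)).
  by apply: eq_bigr => r _; rewrite /T line_integralZ//; exact: admissible_pow.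
have TE' : \sum_(r < n - q) line_integral (T' r) =
   \sum_(r < n - q) ('i * v) ^+ r / r`!%:R * line_integral (fun z => (z - pi *i) ^+ (q + r)).
  by apply: eq_bigr => r _; rewrite /T' line_integralZ//; exact: admissible_shift_pow.
have hF : line_integral F = exp_moment q by [].
clearbody T T' F G; rewrite TE TE' hF.
have -> : \sum_(r < n - q) ('i * v) ^+ r / r`!%:R * moment_defect (q + r) =
   \sum_(r < n - q) ('i * v) ^+ r / r`!%:R * line_integral (fun z => z ^+ (q + r)) -
   (-1) ^+ n * \sum_(r < n - q) ('i * v) ^+ r / r`!%:R * line_integral (fun z => (z - pi *i) ^+ (q + r)).
  rewrite mulr_sumr -sumrB; apply: eq_bigr => r _.
  rewrite /moment_defect.
  by move: (line_integral _) (line_integral _) (_ / _) ((-1) ^+ n) => a1 a2 a3 a4; ring.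
have alg (A B C D e E : R[i]) : D + -1 * B = e * (E * A + -1 * C) -> D - e * E * A = B - e * C.
  move=> h; have -> : D = e * (E * A + -1 * C) + B by rewrite -h; ring.
  by ring.
exact: alg.
Qed.

Lemma integral_sech : ibl setT (fun x => (expR x + expR (- x))^-1) ->
  (\int[mu]_(x in setT) (expR x + expR (- x))^-1 = pi / 2)%R.
Proof.
move=> fi.
have dF x : is_derive x (1 : R) (fun t => atan (expR t)) ((expR x + expR (- x))^-1).
  have h := is_derive1_comp (is_derive1_atan (expR x)) (is_derive_expR x).
  apply: (is_derive_eq h); rewrite /GRing.scale /= expRN.
  have := expR_gt0 x; move: (expR x) => E E0.
  have h1 : 1 + E ^+ 2 != 0 by rewrite gt_eqF// ltr_pwDl// sqr_ge0.
  have -> : E + E^-1 = (1 + E ^+ 2) / E by rewrite mulrDl mul1r expr2 mulfK ?gt_eqF// addrC.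
  by rewrite invf_div mulrC.
have cf : continuous (fun x : R => (expR x + expR (- x))^-1).
  move=> x; apply: cvgV; first by rewrite gt_eqF// addr_gt0 ?expR_gt0.
  apply: cvgD; first exact: continuous_expR.
  by apply: continuous_comp; [exact: opp_continuous|exact: continuous_expR].
rewrite (FTC2_line dF cf fi (l0 := 0) (l1 := pi / 2)) ?subr0//.
  rewrite -[X in _ --> X]atan0.
  apply: (@cvg_comp _ _ _ (@expR R) (@atan R) _ (nbhs (0 : R))); last exact: continuous_atan.
  by apply/cvgNy_compNP; exact: cvgr_expR.
apply: (@cvg_comp _ _ _ (@expR R) (@atan R) _ +oo); last exact: cvgy_atan.
suff : expR x @[x --> (+oo : set_system R)] --> +oo by [].
apply/cvgryPge => A; near=> x; rewrite (@le_trans _ _ (1 + x))//; last exact: expR_ge1Dx.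
by rewrite addrC -lerBlDr; near: x; apply: nbhs_pinfty_ge; exact: num_real.
Unshelve. all: by end_near. Qed.

(* [sinh (x + i pi / 2) = i cosh x]. *)
Lemma line_integral_csinh_pow : line_integral (fun z => csinh z ^+ n.-1) = - (pi *i).
Proof.
have E x : line_quotient (fun z => csinh z ^+ n.-1) x =
    0 +i* (- 2 * (expR x + expR (- x))^-1).
  have E0 : 0 < expR x + expR (- x) by rewrite addr_gt0 ?expR_gt0.
  have sE : csinh (x +i* (pi / 2)) = 0 +i* ((expR x + expR (- x)) / 2).
    by apply: cplx_eq; rewrite /csinh /cexp /= ?(cosN, sinN, cos_pihalf, sin_pihalf); field.
  have s0 : csinh (x +i* (pi / 2)) != 0.
    by rewrite sE eq_complex /= eqxx /= mulf_neq0 ?gt_eqF ?invr_gt0.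
  have -> : line_quotient (fun z => csinh z ^+ n.-1) x = (csinh (x +i* (pi / 2)))^-1.
    by rewrite /line_quotient -[X in _^-1 ^+ X](prednK n0) exprSr mulrA -exprMn divff// expr1n mul1r.
  rewrite sE; apply: cplx_eq; rewrite ?cReV ?cImV /=; last by field; rewrite gt_eqF.
  by rewrite mul0r.
have aS : admissible (fun z : R[i] => csinh z ^+ n.-1).
  exists (n.-1%:R * 1); first by rewrite mulr1 ltr_nat ltn_predL.
  by apply: entire_growth_expn => //; exact: entire_growth_csinh.
have [_ iI] := line_quotient_integrable aS.
have iS : ibl setT (fun x => (expR x + expR (- x))^-1).
  have := integrable_scale (- 2^-1) measurableT iI.
  congr (mu.-integrable _ _); apply/funext => x /=; rewrite E /=; congr (_%:E); field.
  by rewrite gt_eqF// addr_gt0 ?expR_gt0.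
apply: cplx_eq => /=.
  by under eq_Rintegral do rewrite E /=; rewrite /Rintegral integral0 oppr0.
under eq_Rintegral do rewrite E /=.
by rewrite RintegralZl// integral_sech//; field.
Qed.

(** By [vanishing_pow_csinh] the power may be replaced by sinh^(n-1), which leaves the integral of 1
    / sinh, equal to - i pi. The shift multiplies sinh^(n-1) by (-1)^(n-1), so together with (-1)^n
    the two lines add instead of cancelling. *)
Lemma moment_defect_last : moment_defect n.-1 = - (2 * (pi *i)).
Proof.
pose S := fun z : R[i] => csinh z ^+ n.-1.
have aS : admissible S.
  exists (n.-1%:R * 1); first by rewrite mulr1 ltr_nat ltn_predL.
  by apply: entire_growth_expn => //; exact: entire_growth_csinh.
have aP := admissible_pow n.-1; have aP' := admissible_shift_pow n.-1.
have E1 (z : R[i]) : z ^+ n.-1 - csinh z ^+ n.-1 = z ^+ n.-1 + (-1) * S z by rewrite mulN1r.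
have aN : admissible (fun z => z ^+ n.-1 - csinh z ^+ n.-1).
  rewrite (_ : (fun z => _) = (fun z => z ^+ n.-1 + (-1) * S z)); last exact/funext.
  by apply: admissibleD => //; exact: admissibleZ.
have := line_integral_shift aN vanishing_pow_csinh.
have E2 (z : R[i]) : (z - pi *i) ^+ n.-1 - csinh (z - pi *i) ^+ n.-1 =
    (z - pi *i) ^+ n.-1 + (- (-1) ^+ n.-1) * S z.
  by rewrite csinh_sub_ipi -[- csinh z]mulN1r exprMn mulNr.
rewrite (eq_line_integral E1) (eq_line_integral E2) !line_integralD//; try exact: admissibleZ.
rewrite !line_integralZ// line_integral_csinh_pow /moment_defect.
have e2 : (-1) ^+ n * (-1) ^+ n.-1 = -1 :> R[i].
  by rewrite -exprD addnC -[X in (_ + X)%N](prednK n0) addnS exprS addnn -mul2n exprM sqrrN expr1n expr1n mulr1.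
move: e2; move: (line_integral _) (line_integral _) ((-1) ^+ n) ((-1) ^+ n.-1) => a1 a2 e e' e2 h.
have -> : a2 = e * (a1 + - e' * - pi *i) - -1 * - pi *i by rewrite -h; ring.
by ring: e2.
Qed.

End LineIntegrals.

(** * Complex limits through the modulus *)

Section ComplexLimits.
Context {R : realType} {T : Type} {F : set_system T} {FF : Filter F}.
Implicit Types (f g : T -> R[i]) (l z w : R[i]).
Local Notation normc := (@Normc.normc R).

(** Measured by the real-valued modulus, so that squeezing takes place in [R]; [climP] returns to
    the topology of [R[i]]. *)
Definition clim f l := normc (f x - l) @[x --> F] --> 0.

Lemma climP f l : clim f l <-> f x @[x --> F] --> l.
Proof.
have nE z : `|z| = (normc z)%:C by case: z => a c; rewrite normc_def.
split => h.
  apply/cvgrPdist_lt => e e0; have [er ei] : 0 < complex.Re e /\ complex.Im e = 0.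
    by move: e0; rewrite ltcE /= => /andP[/eqP].
  move/cvgr0Pnorm_lt : h => /(_ _ er); apply: filterS => x.
  by rewrite distrC nE ger0_norm ?normc_ge0// ltcE /= ei eqxx.
apply/cvgr0Pnorm_lt => e e0; have e0' : 0 < e%:C by rewrite ltcR.
move/cvgrPdist_lt : h => /(_ _ e0'); apply: filterS => x.
by rewrite distrC nE ger0_norm ?normc_ge0// ltcR.
Qed.

Lemma clim_squeeze f l (u : T -> R) : (\forall x \near F, normc (f x - l) <= u x) ->
  u x @[x --> F] --> 0 -> clim f l.
Proof.
move=> h u0; apply: (@squeeze_cvgr _ _ _ _ (fun=> 0) u) => //; last exact: cvg_cst.
by apply: filterS h => x ->; rewrite normc_ge0.
Qed.

Lemma clim_cst l : clim (fun=> l) l.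
Proof.
apply: (@clim_squeeze _ _ (fun=> 0)); last exact: cvg_cst.
apply: nearW => x; rewrite subrr le_eqVlt; apply/orP; left.
by rewrite normc_eq0.
Qed.

Lemma climD f g l z : clim f l -> clim g z -> clim (fun x => f x + g x) (l + z).
Proof.
move=> fl gz; apply: (@clim_squeeze _ _ (fun x => normc (f x - l) + normc (g x - z))).
  apply: nearW => x; rewrite (le_trans _ (le_normcD _ _))//.
  by rewrite le_eqVlt; apply/orP; left; apply/eqP; congr normc; ring.
by rewrite -[X in _ --> X](addr0 0); exact: cvgD.
Qed.

Lemma climM f g l z : clim f l -> clim g z -> clim (fun x => f x * g x) (l * z).
Proof.
move=> fl gz; apply: (@clim_squeeze _ _ (fun x =>
  (normc (f x - l) * normc (g x - z) + normc z * normc (f x - l)) + normc l * normc (g x - z))).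
  apply: nearW => x; rewrite -!Normc.normcM.
  have -> : f x * g x - l * z = ((f x - l) * (g x - z) + z * (f x - l)) + l * (g x - z) by ring.
  by rewrite (le_trans (le_normcD _ _))// lerD2r le_normcD.
rewrite -[X in _ --> X](addr0 0); apply: cvgD.
  rewrite -[X in _ --> X](addr0 0); apply: cvgD.
    by rewrite -[X in _ --> X](mulr0 0); exact: cvgM.
  by rewrite -[X in _ --> X](mulr0 (normc z)); apply: cvgM => //; exact: cvg_cst.
by rewrite -[X in _ --> X](mulr0 (normc l)); apply: cvgM => //; exact: cvg_cst.
Qed.

Lemma climZ f l z : clim f l -> clim (fun x => z * f x) (z * l).
Proof. by move=> fl; apply: climM => //; exact: clim_cst. Qed.

Lemma climX f l (m : nat) : clim f l -> clim (fun x => f x ^+ m) (l ^+ m).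
Proof.
move=> fl; elim: m => [|m IH]; first exact: clim_cst.
rewrite exprS; have -> : (fun x => f x ^+ m.+1) = (fun x => f x * f x ^+ m).
  by apply/funext => x; rewrite exprS.
exact: climM.
Qed.

Lemma clim_sum (f : nat -> T -> R[i]) (l : nat -> R[i]) (m : nat) :
  (forall r, (r < m)%N -> clim (f r) (l r)) ->
  clim (fun x => \sum_(r < m) f r x) (\sum_(r < m) l r).
Proof.
elim: m => [|m IH] h.
  rewrite big_ord0; have -> : (fun x => \sum_(r < 0) f r x) = fun=> 0.
    by apply/funext => x; rewrite big_ord0.
  exact: clim_cst.
rewrite big_ord_recr /=; have -> : (fun x => \sum_(r < m.+1) f r x) = fun x => \sum_(r < m) f r x + f m x.
  by apply/funext => x; rewrite big_ord_recr.
by apply: climD; [apply: IH => r rm; apply: h; rewrite ltnS ltnW|exact: h].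
Qed.

Lemma climV f l : l != 0 -> clim f l -> clim (fun x => (f x)^-1) l^-1.
Proof. by move=> l0 /climP fl; apply/climP; exact: cvgV. Qed.

Lemma near_clim f g l : (\forall x \near F, f x = g x) -> clim f l -> clim g l.
Proof.
move=> fg; apply: cvg_trans; apply: near_eq_cvg.
by apply: filterS fg => x ->.
Qed.

End ComplexLimits.
Arguments clim {R T} F f l.

(** * Asymptotics of the exponential moments *)

Section MomentAsymptotics.
Context {R : realType}.
Implicit Types (z w v : R[i]) (x y t a b c : R).
Local Notation Re := (@complex.Re R).
Local Notation Im := (@complex.Im R).
Local Notation normc := (@Normc.normc R).
Variable d : R.
Local Notation F := (strip_pinfty d).

Lemma cvg_Re_strip : Re v @[v --> F] --> +oo.
Proof.
apply/cvgryPgt => A; near=> v => /=; near: v.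
by exists A => // v /= Av _.
Unshelve. all: by end_near. Qed.

Lemma near_strip : \forall v \near F, `|Im v| < d.
Proof. by exists 0 => // v _ ? . Qed.

Lemma near_Re_gt M : \forall v \near F, M < Re v.
Proof. by exists M => // v Mv _. Qed.

Lemma near_neq0 : \forall v \near F, v != 0.
Proof.
apply: filterS (near_Re_gt 0) => v v0; apply/eqP => v00.
by rewrite v00 /= ltxx in v0.
Qed.

Lemma cvg_inv_pinfty : x^-1 @[x --> (+oo : set_system R)] --> (0 : R).
Proof.
apply/cvgrVy; first by near=> x; rewrite invr_gt0; near: x; apply: nbhs_pinfty_gt; exact: num_real.
rewrite (_ : unstable.inv_fun _ = id); first exact: cvg_id.
by apply/funext => x /=; exact: invrK.
Unshelve. all: by end_near. Qed.

Lemma clim_inv : clim F (fun v => v^-1) 0.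
Proof.
apply: (@clim_squeeze _ _ _ _ _ _ (fun v => (Re v)^-1)).
  near=> v; have v0 : 0 < Re v by near: v; exact: near_Re_gt.
  rewrite subr0 Normc.normcV.
  have h := le_trans (ler_norm _) (Re_le_normc v).
  by rewrite lef_pV2 ?posrE ?(lt_le_trans v0).
have hR : Re v @[v --> F] --> +oo := cvg_Re_strip.
exact: (@cvg_comp _ _ _ (Re : R[i] -> R) (@GRing.inv R) _ _ _ hR cvg_inv_pinfty).
Unshelve. all: by end_near. Qed.

Lemma clim_cexp_decay a : 0 < a -> clim F (fun v => cexp (- (a%:C * v))) 0.
Proof.
move=> a0; apply: (@clim_squeeze _ _ _ _ _ _ (fun v => (a * Re v)^-1)).
  near=> v; have v0 : 0 < Re v by near: v; exact: near_Re_gt.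
  rewrite subr0 normc_cexp cReN cReM /= mul0r subr0 expRN.
  rewrite lef_pV2 ?posrE ?expR_gt0 ?mulr_gt0//.
  by rewrite (le_trans _ (expR_ge1Dx _))// lerDr.
have h := cvg_inv_pinfty; have hR : Re v @[v --> F] --> +oo := cvg_Re_strip.
have h1 : (a * x) @[x --> +oo] --> +oo by apply: gt0_cvgMry => //; exact: cvg_id.
exact: (@cvg_comp _ _ _ (fun v : R[i] => a * Re v) (@GRing.inv R) _ _ _ (@cvg_comp _ _ _ (Re : R[i] -> R) (fun x => a * x) _ _ _ hR h1) h).
Unshelve. all: by end_near. Qed.

Variable n : nat.
Hypothesis n0 : (0 < n)%N.
Local Notation decay v := ((-1) ^+ n * cexp (- (pi%:C * v))).

Lemma clim_decay : clim F (fun v => decay v) 0.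
Proof. by rewrite -[X in clim _ _ X](mulr0 ((-1) ^+ n)); apply: climZ; exact: clim_cexp_decay (pi_gt0 R). Qed.

Lemma decay_neq0 v : decay v != 0.
Proof. by rewrite mulf_neq0 ?cexp_neq0// expf_neq0// oppr_eq0 oner_neq0. Qed.

Lemma near_decay_lt1 : \forall v \near F, normc (decay v) < 1.
Proof.
have /cvgr0Pnorm_lt /(_ _ ltr01) := clim_decay; apply: filterS => v.
by rewrite subr0 ger0_norm ?normc_ge0.
Qed.

(** Leading coefficient of 2 pi i times the residue of z^q e^(ivz) / sinh^n z at the pole i pi, once
    (-1)^n e^(- pi v) v^(n-1) is divided out. *)
Definition moment_limit (q : nat) : R[i] :=
  (pi *i) ^+ q * (2 * (pi *i) * 'i ^+ n.-1 / (n.-1)`!%:R).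

(** The binomial sum over s <= q contains (- i pi + i pi)^q, which is 1 for q = 0 and 0
    otherwise. *)
Lemma moment_limit_rec (q : nat) :
  moment_limit q = (2 * (pi *i) * 'i ^+ n.-1 / (n.-1)`!%:R) *+ (q == 0)%N
   - \sum_(s < q) (- (pi *i)) ^+ (q - s) *+ 'C(q, s) * moment_limit s.
Proof.
apply/eqP; rewrite -subr_eq opprK; apply/eqP.
set c := 2 * _ * _ / _.
have -> : moment_limit q = (- (pi *i)) ^+ (q - q) *+ 'C(q, q) * moment_limit q.
  by rewrite subnn expr0 binn mulr1n mul1r.
rewrite addrC -(big_ord_recr q (fun s => (- (pi *i)) ^+ (q - s) *+ 'C(q, s) * moment_limit s)) /=.
have -> : \sum_(s < q.+1) (- (pi *i)) ^+ (q - s) *+ 'C(q, s) * moment_limit s =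
    (- (pi *i) + pi *i) ^+ q * c.
  rewrite exprDn mulr_suml; apply: eq_bigr => s _; rewrite /moment_limit -/c.
  by rewrite mulrA mulrnAl.
by rewrite addNr expr0n; case: q => [|q] /=; rewrite ?mul1r ?mul0r.
Qed.

Hypothesis d_small : d <= 1 / 2.

(** Only r = n - 1 keeps up with v^(n-1), and that index occurs only for q = 0, where the defect is
    the one computed in [moment_defect_last]. *)
Lemma clim_defect_sum (q : nat) :
  clim F (fun v => (\sum_(r < n - q) ('i * v) ^+ r / r`!%:R * moment_defect n (q + r)) / v ^+ n.-1)
    (- (2 * (pi *i) * 'i ^+ n.-1 / (n.-1)`!%:R) *+ (q == 0)%N).
Proof.
pose f (r : nat) v := ('i ^+ r / r`!%:R * moment_defect n (q + r)) * (v^-1) ^+ (n.-1 - r).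
pose l (r : nat) := ('i ^+ r / r`!%:R * moment_defect n (q + r)) * 0 ^+ (n.-1 - r) : R[i].
have -> : - (2 * (pi *i) * 'i ^+ n.-1 / (n.-1)`!%:R) *+ (q == 0)%N = \sum_(r < n - q) l r.
  case: q @f @l => [|q] f l; rewrite ?mulr0n ?mulr1n.
    rewrite subn0 /l -(prednK n0) big_ord_recr big1 ?add0r /= => [|i _].
      by rewrite subnn add0n expr0 mulr1 moment_defect_last//; ring.
    by rewrite expr0n subn_eq0 leqNgt ltn_ord mulr0.
  rewrite big1// => i _; rewrite /l expr0n subn_eq0 leqNgt.
  by have := ltn_ord i => h; rewrite (_ : (i < n.-1)%N) ?mulr0//; lia.
apply: (@near_clim _ _ _ _ (fun v => \sum_(r < n - q) f r v)).
  near=> v; rewrite mulr_suml; apply: eq_bigr => r _.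
  have v0 : v != 0 by near: v; exact: near_neq0.
  have -> : v ^+ n.-1 = v ^+ r * v ^+ (n.-1 - r).
    by rewrite -exprD subnKC//; have := ltn_ord r; lia.
  rewrite /f exprMn exprVn invfM; have := expf_neq0 r v0.
  move: (v ^+ r) ((v ^+ (n.-1 - r))^-1) (moment_defect _ _) ('i ^+ r) => a b c e a0.
  have -> : e * a / r`!%:R * c * (a^-1 * b) = e / r`!%:R * c * b * (a / a) by ring.
  by rewrite divff// mulr1.
apply: clim_sum => r _; apply: climZ; apply: climX; exact: clim_inv.
Unshelve. all: by end_near. Qed.

(** Multiplied by w = (-1)^n e^(- pi v), the recursion reads (1 - w) k_q = - w P - S, where P is the
    polynomial of defects and S the sum over s < q. Strong induction gives S, [clim_defect_sum]
    gives P / v^(n-1), and w tends to 0. *)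
Lemma exp_moment_asymptotic (q : nat) :
  clim F (fun v => exp_moment n v q / (decay v * v ^+ n.-1)) (moment_limit q).
Proof.
elim/ltn_ind: q => q IH.
pose P v := \sum_(r < n - q) ('i * v) ^+ r / r`!%:R * moment_defect n (q + r) : R[i].
pose K (s : nat) v := exp_moment n v s / (decay v * v ^+ n.-1).
pose c (s : nat) : R[i] := (- (pi *i)) ^+ (q - s) *+ 'C(q, s).
have dw : clim F (fun v => (1 + (-1) * decay v)^-1) 1.
  rewrite -[X in clim _ _ X]invr1; apply: climV; first exact: oner_neq0.
  rewrite -[X in clim _ _ X]addr0 -[X in clim _ _ (_ + X)](mulr0 (-1)).
  by apply: climD; [exact: clim_cst|apply: climZ; exact: clim_decay].
have hS : clim F (fun v => \sum_(s < q) c s * K s v) (\sum_(s < q) c s * moment_limit s).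
  apply: (@clim_sum _ _ _ _ (fun s v => c s * K s v) (fun s => c s * moment_limit s)).
  by move=> s sq; apply: climZ; exact: IH.
have hP := clim_defect_sum q.
have {hP hS dw} /(_ _ _ _ _)h := climM dw (climD (climZ (-1) hP) (climZ (-1) hS)).
have -> : moment_limit q = 1 * (-1 * (- (2 * pi *i * 'i ^+ n.-1 / (n.-1)`!%:R) *+ (q == 0)%N) +
          -1 * (\sum_(s < q) c s * moment_limit s)).
  by rewrite moment_limit_rec mul1r !mulN1r mulNrn opprK.
move: h; apply: near_clim; near=> v.
have vs : `|Im v| < 1 / 2 by rewrite (lt_le_trans _ d_small)//; near: v; exact: near_strip.
have v0 : v != 0 by near: v; exact: near_neq0.
have w1 : 1 + -1 * decay v != 0.
  rewrite mulN1r subr_eq0 eq_sym; apply/eqP => e1.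
  have : normc (decay v) < 1 by near: v; exact: near_decay_lt1.
  by rewrite e1 -[1]/(1%:C) normc_real normr1 ltxx.
have := exp_moment_recursion n0 vs q; rewrite -/(P v) big_ord_recr /= subnn expr0 binn mulr1n mul1r.
have wE : decay v * ((-1) ^+ n * cexp (pi%:C * v)) = 1.
  by rewrite mulrACA -exprMn mulrNN mulr1 expr1n mul1r -cexpD addNr cexp0.
have -> : \sum_(s < q) c s * K s v = (\sum_(s < q) (- pi *i) ^+ (q - s) * exp_moment n v s *+ 'C(q, s)) / (decay v * v ^+ n.-1).
  rewrite mulr_suml; apply: eq_bigr => s _; rewrite /c /K mulrnAl mulrA.
  by rewrite !mulrnAl.
have D0 := decay_neq0 v; have V0 := expf_neq0 n.-1 v0.
move: wE w1 D0 V0; move: (P v) (decay v) (v ^+ _) ((-1) ^+ n * cexp (pi%:C * v)) (exp_moment n v q) (\sum_(s < q) _).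
move=> p w V E k S wE w1 D0 V0 h.
apply: (canLR (mulKf w1)).
have hk : w * p = (w * k - (w * E) * (S + k)) by rewrite -h; ring.
rewrite wE mul1r in hk.
have E1 : (1 + -1 * w) * k = - (w * p) - S by rewrite hk; ring.
have -> : (1 + -1 * w) * (k / (w * V)) = ((1 + -1 * w) * k) / (w * V) by ring.
rewrite E1 invfM; have -> : (- (w * p) - S) * (w^-1 / V) = (w / w) * (- p / V) - S * (w^-1 / V) by ring.
by rewrite divff// mul1r !mulN1r mulNr.
Unshelve. all: by end_near. Qed.

End MomentAsymptotics.

(** * Gamma at half-integers and Bessel series *)

Section Gamma.
Context {R : realType}.
Implicit Types (x y t a b c : R).
Local Notation mu := (@lebesgue_measure R).
Local Notation ibl D f := (mu.-integrable D (EFin \o f)).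

Lemma expr_gauss_le (p : nat) : exists2 C : R, 0 < C & forall x,
  `|x ^+ p * expR (- x ^+ 2)| <= C * expR (- `|x|).
Proof.
have [C C0 h] := expr_le_expR p (ltr01 : 0 < (1 : R)).
exists (C * expR 1); first by rewrite mulr_gt0 ?expR_gt0.
move=> x; rewrite normrM (ger0_norm (expR_ge0 _)) normrX.
rewrite (le_trans (ler_wpM2r (expR_ge0 _) (h x)))// -!mulrA ler_pM2l// mul1r -!expRD ler_expR.
have := sqr_ge0 (`|x| - 1); rewrite sqrrB1 real_normK ?num_real//; lra.
Qed.

Lemma continuous_expr_gauss (p : nat) : continuous (fun x : R => x ^+ p * expR (- x ^+ 2)).
Proof.
move=> x; apply: cvgM; first exact: exprn_continuous.
apply: continuous_comp; last exact: continuous_expR.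
by apply: cvgN; exact: exprn_continuous.
Qed.

Lemma expr_gauss_integrable (p : nat) : ibl setT (fun x : R => x ^+ p * expR (- x ^+ 2)).
Proof.
have [C C0 h] := expr_gauss_le p.
apply: (integrable_le_expR measurableT _ ltr01) => [|x _].
  exact: continuous_measurable_fun (@continuous_expr_gauss p).
by rewrite mul1r; exact: h.
Qed.

Lemma is_derive_expr (p : nat) x : is_derive x (1 : R) (fun t => t ^+ p.+1) (p.+1%:R * x ^+ p).
Proof.
have h := is_deriveX p.+1 (is_derive_id x (1 : R)); rewrite !fctE in h.
by apply: (is_derive_eq h); rewrite /GRing.scale /= mulr1.
Qed.

Lemma is_derive_gauss x : is_derive x (1 : R) (fun t => expR (- t ^+ 2)) (- (2 * x) * expR (- x ^+ 2)).
Proof.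
have h2 : is_derive x (1 : R) (fun t => - t ^+ 2) (- (2 * x)).
  by apply: (is_derive_eq (is_deriveN (is_derive_expr 1 x))); rewrite expr1.
have h := @is_derive1_comp R expR (fun t => - t ^+ 2) x _ _ (is_derive_expR (- x ^+ 2)) h2.
by apply: (is_derive_eq h); rewrite mulrC.
Qed.

Lemma expr_gauss_cvg0 (p : nat) : x ^+ p * expR (- x ^+ 2) @[x --> (+oo : set_system R)] --> 0.
Proof.
have [C C0 h] := expr_gauss_le p.
apply/norm_cvg0P.
apply: (@squeeze_cvgr _ _ _ _ (fun=> 0) (fun x => C * expR (- x))).
- near=> x; have x0 : 0 <= x by near: x; apply: nbhs_pinfty_ge; exact: num_real.
  by rewrite normr_ge0 (le_trans (h x))// ger0_norm.
- exact: cvg_cst.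
- by rewrite -[X in _ --> X](mulr0 C); apply: cvgM; [exact: cvg_cst|exact: cvgr_expR].
Unshelve. all: by end_near. Qed.

Definition gauss_moment (p : nat) : R :=
  (\int[mu]_(x in `]0%R, +oo[) (x ^+ p * expR (- x ^+ 2)))%R.

Let itv_oy : set (measurableTypeR R) := `]0%R, +oo[%classic.
Let m_oy : measurable itv_oy. Proof. exact: measurable_itv. Qed.

Lemma gauss_moment_rec (p : nat) : gauss_moment p.+2 = (p.+1%:R / 2) * gauss_moment p.
Proof.
pose F x : R := x ^+ p.+1 * expR (- x ^+ 2).
pose f x : R := p.+1%:R * (x ^+ p * expR (- x ^+ 2)) + (-2) * (x ^+ p.+2 * expR (- x ^+ 2)).
have ip q : ibl itv_oy (fun x : R => x ^+ q * expR (- x ^+ 2)).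
  exact: integrable_subset measurableT m_oy _ (expr_gauss_integrable q).
have cF q : continuous (fun x : R => x ^+ q * expR (- x ^+ 2)) := @continuous_expr_gauss q.
have : \int[mu]_(x in itv_oy) f x = 0 - 0.
  apply: (@FTC2_half_line _ F f).
  - move=> x _; have h := is_deriveM (is_derive_expr p x) (is_derive_gauss x).
    apply: (is_derive_eq h); rewrite /GRing.scale /= /f; move: (expR _) => E.
    by rewrite !exprS; ring.
  - move=> x _; apply: cvgD; (apply: cvgM; first exact: cvg_cst); exact: cF.
  - by apply: integrable_add => //; exact: integrable_scale.
  - have F00 : F 0 = 0 by rewrite /F exprS !mul0r.
    by rewrite -[X in _ --> X]F00; apply: cvg_at_right_filter; exact: cF.
  - exact: expr_gauss_cvg0.
rewrite subrr /f RintegralD//; [|exact: integrable_scale|exact: integrable_scale].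
by rewrite !RintegralZl// -/(gauss_moment p) -/(gauss_moment p.+2); lra.
Qed.

Lemma gauss_moment0 : gauss_moment 0 = Num.sqrt pi / 2.
Proof.
rewrite /gauss_moment Rintegral_itv_obnd_cbnd; last first.
  exact: integrable_subset measurableT m_oy _ (expr_gauss_integrable 0).
rewrite /Rintegral; have := @integral0y_gauss R; rewrite /gauss_fun => h.
under eq_integral do rewrite expr0 mul1r.
by rewrite h.
Qed.

Lemma gauss_moment1 : gauss_moment 1 = 1 / 2.
Proof.
rewrite /gauss_moment; have -> : 1 / 2 = 0 - (- (1 / 2)) :> R by ring.
apply: (@FTC2_half_line _ (fun x => (- (1 / 2)) * expR (- x ^+ 2)) (fun x => x ^+ 1 * expR (- x ^+ 2))).
- move=> x _; have h := is_deriveM (is_derive_cst (- (1/2) : R) x 1) (is_derive_gauss x).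
  by apply: (is_derive_eq h); rewrite /GRing.scale /= mulr0 addr0 expr1; field.
- by move=> x _; exact: continuous_expr_gauss.
- exact: integrable_subset measurableT m_oy _ (expr_gauss_integrable 1).
- apply: cvg_at_right_filter; rewrite -[X in _ --> X]mulr1; apply: cvgM; first exact: cvg_cst.
  have F00 : expR (- (0 : R) ^+ 2) = 1 by rewrite expr0n oppr0 expR0.
  by rewrite -[X in _ --> X]F00; exact: (@continuous_gauss_fun R).
- rewrite -[X in _ --> X](mulr0 (- (1/2))); apply: cvgM; first exact: cvg_cst.
  by have := expr_gauss_cvg0 0; under eq_fun do rewrite expr0 mul1r.
Qed.

Lemma gauss_moment_gt0 p : 0 < gauss_moment p.
Proof.
suff : 0 < gauss_moment p /\ 0 < gauss_moment p.+1 by case.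
elim: p => [|p [h1 h2]].
  by rewrite gauss_moment0 gauss_moment1 !divr_gt0// sqrtr_gt0 pi_gt0.
by split => //; rewrite gauss_moment_rec mulr_gt0// divr_gt0.
Qed.

Let half_line_exhaust (a b : nat -> R) : (forall n, 0 < a n) -> nonincreasing_seq a -> nondecreasing_seq b ->
  a n @[n --> \oo] --> 0 -> b n @[n --> \oo] --> +oo ->
  nondecreasing_seq (fun n => `[a n, b n]%classic : set (measurableTypeR R)) /\
  \bigcup_n (`[a n, b n]%classic : set (measurableTypeR R)) = itv_oy.
Proof.
move=> a0 da db ca cb; split.
  move=> i j ij; rewrite subsetEset => x /=; rewrite !in_itv/= => /andP[ax xb].
  by rewrite (le_trans (da _ _ ij))// (le_trans xb)// db.
apply/seteqP; split => [x [i _]|x]; rewrite /itv_oy /= !in_itv/= andbT.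
  by move=> /andP[+ _]; exact: lt_le_trans.
move=> x0; near \oo => i; exists i => //=; rewrite in_itv/=; apply/andP; split.
  by near: i; exact: (cvgr_le 0).
by near: i; move/cvgryPge: cb; exact.
Unshelve. all: by end_near. Qed.

(** The substitution t = x^2 is made on compact intervals away from 0, since t^(- 1 / 2) is
    unbounded there when p = 0. Both integrands are nonnegative, so monotone convergence exhausts
    the half-line. *)
Lemma Gamma_half (p : nat) : Gamma (p.+1%:R / 2 : R) = 2 * gauss_moment p.
Proof.
pose G (t : R) := t `^ (p.+1%:R / 2 - 1) * expR (- t).
pose f (x : R) := 2 * (x ^+ p * expR (- x ^+ 2)).
pose a (n : nat) : R := n.+2%:R^-1; pose b (n : nat) : R := n.+2%:R.
have a0 n : 0 < a n by rewrite invr_gt0.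
have ab n : a n < b n.
  by rewrite (@lt_trans _ _ 1)// ?ltr1n// invf_lt1// ltr1n.
have da : nonincreasing_seq a.
  by move=> i j ij; rewrite lef_pV2 ?posrE// ler_nat.
have db : nondecreasing_seq b by move=> i j ij; rewrite ler_nat.
have cb : b n @[n --> \oo] --> +oo.
  rewrite (cvg_shiftS (fun n => n.+1%:R : R)).
  by rewrite (cvg_shiftS (fun n => n%:R : R)); exact: cvgr_idn.
have ca : a n @[n --> \oo] --> 0.
  by apply/gtr0_cvgV0 => //; apply: nearW => n; rewrite ltr0n.
have a20 n : 0 < a n ^+ 2 by rewrite exprn_gt0.
have da2 : nonincreasing_seq (fun n => a n ^+ 2).
  by move=> i j ij; rewrite lerXn2r ?nnegrE ?(ltW (a0 _))// da.
have db2 : nondecreasing_seq (fun n => b n ^+ 2).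
  by move=> i j ij; rewrite lerXn2r ?nnegrE// db.
have ca2 : a n ^+ 2 @[n --> \oo] --> 0.
  by rewrite -[X in _ --> X](mulr0 0); apply: cvgM.
have cb2 : b n ^+ 2 @[n --> \oo] --> +oo.
  apply/cvgryPge => A; near=> n; apply: (@le_trans _ _ (b n)).
    by near: n; move/cvgryPge: cb; exact.
  by rewrite expr2 ler_peMl// ler1n.
have [nd1 U1] := half_line_exhaust a0 da db ca cb.
have [nd2 U2] := half_line_exhaust a20 da2 db2 ca2 cb2.
have cf : continuous f by move=> x; apply: cvgM; [exact: cvg_cst|exact: continuous_expr_gauss].
have cG x : 0 < x -> {for x, continuous G}.
  move=> x0; apply: cvgM; last by apply: continuous_comp; [exact: opp_continuous|exact: continuous_expR].
  exact: (is_derive_continuous_at (is_derive1_powR (p.+1%:R / 2 - 1) x0)).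
have f0 x : 0 <= x -> 0 <= f x by move=> x0; rewrite mulr_ge0// mulr_ge0 ?expR_ge0// exprn_ge0.
have G0 x : 0 <= G x by rewrite mulr_ge0 ?expR_ge0// powR_ge0.
pose A n : set (measurableTypeR R) := `[a n, b n]%classic.
pose B n : set (measurableTypeR R) := `[a n ^+ 2, b n ^+ 2]%classic.
have h1 := @ge0_nondecreasing_set_cvg_integral _ (measurableTypeR R) R A (EFin \o f) mu nd1.
have h2 := @ge0_nondecreasing_set_cvg_integral _ (measurableTypeR R) R B (EFin \o G) mu nd2.
have E n : (\int[mu]_(x in B n) (EFin \o G) x = \int[mu]_(x in A n) (EFin \o f) x)%E.
  have dF x : is_derive x (1 : R) (fun x : R => x ^+ 2) (2 * x).
    by apply: (is_derive_eq (is_derive_expr 1 x)); rewrite expr1.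
  have F'E : (fun x : R => x ^+ 2)^`()%classic = (fun x => 2 * x).
    by apply/funext => x; rewrite derive1E (@derive_val _ _ _ _ _ _ _ (dF x)).
  have cF' : continuous (fun x : R => 2 * x).
    by move=> x; apply: cvgM; [exact: cvg_cst|exact: cvg_id].
  have cF : continuous (fun x : R => x ^+ 2) by exact: exprn_continuous.
  rewrite /A /B (@integration_by_substitution_increasing _ (fun x : R => x ^+ 2) G).
  - apply: eq_integral => x; rewrite inE/= in_itv/= => /andP[ax _]; congr (_%:E).
    have x0 : 0 < x by exact: lt_le_trans ax.
    rewrite F'E !fctE /G /f; have -> : (x ^+ 2) `^ (p.+1%:R / 2 - 1) = x `^ (p%:R - 1).
      rewrite -(powR_mulrn 2 (ltW x0)) -powRrM; congr (_ `^ _).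
      by rewrite -natr1; field.
    have -> : x ^+ p = x `^ (p%:R - 1) * x.
      rewrite -(powR_mulrn p (ltW x0)) -[in LHS](subrK 1 p%:R) powRD ?(gt_eqF x0) ?implybT//.
      by rewrite powRr1// ltW.
    by move: (_ `^ _) (expR _) => u w; ring.
  - exact: ltW.
  - move=> x y; rewrite !in_itv/= => /andP[xa _] /andP[ya _] xy.
    by rewrite ltr_pXn2r// nnegrE (le_trans (ltW (a0 n))).
  - by move=> x _; rewrite F'E; exact: cF'.
  - by rewrite F'E; apply/cvg_ex; exists (2 * a n); apply: cvg_at_right_filter; exact: cF'.
  - by rewrite F'E; apply/cvg_ex; exists (2 * b n); apply: cvg_at_left_filter; exact: cF'.
  - split; first by move=> x _; have [] := dF x.
      by apply: cvg_at_right_filter; exact: cF.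
    by apply: cvg_at_left_filter; exact: cF.
  - apply: continuous_in_subspaceT => x; rewrite inE/= in_itv/= => /andP[xa _].
    by apply: cG; exact: lt_le_trans xa.
have mI n : measurable (`[a n, b n]%classic : set (measurableTypeR R)) by exact: measurable_itv.
have mI2 n : measurable (`[a n ^+ 2, b n ^+ 2]%classic : set (measurableTypeR R)) by exact: measurable_itv.
have mf : measurable_fun [set: measurableTypeR R] (EFin \o f).
  by apply/measurable_EFinP; exact: continuous_measurable_fun.
have mG : measurable_fun [set: measurableTypeR R] (EFin \o G).
  apply/measurable_EFinP; apply: measurable_funM; first exact: measurable_powR.
  apply: continuous_measurable_fun => x.
  by apply: continuous_comp; [exact: opp_continuous|exact: continuous_expR].
have {}h1 := h1 mI (fun n => measurable_funS measurableT (@subsetT _ _) mf).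
have {}h2 := h2 mI2 (fun n => measurable_funS measurableT (@subsetT _ _) mG).
have {}h2 : (\int[mu]_(x in B n) (EFin \o G) x @[n --> \oo] -->
    \int[mu]_(x in \bigcup_n B n) (EFin \o G) x)%E.
  by apply: h2 => n x _; rewrite lee_fin.
have {}h1 : (\int[mu]_(x in A n) (EFin \o f) x @[n --> \oo] -->
    \int[mu]_(x in \bigcup_n A n) (EFin \o f) x)%E.
  apply: h1 => n x; rewrite /A /= in_itv/= => /andP[ax _]; rewrite lee_fin f0//.
  by rewrite (le_trans (ltW (a0 n))).
have e1 : (\int[mu]_(x in itv_oy) (EFin \o G) x = \int[mu]_(x in itv_oy) (EFin \o f) x)%E.
  rewrite -[in LHS]U2 -U1.
  apply: (cvg_unique _ h2); first exact: ereal_hausdorff.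
  have EE : (fun n => (\int[mu]_(x in B n) (EFin \o G) x)%E) = (fun n => (\int[mu]_(x in A n) (EFin \o f) x)%E) by exact/funext.
  by rewrite /= EE.
rewrite /Gamma /Rintegral -/G; have -> : (\int[mu]_(x in `]0%R, +oo[) (G x)%:E = \int[mu]_(x in itv_oy) (EFin \o f) x)%E by [].
rewrite -/(Rintegral mu itv_oy f) /f RintegralZl//.
exact: integrable_subset measurableT m_oy _ (expr_gauss_integrable p).
Unshelve. all: by end_near. Qed.

Lemma Gamma_half_gt0 (p : nat) : 0 < Gamma (p.+1%:R / 2 : R).
Proof. by rewrite Gamma_half mulr_gt0// gauss_moment_gt0. Qed.

Lemma Gamma_half_rec (p : nat) : Gamma (p.+3%:R / 2 : R) = (p.+1%:R / 2) * Gamma (p.+1%:R / 2).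
Proof. by rewrite !Gamma_half gauss_moment_rec; ring. Qed.

Lemma Gamma_half1 : Gamma (1%:R / 2 : R) = Num.sqrt pi.
Proof. by rewrite Gamma_half gauss_moment0; field. Qed.

End Gamma.

Section BesselSeries.
Context {R : realType}.
Implicit Types (z w : R[i]) (x y : R) (p k j N : nat).
Local Notation normc := (@Normc.normc R).

(* Here and below [p] stands for [m - 1], that is [nu = (p - 1) / 2]. *)
Definition bessel_term p z j : R[i] :=
  (-1) ^+ j / (j`!%:R * (Gamma ((p + j.*2).+1%:R / 2))%:C) * (z / 2) ^+ j.*2.

Definition bessel_sum p z N : R[i] := \sum_(j < N) bessel_term p z j.

Lemma bessel_seriesE p z :
  bessel_series ((p.+1%:R - 2) / 2) z = limn (series (bessel_term p z)).
Proof.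
have E : (fun j : nat => (-1) ^+ j / (j`!%:R * (Gamma ((p.+1%:R - 2) / 2 + j%:R + 1))%:C) * (z / 2) ^+ j.*2) =
    bessel_term p z.
  apply/funext => j; rewrite /bessel_term.
  have -> : (p.+1%:R - 2) / 2 + j%:R + 1 = (p + j.*2).+1%:R / 2 :> R; last by [].
  by rewrite -!natr1 natrD -muln2 natrM; field.
by rewrite /bessel_series E.
Qed.

Lemma bessel_series_lim p z l : clim \oo (bessel_sum p z) l ->
  bessel_series ((p.+1%:R - 2) / 2) z = l.
Proof.
move=> /climP h; rewrite bessel_seriesE; apply: (@cvg_lim _ (@norm_hausdorff _ R[i])).
by rewrite seriesEord.
Qed.

Lemma realC_neq0 x : x != 0 -> x%:C != 0 :> R[i].
Proof. by move=> x0; rewrite eq_complex /= eqxx andbT. Qed.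

Lemma Gamma_halfC_neq0 p : (Gamma (p.+1%:R / 2 : R))%:C != 0 :> R[i].
Proof. by apply: realC_neq0; rewrite gt_eqF// Gamma_half_gt0. Qed.

Lemma natC_half p : (p%:R / 2 : R)%:C = p%:R / 2 :> R[i].
Proof. by rewrite rmorphM fmorphV !rmorph_nat. Qed.

Lemma bessel_term0 p z : bessel_term p z 0 = (Gamma (p.+1%:R / 2 : R))%:C^-1.
Proof.
rewrite /bessel_term double0 addn0 fact0 !expr0 mulr1.
by move: (Gamma _)%:C => g; rewrite !mul1r.
Qed.

Lemma Gamma_halfC_rec p :
  (Gamma (p.+3%:R / 2 : R))%:C = p.+1%:R / 2 * (Gamma (p.+1%:R / 2 : R))%:C :> R[i].
Proof. by rewrite Gamma_half_rec -natC_half -rmorphM. Qed.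

(** Contiguity of the coefficients, from Gamma (x + 1) = x Gamma x: the terms j + 1 of the two lower
    orders combine into the term j of the highest. Truncated sums then satisfy the three-term
    recurrence exactly, so for z != 0 convergence passes from two orders to the next. *)
Lemma bessel_term_recursion p z j :
  p.+1%:R / 2 * bessel_term p.+2 z j.+1 - bessel_term p z j.+1 = (z / 2) ^+ 2 * bessel_term p.+4 z j.
Proof.
rewrite /bessel_term doubleS (_ : p.+2 + j.*2.+2 = (p + j.*2.+2).+2)%N ?addSn//.
rewrite (_ : (p + j.*2).+1.+4 = (p + j.*2.+2).+3)%N; last by rewrite !addnS.
rewrite !(Gamma_halfC_rec (p + j.*2.+2)%N) factS natrM.
have g0 := Gamma_halfC_neq0 (p + j.*2.+2)%N.
rewrite (_ : (p + j.*2.+2).+1%:R = p%:R + 2 * j%:R + 3 :> R[i]); last first.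
  rewrite (_ : (p + j.*2.+2).+1 = p + 2 * j + 3)%N; last by rewrite -muln2; lia.
  by rewrite natrD natrD natrM.
have p0 : (p%:R + 2 * j%:R + 3 : R[i]) != 0.
  by rewrite -natrM -!natrD addnC pnatr_eq0.
have j0 := @factC_neq0 R j; have j1 : (j%:R + 1 : R[i]) != 0 by rewrite natr1 pnatr_eq0.
rewrite -[j.+1%:R]natr1 -[p.+1%:R]natr1 [(-1) ^+ j.+1]exprS ![(z / 2) ^+ j.*2.+2]exprS ![(z / 2) ^+ j.*2.+1]exprS.
move: g0 p0 j0 j1; move: (Gamma _)%:C (j`!%:R) (j%:R) (p%:R) ((-1) ^+ j) ((z / 2) ^+ j.*2) => g f y q e Z g0 p0 j0 j1.
by field; rewrite g0 p0 j0 j1.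
Qed.

Lemma bessel_sum_recursion p z N :
  p.+1%:R / 2 * bessel_sum p.+2 z N.+1 - bessel_sum p z N.+1 = (z / 2) ^+ 2 * bessel_sum p.+4 z N.
Proof.
elim: N => [|N IH].
  have S1 q : bessel_sum q z 1 = bessel_term q z 0.
    by rewrite /bessel_sum; move: (bessel_term q z) => f; rewrite big_ord_recl big_ord0 addr0.
  have S0 q : bessel_sum q z 0 = 0 by rewrite /bessel_sum big_ord0.
  rewrite !S1 S0 mulr0 !bessel_term0.
  rewrite Gamma_halfC_rec; have g0 := Gamma_halfC_neq0 p.
  have p0 : (p.+1%:R : R[i]) != 0 by rewrite pnatr_eq0.
  by move: g0 p0; move: (Gamma _)%:C (p.+1%:R : R[i]) => g q g0 q0; field; rewrite g0 q0.
have E q M : bessel_sum q z M.+1 = bessel_sum q z M + bessel_term q z M by rewrite /bessel_sum big_ord_recr.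
rewrite E [X in _ - X]E [in RHS]E mulrDr opprD addrACA IH bessel_term_recursion.
by rewrite -mulrDr.
Qed.

Lemma clim_exp_poly z : clim \oo (exp_poly^~ z) (cexp z).
Proof.
apply: (@clim_squeeze _ _ _ _ _ _ (fun N => 2 * (expR (normc z) * exp_coeff (2 * normc z) N))).
  near=> N; have -> : exp_poly N z - cexp z = - cexp_rem N z by rewrite opprB.
  by rewrite normcN; exact: cexp_rem_le.
rewrite -[X in _ --> X](mulr0 2); apply: cvgM; first exact: cvg_cst.
rewrite -[X in _ --> X](mulr0 (expR (normc z))); apply: cvgM; first exact: cvg_cst.
exact: cvg_series_cvg_0 (is_cvg_series_exp_coeff _).
Unshelve. all: by end_near. Qed.

(** The duplication formula; it turns the series of orders - 1 / 2 and 1 / 2 into those of cos and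
    sin. *)
Lemma Gamma_half_odd j : (Gamma ((j.*2).+1%:R / 2 : R))%:C * (4 ^+ j * j`!%:R) =
  (j.*2)`!%:R * (Num.sqrt pi)%:C :> R[i].
Proof.
elim: j => [|j IH]; first by rewrite Gamma_half1 expr0 fact0 !mul1r mulr1.
rewrite doubleS Gamma_halfC_rec !factS !natrM exprS.
transitivity ((j.*2).+1%:R / 2 * 4 * j.+1%:R * ((Gamma ((j.*2).+1%:R / 2 : R))%:C * (4 ^+ j * j`!%:R)) : R[i]).
  by move: (Gamma _)%:C (4 ^+ j) => g e; ring.
rewrite IH (_ : (j.*2).+2%:R = 2 * j.+1%:R :> R[i]); last by rewrite -natrM mul2n.
by move: (Num.sqrt pi)%:C => g; field.
Qed.

Lemma bessel_term_cos z j : (Num.sqrt pi)%:C * bessel_term 0 z j =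
  (-1) ^+ j * (z ^+ j.*2 / (j.*2)`!%:R).
Proof.
rewrite /bessel_term add0n; have := Gamma_half_odd j; have := Gamma_halfC_neq0 (j.*2).
have := @factC_neq0 R j; have := @factC_neq0 R (j.*2).
have p4 : (4 ^+ j : R[i]) != 0 by rewrite expf_neq0// pnatr_eq0.
have -> : (z / 2) ^+ j.*2 = z ^+ j.*2 / 4 ^+ j.
  rewrite expr_div_n; congr (_ / _); rewrite -mul2n exprM; congr (_ ^+ _).
  by rewrite -natrX.
move: p4; move: (Gamma _)%:C (Num.sqrt pi)%:C (j`!%:R) ((j.*2)`!%:R) (4 ^+ j) ((-1) ^+ j) (z ^+ j.*2) => g q f f2 e s Z e0 f20 f0 g0 h.
have -> : q = g * (e * f) / f2 by rewrite h mulrC mulKf.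
by field; rewrite e0 f20 f0 g0.
Qed.

Lemma bessel_term_sin z j : (Num.sqrt pi)%:C * (z * bessel_term 2 z j) =
  2 * ((-1) ^+ j * (z ^+ (j.*2).+1 / (j.*2).+1`!%:R)).
Proof.
rewrite /bessel_term !addSn add0n Gamma_halfC_rec exprS factS natrM.
have := Gamma_half_odd j; have := Gamma_halfC_neq0 (j.*2).
have := @factC_neq0 R j; have := @factC_neq0 R (j.*2).
have q0 : ((j.*2).+1%:R : R[i]) != 0 by rewrite pnatr_eq0.
have p4 : (4 ^+ j : R[i]) != 0 by rewrite expf_neq0// pnatr_eq0.
have -> : (z / 2) ^+ j.*2 = z ^+ j.*2 / 4 ^+ j.
  rewrite expr_div_n; congr (_ / _); rewrite -mul2n exprM; congr (_ ^+ _).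
  by rewrite -natrX.
move: q0 p4; move: (Gamma _)%:C (Num.sqrt pi)%:C (j`!%:R) ((j.*2)`!%:R) (4 ^+ j) ((-1) ^+ j) (z ^+ j.*2) (_.+1%:R).
move=> g q f f2 e s Z c c0 e0 f20 f0 g0 h.
have -> : q = g * (e * f) / f2 by rewrite h mulrC mulKf.
by field; rewrite e0 f20 f0 g0 c0.
Qed.

Lemma exp_poly_cos z N : exp_poly N.*2 ('i * z) + exp_poly N.*2 (- ('i * z)) =
  2 * \sum_(j < N) (-1) ^+ j * (z ^+ j.*2 / (j.*2)`!%:R).
Proof.
elim: N => [|N IH]; first by rewrite /exp_poly !big_ord0 mulr0 addr0.
rewrite /exp_poly doubleS !big_ord_recr /= -!/(exp_poly _ _) mulrDr -IH.
have e : ('i * z) ^+ N.*2 = (-1) ^+ N * z ^+ N.*2 by rewrite exprMn; congr (_ * _); rewrite -mul2n exprM sqr_i.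
have e' : (- ('i * z)) ^+ N.*2 = (-1) ^+ N * z ^+ N.*2 by rewrite -e -mul2n !exprM sqrrN.
by rewrite !exprS e e'; ring.
Qed.

Lemma exp_poly_sin z N : exp_poly N.*2 ('i * z) - exp_poly N.*2 (- ('i * z)) =
  'i * (2 * \sum_(j < N) (-1) ^+ j * (z ^+ (j.*2).+1 / (j.*2).+1`!%:R)).
Proof.
elim: N => [|N IH]; first by rewrite /exp_poly !big_ord0 !mulr0 subr0.
rewrite /exp_poly doubleS !big_ord_recr /= -!/(exp_poly _ _) !mulrDr -IH.
have e : ('i * z) ^+ N.*2 = (-1) ^+ N * z ^+ N.*2 by rewrite exprMn; congr (_ * _); rewrite -mul2n exprM sqr_i.
have e' : (- ('i * z)) ^+ N.*2 = (-1) ^+ N * z ^+ N.*2 by rewrite -e -mul2n !exprM sqrrN.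
by rewrite !exprS e e'; ring.
Qed.

Lemma sqrt_piC_neq0 : (Num.sqrt pi)%:C != 0 :> R[i].
Proof. by apply: realC_neq0; rewrite gt_eqF// sqrtr_gt0 pi_gt0. Qed.

Lemma clim_subseq (u : nat -> nat) (f : nat -> R[i]) l : (forall N, (N <= u N)%N) ->
  clim \oo f l -> clim \oo (fun N => f (u N)) l.
Proof.
move=> hu h; have uy : u N @[N --> \oo] --> \oo.
  apply/cvgnyPge => A; near=> N; rewrite (leq_trans _ (hu N))//.
  by near: N; exact: nbhs_infty_ge.
exact: (@cvg_comp _ _ _ u (fun N => normc (f N - l)) _ _ _ uy h).
Unshelve. all: by end_near. Qed.

(** Order - 1 / 2, where the kernel is cos z / sqrt pi. Cutting at even length makes the two
    exponential polynomials add up to an exact cosine polynomial. *)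
Lemma bessel_sum_cvg0 z : clim \oo (bessel_sum 0 z)
  ((cexp ('i * z) + cexp (- ('i * z))) / (2 * (Num.sqrt pi)%:C)).
Proof.
have h w : clim \oo (fun N => exp_poly N.*2 w) (cexp w).
  by apply: (clim_subseq _ (clim_exp_poly w)) => N; rewrite -addnn leq_addr.
have hh := climZ ((2 * (Num.sqrt pi)%:C)^-1) (climD (h ('i * z)) (h (- ('i * z)))).
rewrite mulrC; apply: (near_clim _ (hh _ _)); apply: nearW => N.
rewrite exp_poly_cos.
have -> : \sum_(j < N) (-1) ^+ j * (z ^+ j.*2 / (j.*2)`!%:R) = (Num.sqrt pi)%:C * bessel_sum 0 z N.
  by rewrite /bessel_sum mulr_sumr; apply: eq_bigr => j _; rewrite bessel_term_cos.
by have := sqrt_piC_neq0; move: (_%:C) => q q0; field.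
Qed.

Lemma bessel_sum_cvg2 z : z != 0 -> clim \oo (bessel_sum 2 z)
  ((cexp ('i * z) - cexp (- ('i * z))) / ('i * (Num.sqrt pi)%:C * z)).
Proof.
move=> z0.
have h w : clim \oo (fun N => exp_poly N.*2 w) (cexp w).
  by apply: (clim_subseq _ (clim_exp_poly w)) => N; rewrite -addnn leq_addr.
have hh := climZ (('i * (Num.sqrt pi)%:C * z)^-1) (climD (h ('i * z)) (climZ (-1) (h (- ('i * z))))).
have i0 : ('i : R[i]) != 0 by rewrite neq0Ci.
rewrite mulrC -[- cexp (- _)]mulN1r; apply: (near_clim _ (hh _ _ _)); apply: nearW => N.
rewrite mulN1r exp_poly_sin.
have -> : 2 * \sum_(j < N) (-1) ^+ j * (z ^+ (j.*2).+1 / (j.*2).+1`!%:R) = (Num.sqrt pi)%:C * (z * bessel_sum 2 z N).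
  by rewrite /bessel_sum !mulr_sumr; apply: eq_bigr => j _; rewrite bessel_term_sin.
by have := sqrt_piC_neq0; move: i0 z0; move: (_%:C) ('i) => q i i0 z0 q0; field; rewrite q0 z0 i0.
Qed.

Lemma bessel_sum_cvg_rec p z l0 l1 : z != 0 -> clim \oo (bessel_sum p z) l0 ->
  clim \oo (bessel_sum p.+2 z) l1 ->
  clim \oo (bessel_sum p.+4 z) ((z / 2) ^- 2 * (p.+1%:R / 2 * l1 - l0)).
Proof.
move=> z0 h0 h1.
have sh (f : nat -> R[i]) l : clim \oo f l -> clim \oo (fun N : nat => f N.+1) l.
  exact: clim_subseq.
have hh := climZ ((z / 2) ^- 2) (climD (climZ (p.+1%:R / 2) (sh _ _ h1)) (climZ (-1) (sh _ _ h0))).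
rewrite -[- l0]mulN1r; apply: (near_clim _ (hh _ _ _ _)); apply: nearW => N.
by rewrite mulN1r bessel_sum_recursion mulKf// expf_neq0// mulf_neq0// invr_eq0 pnatr_eq0.
Qed.

End BesselSeries.

(** * Odd dimensions *)

Section OddDimension.
Context {R : realType}.
Implicit Types (z w v : R[i]) (x y s : R) (p k j : nat).
Local Notation Re := (@complex.Re R).
Local Notation Im := (@complex.Im R).
Local Notation normc := (@Normc.normc R).
Local Notation bess p z := (bessel_series ((p.+1%:R - 2) / 2) z).
Local Notation half_line := (`]0%R, +oo[%classic : set (measurableTypeR R)).
Variable n : nat.
Hypothesis n0 : (0 < n)%N.
Local Notation chi s := ((s / sinh s) ^+ n).

Let m_half : measurable half_line. Proof. exact: measurable_itv. Qed.

Let realCM x y : (x * y)%:C = x%:C * y%:C :> R[i]. Proof. exact: rmorphM. Qed.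

Lemma eq_in_cintegrable (f g : R -> R[i]) : {in half_line, f =1 g} ->
  cintegrable half_line f -> cintegrable half_line g.
Proof.
move=> fg [h1 h2]; split.
  by move: h1; apply: eq_integrable => // x xD /=; rewrite fg.
by move: h2; apply: eq_integrable => // x xD /=; rewrite fg.
Qed.

(** The folded integrand, with 2 cos (v s) or 2 i sin (v s) according to the parity of [p]. *)
Definition half_moment_fun p v s : R[i] :=
  (s ^+ p * chi s)%:C * (cexp ('i * v * s%:C) + (-1) ^+ p * cexp (- ('i * v * s%:C))).

(** The factor s^n of the weight supplies the zero of order n, so the numerator z^(n+p) e^(ivz) can
    be brought down to the real axis without a Taylor correction. *)
Lemma half_moment p v : `|Im v| < 1 / 2 ->
  cintegrable half_line (half_moment_fun p v) /\
  cintegral half_line (half_moment_fun p v) = exp_moment n v (n + p).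
Proof.
move=> vs; have [a an ga] := admissible_exp_moment n0 vs (n + p).
have [M0 vM] := @vanishing_pow_rem R n n0 (n + p)%N v.
have bN x y : `|x| <= 1 -> 0 <= y <= 1 ->
    normc ((x +i* y) ^+ (n + p) * cexp ('i * v * (x +i* y))) <= M0 * normc (x +i* y) ^+ n.
  move=> x1 /andP[y0 y1]; have := vM x y x1; rewrite ger0_norm// => /(_ y1).
  rewrite (_ : n - (n + p) = 0)%N; last by rewrite subnDA subnn.
  by rewrite /cexp_rem /exp_poly big_ord0 subr0.
have [h1 h2] := contour_shift n0 an ga bN.
have E : {in half_line, forall s, s%:C ^+ (n + p) * cexp ('i * v * s%:C) * (csinh s%:C)^-1 ^+ n +
    (- s)%:C ^+ (n + p) * cexp ('i * v * (- s)%:C) * (csinh (- s)%:C)^-1 ^+ n = half_moment_fun p v s}.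
  move=> s _; rewrite /half_moment_fun !csinh_real sinhN; move: (sinh s) => S.
  rewrite !rmorphN !rmorphM !rmorphXn rmorphM fmorphV /=.
  have -> : (- S%:C)^-1 = - 1 * S%:C^-1 :> R[i] by rewrite invrN mulN1r.
  have -> : (- s%:C) ^+ (n + p) = (-1) ^+ (n + p) * s%:C ^+ (n + p) :> R[i] by rewrite -exprMn mulN1r.
  rewrite mulrN !exprMn !exprD.
  have s2 : (-1) ^+ n * (-1) ^+ n = 1 :> R[i] by rewrite -exprMn mulrNN mulr1 expr1n.
  move: s2; move: ((-1) ^+ n) ((-1) ^+ p) (s%:C ^+ n) (s%:C ^+ p) (_^-1 ^+ n) (cexp _) (cexp _) => e e' T T' I a1 a2 s2.
  by ring: s2.
split.
  by apply: (eq_in_cintegrable _ h1).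
by rewrite -(eq_cintegral E) -h2.
Qed.

Local Notation F := (strip_pinfty (1 / 2 : R)).
Local Notation scale_at k v := (cexp (- (pi%:C * v)) * v ^+ n.-1 * v^-1 ^+ k).

Definition half_limit p : R[i] := (-1) ^+ n * moment_limit n (n + p).

Lemma half_limitS p : half_limit p.+1 = pi *i * half_limit p.
Proof. by rewrite /half_limit /moment_limit addnS exprS; ring. Qed.

Lemma half_moment_asymptotic p :
  clim F (fun v => cintegral half_line (half_moment_fun p v) / scale_at 0 v) (half_limit p).
Proof.
have h := climZ ((-1) ^+ n : R[i]) (exp_moment_asymptotic n0 (lexx (1 / 2 : R)) (n + p)).
apply: (near_clim _ (h _)); near=> v.
have vs : `|Im v| < 1 / 2 by near: v; exact: near_strip.
have v0 : v != 0 by near: v; exact: near_neq0.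
have [_ ->] := half_moment p vs; rewrite expr0 mulr1.
have e0 : (-1) ^+ n != 0 :> R[i] by rewrite signr_eq0.
move: (cexp_neq0 (- (pi%:C * v))) (expf_neq0 n.-1 v0) e0.
move: (cexp _) (v ^+ _) ((-1) ^+ n) (exp_moment _ _ _) => C V e E C0 V0 e0.
by field; rewrite C0 V0 e0.
Unshelve. all: by end_near. Qed.

Lemma half_bessel_cvg k z : z != 0 ->
  clim \oo (bessel_sum (k.*2) z) (bess (k.*2) z) /\
  clim \oo (bessel_sum (k.*2).+2 z) (bess (k.*2).+2 z).
Proof.
move=> z0; elim: k => [|k [h1 h2]].
  have h0 := bessel_sum_cvg0 z; have h2 := bessel_sum_cvg2 z0.
  by rewrite double0 (bessel_series_lim h0) (bessel_series_lim h2).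
rewrite doubleS; split; first exact: h2.
have h := bessel_sum_cvg_rec z0 h1 h2.
have e := bessel_series_lim h; rewrite e; exact: h.
Qed.

Lemma half_bessel_rec k z : z != 0 ->
  bess (k.*2).+4 z = (z / 2) ^- 2 * ((k.*2).+1%:R / 2 * bess (k.*2).+2 z - bess (k.*2) z).
Proof.
move=> z0; have [h1 h2] := half_bessel_cvg k z0.
exact: bessel_series_lim (bessel_sum_cvg_rec z0 h1 h2).
Qed.

(** The integrand of [b n (2 * k + 1)] with an extra s^(2 j): the three-term recurrence expresses k
    + 2 through k with one more factor s^2, so all j are treated together. *)
Definition bessel_moment_fun k j v s : R[i] :=
  (s ^+ (j + k).*2 * chi s)%:C * bess (k.*2) (s%:C * v).

Definition bessel_limit k j : R[i] :=
  (2 * pi%:C) ^+ k * half_limit (j.*2) / (2 * (Num.sqrt pi)%:C).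

Lemma cintegral_comb (f1 f0 f2 : R -> R[i]) z w : cintegrable half_line f1 -> cintegrable half_line f0 ->
  {in half_line, forall s, z * (w * f1 s + -1 * f0 s) = f2 s} ->
  cintegral half_line f2 = z * (w * cintegral half_line f1 + -1 * cintegral half_line f0).
Proof.
move=> i1 i0 E; have c1 := cintegrableZ w m_half i1; have c0 := cintegrableZ (-1) m_half i0.
rewrite -(eq_cintegral E) (cintegralZ _ m_half (cintegrableD m_half c1 c0)).
by rewrite (cintegralD m_half c1 c0) (cintegralZ _ m_half i1) (cintegralZ _ m_half i0).
Qed.

(** In the recurrence the middle order contributes v^-2 v^-(k+1), one power of v too small, so only
    the lowest order survives. It brings - 4 v^-2 and a factor s^2, which multiplies the limit by (i
    pi)^2; two steps of k thus give (2 pi)^2 v^-2. *)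
Lemma bessel_moment_asymptotic k j :
  (forall v, v != 0 -> `|Im v| < 1 / 2 -> cintegrable half_line (bessel_moment_fun k j v)) /\
  clim F (fun v => cintegral half_line (bessel_moment_fun k j v) / scale_at k v) (bessel_limit k j).
Proof.
have pos s : s \in half_line -> 0 < s by rewrite inE /= in_itv/= andbT.
(* Two consecutive values of k are carried, as the recurrence has three terms. *)
suff : forall k, (forall j,
  (forall v, v != 0 -> `|Im v| < 1 / 2 -> cintegrable half_line (bessel_moment_fun k j v)) /\
  clim F (fun v => cintegral half_line (bessel_moment_fun k j v) / scale_at k v) (bessel_limit k j)) /\ (forall j,
  (forall v, v != 0 -> `|Im v| < 1 / 2 -> cintegrable half_line (bessel_moment_fun k.+1 j v)) /\
  clim F (fun v => cintegral half_line (bessel_moment_fun k.+1 j v) / scale_at k.+1 v) (bessel_limit k.+1 j)).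
  by move=> /(_ k)[/(_ j)].
have q0 := @sqrt_piC_neq0 R.
move=> {k j}; elim => [|k [IH0 IH1]]; last split => [j|j].
- split => j.
  + have E v : {in half_line, forall s, (2 * (Num.sqrt pi)%:C)^-1 * half_moment_fun (j.*2) v s = bessel_moment_fun 0 j v s}.
      move=> s _; rewrite /half_moment_fun /bessel_moment_fun addn0 (bessel_series_lim (bessel_sum_cvg0 _)).
      rewrite -signr_odd odd_double expr0 mul1r (_ : 'i * (s%:C * v) = 'i * v * s%:C); last by ring.
      move: q0; move: (cexp (- _)) (cexp _) (Num.sqrt pi)%:C ((_ * chi s)%:C) => a1 a2 a3 a4 q0.
      by field.
    split => [v v0 vs|].
      by apply: (eq_in_cintegrable (E v)); apply: cintegrableZ => //; have [] := half_moment (j.*2) vs.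
    have h := climZ ((2 * (Num.sqrt pi)%:C)^-1) (half_moment_asymptotic (j.*2)).
    have -> : bessel_limit 0 j = (2 * (Num.sqrt pi)%:C)^-1 * half_limit (j.*2).
      by rewrite /bessel_limit expr0 mul1r mulrC.
    apply: (near_clim _ (h _)); near=> v.
    have vs : `|Im v| < 1 / 2 by near: v; exact: near_strip.
    have [hi _] := half_moment (j.*2) vs.
    by rewrite -(eq_cintegral (E v)) cintegralZ// mulrA.
  + have E v : v != 0 -> {in half_line, forall s, ('i * (Num.sqrt pi)%:C * v)^-1 * half_moment_fun (j.*2).+1 v s = bessel_moment_fun 1 j v s}.
      move=> v0 s /pos s0; have sv0 : s%:C * v != 0 by rewrite mulf_neq0// realC_neq0// gt_eqF.
      have sC0 : s%:C != 0 :> R[i] by rewrite realC_neq0// gt_eqF.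
      rewrite /half_moment_fun /bessel_moment_fun (bessel_series_lim (bessel_sum_cvg2 sv0)).
      rewrite -signr_odd /= odd_double expr1 mulN1r (_ : 'i * (s%:C * v) = 'i * v * s%:C); last by ring.
      rewrite addn1 doubleS [in RHS]exprS -[in RHS]mulrA (realCM s).
      have alg (a1 a2 q a4 S i : R[i]) : q != 0 -> i != 0 -> S != 0 ->
          (i * q * v)^-1 * (a4 * (a1 - a2)) = S * a4 * ((a1 - a2) / (i * q * (S * v))).
        by move=> q1 i1 S1; field; rewrite q1 i1 S1 v0.
      exact: (alg _ _ _ _ _ _ q0 (@neq0Ci R[i]) sC0).
    split => [v v0 vs|].
      by apply: (eq_in_cintegrable (E v v0)); apply: cintegrableZ => //; have [] := half_moment (j.*2).+1 vs.
    have h := climZ (('i * (Num.sqrt pi)%:C)^-1) (half_moment_asymptotic (j.*2).+1).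
    have -> : bessel_limit 1 j = ('i * (Num.sqrt pi)%:C)^-1 * half_limit (j.*2).+1.
      rewrite half_limitS /bessel_limit expr1 (_ : pi *i = 'i * pi%:C :> R[i]); last by apply: cplx_eq => /=; ring.
      by move: q0 (@neq0Ci R[i]); move: (_%:C) ('i) (half_limit _) => a1 i L q0 i0; field; rewrite q0 i0.
    apply: (near_clim _ (h _)); near=> v.
    have v0 : v != 0 by near: v; exact: near_neq0.
    have vs : `|Im v| < 1 / 2 by near: v; exact: near_strip.
    have [hi _] := half_moment (j.*2).+1 vs.
    rewrite -(eq_cintegral (E v v0)) cintegralZ// expr0 mulr1 expr1.
    have S0 : cexp (- (pi%:C * v)) * v ^+ n.-1 != 0 by rewrite mulf_neq0 ?cexp_neq0// expf_neq0.
    move: v0 q0 (@neq0Ci R[i]) S0; move: (cintegral _ _) (_ * v ^+ _) ('i) (_%:C) => M1 S i q v0 q0 i0 S0.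
    by field; rewrite v0 q0 i0 S0.
- by split; [move=> v v0 vs; have [h _] := IH1 j; exact: h|have [_ h] := IH1 j].
have E v : v != 0 -> {in half_line, forall s, 4 * (v^-1 ^+ 2) * ((k.*2).+1%:R / 2 * bessel_moment_fun k.+1 j v s + -1 * bessel_moment_fun k j.+1 v s)
   = bessel_moment_fun k.+2 j v s}.
  move=> v0 s /pos s0; have sv0 : s%:C * v != 0 by rewrite mulf_neq0// realC_neq0// gt_eqF.
  have sC0 : s%:C != 0 :> R[i] by rewrite realC_neq0// gt_eqF.
  have e1 : ((j + k.+2).*2 = (j + k.+1).*2.+2)%N by rewrite addnS doubleS.
  rewrite /bessel_moment_fun e1 addSnnS; move: (j + k.+1).*2 => q.
  have e2 : (s ^+ q.+2 * chi s)%:C = s%:C * (s%:C * (s ^+ q * chi s)%:C) :> R[i].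
    by rewrite -!realCM !exprS !mulrA.
  rewrite !doubleS half_bessel_rec// e2.
  have alg (a1 a2 a3 a4 S : R[i]) : S != 0 -> 4 * v^-1 ^+ 2 * (a4 * (a1 * a2) + -1 * (a1 * a3)) =
      S * (S * a1) * ((S * v / 2) ^- 2 * (a4 * a2 - a3)).
    by move=> S1; field; rewrite S1 v0.
  exact: (alg _ _ _ _ _ sC0).
split => [v v0 vs|].
  apply: (eq_in_cintegrable (E v v0)); apply: cintegrableZ => //.
  by apply: cintegrableD => //; apply: cintegrableZ => //; [apply: (IH1 j).1|apply: (IH0 j.+1).1].
have h := climD (climM (climZ (4 * ((k.*2).+1%:R / 2)) (clim_inv (1 / 2))) (IH1 j).2) (climZ (-4) (IH0 j.+1).2).
have -> : bessel_limit k.+2 j = 4 * ((k.*2).+1%:R / 2) * 0 * bessel_limit k.+1 j + - 4 * bessel_limit k j.+1.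
  rewrite mulr0 mul0r add0r /bessel_limit doubleS !half_limitS !exprS.
  rewrite (_ : pi *i = 'i * pi%:C :> R[i]); last by apply: cplx_eq => /=; ring.
  have i2 : 'i * 'i = -1 :> R[i] by rewrite -expr2 sqr_i.
  move: (pi%:C) (half_limit _) ((2 * _)^-1) ((2 * _) ^+ k) => P L q E2.
  by ring: i2.
apply: (near_clim _ (h _ _ _ _)); near=> v.
have v0 : v != 0 by near: v; exact: near_neq0.
have vs : `|Im v| < 1 / 2 by near: v; exact: near_strip.
have i1 := (IH1 j).1 v v0 vs; have i0 := (IH0 j.+1).1 v v0 vs.
have e := cintegral_comb i1 i0 (E v v0).
have u0 : v^-1 != 0 by rewrite invr_eq0.
have S0 : cexp (- (pi%:C * v)) * v ^+ n.-1 != 0 by rewrite mulf_neq0 ?cexp_neq0// expf_neq0.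
have U0 := expf_neq0 k u0.
have alg (M2 M1 M0 S U c u : R[i]) : S != 0 -> U != 0 -> u != 0 ->
    M2 = 4 * u ^+ 2 * (c * M1 + -1 * M0) ->
    4 * c * u * (M1 / (S * (u * U))) + - 4 * (M0 / (S * U)) = M2 / (S * (u * (u * U))).
  by move=> S1 U1 u1 ->; field; rewrite S1 U1 u1.
rewrite (exprS _ k.+1) (exprS _ k); exact: (alg _ _ _ _ _ _ _ S0 U0 u0 e).
Unshelve. all: by end_near. Qed.

End OddDimension.

(** * From moments to [b] in odd dimension *)

Section OddTheorem.
Context {R : realType}.
Implicit Types (z w v : R[i]) (x y s : R) (p k j : nat).
Local Notation Re := (@complex.Re R).
Local Notation Im := (@complex.Im R).
Local Notation bess p z := (bessel_series ((p.+1%:R - 2) / 2) z).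
Local Notation half_line := (`]0%R, +oo[%classic : set (measurableTypeR R)).
Variable n : nat.
Hypothesis n0 : (0 < n)%N.

Lemma clim_strip_le d d' (f : R[i] -> R[i]) l : d' <= d ->
  clim (strip_pinfty d) f l -> clim (strip_pinfty d') f l.
Proof.
move=> dd; apply: cvg_trans => A [M _ MA]; exists M => // v Mv vd.
by apply: MA => //=; exact: lt_le_trans dd.
Qed.

Lemma half_limit0 : half_limit n 0 = (2 * pi ^+ n.+1 / (n.-1)`!%:R)%:C :> R[i].
Proof.
rewrite /half_limit /moment_limit addn0 (_ : pi *i = 'i * pi%:C :> R[i]); last by apply: cplx_eq => /=; ring.
have i1 : 'i ^+ n * 'i ^+ n.-1 * 'i * (-1) ^+ n = 1 :> R[i].
  rewrite -exprD -exprSr -addnS (prednK n0) addnn -mul2n exprM sqr_i.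
  by rewrite -exprMn mulrNN mulr1 expr1n.
have alg (e I I' i P P' f : R[i]) : I * I' * i * e = 1 ->
   e * (I * P * (2 * (i * P') * I' / f)) = 2 * (P' * P) / f.
  by move=> h; rewrite -[RHS]mulr1 -h; ring.
rewrite exprMn (alg _ _ _ _ _ _ _ i1) -exprS rmorphM fmorphV rmorphM rmorphXn.
by rewrite !rmorph_nat.
Qed.

Lemma b_odd k v : b n (2 * k + 1)%N v =
  (2 / ((4 * pi) ^+ (n + k) * (2 * Num.sqrt pi)))%:C * cintegral half_line (bessel_moment_fun n k 0 v).
Proof.
rewrite /b; have -> : (4 * pi : R) `^ (n%:R + (2 * k + 1)%:R / 2) = (4 * pi) ^+ (n + k) * (2 * Num.sqrt pi).
  have p0 : 0 < 4 * pi :> R by rewrite mulr_gt0 ?pi_gt0.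
  have -> : n%:R + (2 * k + 1)%:R / 2 = (n + k)%:R + 2^-1 :> R.
    have -> : (2 * k + 1)%:R = 2 * k%:R + 1 :> R by rewrite natrD natrM.
    by rewrite natrD; field.
  rewrite powRD ?(gt_eqF p0) ?implybT// powR_mulrn ?(ltW p0)// powR12_sqrt ?(ltW p0)//.
  congr (_ * _); rewrite sqrtrM//; congr (_ * _).
  by rewrite (_ : 4 = 2 ^+ 2) ?sqrtr_sqr ?ger0_norm// -natrX.
congr (_ * _); apply: eq_cintegral => s _.
rewrite /bessel_moment_fun besselJ_entireE add0n addn1 /= mul2n.
by [].
Qed.

Lemma odd_constant k :
  (2 / ((4 * pi) ^+ (n + k) * (2 * Num.sqrt pi)))%:C * bessel_limit n k 0 =
  ((2 ^+ k * 4 ^+ n * (n.-1)`!%:R)^-1 : R)%:C :> R[i].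
Proof.
rewrite /bessel_limit double0 half_limit0.
have -> : (2 * pi%:C) ^+ k * (2 * pi ^+ n.+1 / (n.-1)`!%:R)%:C / (2 * (Num.sqrt pi)%:C) =
  ((2 * pi) ^+ k * (2 * pi ^+ n.+1 / (n.-1)`!%:R) / (2 * Num.sqrt pi))%:C :> R[i].
  have h2 : (2 : R[i]) = (2 : R)%:C by rewrite rmorph_nat.
  by rewrite h2 -!rmorphM -rmorphXn -fmorphV -!rmorphM.
rewrite -rmorphM; congr (_%:C).
have q2 : Num.sqrt pi ^+ 2 = pi :> R by rewrite sqr_sqrtr// pi_ge0.
have q0 : Num.sqrt pi != 0 :> R by rewrite gt_eqF// sqrtr_gt0 pi_gt0.
have f0 : ((n.-1)`!%:R : R) != 0 by rewrite pnatr_eq0 -lt0n fact_gt0.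
have P0 : (pi : R) ^+ n != 0 by rewrite expf_neq0// gt_eqF// pi_gt0.
have P1 : (pi : R) ^+ k != 0 by rewrite expf_neq0// gt_eqF// pi_gt0.
have E0 : (2 : R) ^+ k != 0 by rewrite expf_neq0.
have E1 : (4 : R) ^+ n != 0 by rewrite expf_neq0// pnatr_eq0.
rewrite exprMn !exprD (_ : (4 : R) ^+ k = 2 ^+ k * 2 ^+ k); last by rewrite -exprMn -natrM.
rewrite exprMn exprS -[X in X * pi ^+ n]q2.
move: q0 f0 P0 P1 E0 E1; move: (Num.sqrt pi) ((n.-1)`!%:R) (pi ^+ n) (pi ^+ k) (2 ^+ k) (4 ^+ n) => q f P1 P2 E1 E2 *.
by field; do ?[apply/andP; split] => //.
Qed.

(** All these strips lie in |Im v| < 1 / 2, where the moment asymptotics hold. The power v^(n-1)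
    comes from the pole of order n at i pi and v^-k from the Bessel kernel. *)
Lemma b_odd_asymptotic k :
  equiv_at (strip_pinfty ((2 / 3) ^+ k * (1 / 2)))
        (fun v : R[i] => b n (2 * k + 1)%N v)
        (fun v : R[i] =>
           ((2 ^+ k * 4 ^+ n * (n.-1)`!%:R)^-1 : R)%:C *
           v ^ (n%:Z - k%:Z - 1) * cexp (- (pi%:C * v))).
Proof.
apply/climP; apply: (@clim_strip_le (1 / 2) _ _ _ _).
  by rewrite ler_piMl// exprn_ile1//; lra.
have h := (@bessel_moment_asymptotic R n n0 k 0%N).2.
set c := ((_)^-1 : R)%:C.
have c0 : c != 0.
  by apply: realC_neq0; rewrite invr_neq0// !mulf_neq0 ?expf_neq0 ?pnatr_eq0// -lt0n fact_gt0.
have := climZ ((2 / ((4 * pi) ^+ (n + k) * (2 * Num.sqrt pi)))%:C / c) h.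
rewrite mulrAC odd_constant -/c divff// => {}h.
apply: (near_clim _ (h _)); near=> v.
have v0 : v != 0 by near: v; exact: near_neq0.
rewrite b_odd.
have -> : v ^ (n%:Z - k%:Z - 1) = v ^+ n.-1 * v^-1 ^+ k.
  have -> : (n%:Z - k%:Z - 1 = n.-1%:Z - k%:Z)%R by lia.
  by rewrite expfzDr// -exprnN exprVn.
have alg (C c' M E V U : R[i]) : C / c' * (M / (E * V * U)) = C * M / (c' * (V * U) * E).
  by rewrite !invfM; ring.
exact: alg.
Unshelve. all: by end_near. Qed.

End OddTheorem.

(** * Descent from dimension [m + 1] to dimension [m] *)

Section RealBessel.
Context {R : realType}.
Implicit Types (x y t a b c v : R) (p k j N : nat).
Local Notation bess p z := (bessel_series ((p.+1%:R - 2) / 2) z).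

Definition gamma_half p : R := Gamma (p.+1%:R / 2).
Local Notation gam := gamma_half.

Lemma gamma_half_gt0 p : 0 < gam p. Proof. exact: Gamma_half_gt0. Qed.

Lemma gamma_half_rec p : gam p.+2 = (p.+1%:R / 2) * gam p. Proof. exact: Gamma_half_rec. Qed.

Definition ebessel_coef p j : R := (- 4^-1) ^+ j / (j`!%:R * gam (p + j.*2)%N).
(* [(x / 2)^(- nu) * J_nu(x)] as an entire function of [y = x^2]. *)
Definition ebessel p y : R := limn (pseries (ebessel_coef p) y).

(** In steps of 2 the sequence is nondecreasing from its second entry on; the first step has the
    factor (p + 1) / 2, which is 1 / 2 for p = 0, hence the minimum of two entries. *)
Lemma Gamma_half_lower p : exists2 c : R, 0 < c & forall j, c <= gam (p + j.*2)%N.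
Proof.
pose g j := gam (p + j.*2)%N.
have g0 j : 0 < g j by exact: gamma_half_gt0.
have gS j : g j.+1 <= g j.+2.
  rewrite /g !doubleS !addnS (gamma_half_rec (p + j.*2).+2).
  rewrite ler_peMl ?(ltW (gamma_half_gt0 _))// ler_pdivlMr// mul1r ler_nat; lia.
have h j : g 1%N <= g j.+1.
  elim: j => [|j IH]; first exact: lexx.
  exact: (le_trans IH (gS j)).
exists (Num.min (g 0%N) (g 1%N)); first by rewrite lt_min; apply/andP; split; exact: g0.
suff H (u : nat -> R) : (forall j, u 1%N <= u j.+1) -> forall j, Num.min (u 0%N) (u 1%N) <= u j.
  exact: (H g h).
by move=> hu [|j]; rewrite ge_min ?lexx// hu orbT.
Qed.

Lemma ebessel_coef_diffs p : pseries_diffs (ebessel_coef p) = (fun j => - 4^-1 * ebessel_coef p.+2 j).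
Proof.
apply/funext => j; rewrite /pseries_diffs /ebessel_coef doubleS !addnS !addSn factS natrM exprS.
have f0 : (j`!%:R : R) != 0 by rewrite pnatr_eq0 -lt0n fact_gt0.
have g0 : gam (p + j.*2).+2 != 0 by rewrite gt_eqF// gamma_half_gt0.
have j0 : (j.+1%:R : R) != 0 by rewrite pnatr_eq0.
by move: f0 g0 j0; move: (gam _) (j`!%:R) (j.+1%:R) ((- 4^-1) ^+ j) => g f c e f0 g0 c0; field; rewrite f0 g0 c0.
Qed.

(** Comparison with the exponential series of |y| / 4, the Gamma factors being bounded below. *)
Lemma ebessel_cvg p y : cvgn (pseries (ebessel_coef p) y).
Proof.
have [c c0 h] := Gamma_half_lower p; rewrite /pseries.
apply: normed_cvg.
apply: (@series_le_cvg _ _ (fun j => c^-1 * exp_coeff (`|y| / 4) j)) => [j|j|j|].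
- exact: normr_ge0.
- by rewrite mulr_ge0 ?invr_ge0 ?(ltW c0)// exp_coeff_ge0// divr_ge0.
- rewrite /= normrM normrX /ebessel_coef normrM normrX normrN normfV (gtr0_norm (_ : 0 < 4))//.
  have P : 0 < j`!%:R * gam (p + j.*2)%N by rewrite mulr_gt0 ?gamma_half_gt0// ltr0n fact_gt0.
  rewrite normfV (gtr0_norm P).
  rewrite /exp_coeff /= (expr_div_n `|y|) -exprVn invfM.
  have -> : 4^-1 ^+ j * (j`!%:R^-1 / gam (p + j.*2)%N) * `|y| ^+ j =
     (gam (p + j.*2)%N)^-1 * (`|y| ^+ j * 4^-1 ^+ j / j`!%:R) by ring.
  rewrite ler_wpM2r ?lef_pV2 ?posrE ?gamma_half_gt0//.
- apply: is_cvg_seriesZ; exact: is_cvg_series_exp_coeff.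
Qed.

Lemma is_derive_ebessel p y : is_derive y (1 : R) (ebessel p) (- 4^-1 * ebessel p.+2 y).
Proof.
have ZE q (c : R) : pseries (fun j => c * ebessel_coef q j) = (fun x => (fun N => c * pseries (ebessel_coef q) x N)).
  apply/funext => x; apply/funext => N; rewrite /pseries /series /= mulr_sumr.
  by apply: eq_bigr => j _; rewrite mulrA.
have dE q : pseries (pseries_diffs (ebessel_coef q)) = (fun x => (fun N => - 4^-1 * pseries (ebessel_coef q.+2) x N)).
  by rewrite ebessel_coef_diffs ZE.
have ZC q x (c : R) : cvgn (fun N => c * pseries (ebessel_coef q) x N).
  by apply: is_cvgM; [exact: is_cvg_cst|exact: ebessel_cvg].
have h := @pseries_snd_diffs R (ebessel_coef p) (`|y| + 1) y (@ebessel_cvg p _).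
apply: (is_derive_eq (h _ _ _)).
- by rewrite dE; exact: ZC.
- rewrite ebessel_coef_diffs.
  rewrite (_ : pseries_diffs _ = (fun j => (- 4^-1) * (- 4^-1) * ebessel_coef p.+4 j)).
    by rewrite ZE; exact: ZC.
  apply/funext => j; rewrite /pseries_diffs mulrCA -/(pseries_diffs (ebessel_coef p.+2) j).
  by rewrite ebessel_coef_diffs mulrA.
- by rewrite [ltRHS]ger0_norm ?ltrDl// addr_ge0.
- rewrite dE /ebessel; apply/cvg_lim => //.
  by apply: cvgM; [exact: cvg_cst|exact: ebessel_cvg].
Qed.

Lemma ebessel_continuous p : continuous (ebessel p).
Proof. by move=> y; exact: (is_derive_continuous_at (is_derive_ebessel p y)). Qed.

Lemma bessel_sum_real p x N :
  bessel_sum p x%:C N = (pseries (ebessel_coef p) (x ^+ 2) N)%:C.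
Proof.
rewrite /bessel_sum /pseries seriesEord /= rmorph_sum; apply: eq_bigr => j _.
rewrite /bessel_term /ebessel_coef /gamma_half.
have -> : x%:C / 2 = (x / 2)%:C by rewrite rmorphM fmorphV rmorph_nat.
move: (Gamma _) => g; have -> : (-1) ^+ j / (j`!%:R * g%:C) = ((-1) ^+ j / (j`!%:R * g))%:C :> R[i].
  by rewrite [in RHS]rmorphM fmorphV [in RHS]rmorphM rmorphXn rmorphN1 rmorph_nat.
rewrite -rmorphXn -rmorphM; congr (_%:C); rewrite -mul2n exprM expr_div_n exprMn.
rewrite (_ : 2 ^- 2 = 4^-1 :> R); last by rewrite -natrX.
have -> : (- 4^-1 : R) ^+ j = (-1) ^+ j * 4^-1 ^+ j by rewrite -exprMn mulN1r.
by ring.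
Qed.

Lemma ebessel_clim p x : clim \oo (bessel_sum p x%:C) (ebessel p (x ^+ 2))%:C.
Proof.
have h := @ebessel_cvg p (x ^+ 2).
apply: (@clim_squeeze _ _ _ _ _ _ (fun N => `|pseries (ebessel_coef p) (x ^+ 2) N - ebessel p (x ^+ 2)|)).
  by apply: nearW => N; rewrite bessel_sum_real -rmorphB normc_real.
apply/norm_cvg0P; apply/subr_cvg0; exact: h.
Qed.

Lemma bessel_real p x : bess p x%:C = (ebessel p (x ^+ 2))%:C.
Proof. exact: bessel_series_lim (ebessel_clim p x). Qed.

Lemma ebessel0 p : ebessel p 0 = (gam p)^-1.
Proof.
rewrite /ebessel; apply/cvg_lim => //; apply: cvg_near_cst; near=> N.
have -> : N = N.-1.+1 by rewrite prednK //; near: N; exists 1%N.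
rewrite /pseries seriesEord /= big_ord_recl big1 ?addr0 => [|i _]; last by rewrite expr0n mulr0.
by rewrite /ebessel_coef expr0 double0 addn0 fact0 !mulr1 !mul1r.
Unshelve. all: by end_near. Qed.

(** Inherited from the complex recurrence at sqrt y for y > 0; at y = 0, where that recurrence
    divides by 0, it is the functional equation of Gamma. *)
Lemma ebessel_rec p y : 0 <= y ->
  ebessel p y = p.+1%:R / 2 * ebessel p.+2 y - y / 4 * ebessel p.+4 y.
Proof.
rewrite le_eqVlt => /predU1P[<-|y0].
  rewrite mul0r mul0r subr0 !ebessel0 gamma_half_rec invfM mulrA divff ?mul1r// mulf_neq0 ?pnatr_eq0 ?invr_neq0.

have [x x0 ->] : exists2 x, x != 0 & y = x ^+ 2.
  by exists (Num.sqrt y); rewrite ?sqr_sqrtr ?(ltW y0)// gt_eqF// sqrtr_gt0.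
have xC : x%:C != 0 :> R[i] by exact: realC_neq0.
have := bessel_series_lim (bessel_sum_cvg_rec xC (ebessel_clim p x) (ebessel_clim p.+2 x)).
rewrite bessel_real.
have -> : (x%:C / 2) ^- 2 * (p.+1%:R / 2 * (ebessel p.+2 (x ^+ 2))%:C - (ebessel p (x ^+ 2))%:C) =
  ((x / 2) ^- 2 * (p.+1%:R / 2 * ebessel p.+2 (x ^+ 2) - ebessel p (x ^+ 2)))%:C.
  have h2 : (2 : R[i]) = (2 : R)%:C by rewrite rmorph_nat.
  have hp : (p.+1%:R : R[i]) = (p.+1%:R : R)%:C by rewrite rmorph_nat.
  by rewrite h2 hp -!fmorphV -!rmorphM -!rmorphXn -fmorphV -rmorphB -rmorphM.
move/(congr1 (@complex.Re R)) => /=.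
by move: (ebessel _ _) (ebessel _ _) (ebessel _ _) => e0 e1 e2 ->; field.
Qed.

Opaque ebessel.

(* The hypotheses are the Bessel equation of [f0], written as a first order system. *)
Lemma energy_le (f0 f1 f2 : R -> R) (a : R) : 0 <= a ->
  (forall v, is_derive v (1 : R) f0 (- (v / 2) * f1 v)) ->
  (forall v, is_derive v (1 : R) f1 (- (v / 2) * f2 v)) ->
  (forall v, f0 v = (a + 1) / 2 * f1 v - v ^+ 2 / 4 * f2 v) ->
  forall v, 0 <= v -> f0 v ^+ 2 + v ^+ 2 / 4 * f1 v ^+ 2 <= f0 0 ^+ 2.
Proof.
move=> a0 d0 d1 rec v v0.
(* Minus the energy f0^2 + f0'^2, since f0' = - t f1 / 2. Its derivative is the damping term, of
   constant sign for t >= 0. *)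
pose H t := - (f0 t ^+ 2 + 4^-1 * (t ^+ 2 * f1 t ^+ 2)).
pose H' t := a / 2 * t * f1 t ^+ 2.
have dH t : is_derive t (1 : R) H (H' t).
  have h1 := is_deriveX 2 (d0 t); have h2 := is_deriveX 2 (d1 t).
  have h3 := is_deriveM (is_derive_expr 1 t) h2.
  have h := is_deriveN (is_deriveD h1 (is_deriveM (is_derive_cst (4^-1 : R) t 1) h3)).
  rewrite !fctE in h; apply: (is_derive_eq h); rewrite /GRing.scale /= !expr1 /H' mulr0 addr0.
  have e2 : t ^+ 2 / 4 * f2 t = (a + 1) / 2 * f1 t - f0 t by rewrite rec; ring.
  transitivity (t * f0 t * f1 t - t / 2 * f1 t ^+ 2 + t * f1 t * (t ^+ 2 / 4 * f2 t)); first by field.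
  by rewrite e2; field.
have := @ge0_derive_le _ H H' 0 v v0 (fun t _ => dH t).
rewrite /H expr0n mul0r mulr0 addr0 lerN2 mulrA (mulrC 4^-1) => -> // t /andP[t0 _].
by rewrite /H' mulr_ge0 ?sqr_ge0// mulr_ge0// divr_ge0.
Qed.

Lemma is_derive_ebessel_sqr p u v : is_derive v (1 : R) (fun t => ebessel p (t ^+ 2 + u)) (- (v / 2) * ebessel p.+2 (v ^+ 2 + u)).
Proof.
have h1 : is_derive v (1 : R) (fun t => t ^+ 2 + u) (2 * v).
  by apply: (is_derive_eq (is_deriveD (is_derive_expr 1 v) (is_derive_cst u v 1))); rewrite expr1 addr0.
have h := @is_derive1_comp R (ebessel p) (fun t => t ^+ 2 + u) v _ _ (is_derive_ebessel p _) h1.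
by apply: (is_derive_eq h); field.
Qed.

Lemma ebessel_energy p v : 0 <= v ->
  ebessel p (v ^+ 2) ^+ 2 + v ^+ 2 / 4 * ebessel p.+2 (v ^+ 2) ^+ 2 <= ebessel p 0 ^+ 2.
Proof.
move=> v0.
have d q t : is_derive t (1 : R) (fun t => ebessel q (t ^+ 2)) (- (t / 2) * ebessel q.+2 (t ^+ 2)).
  by have := is_derive_ebessel_sqr q 0 t; under eq_fun do rewrite addr0; rewrite addr0.
have := @energy_le _ _ _ p%:R (ler0n _ _) (d p) (d p.+2) _ v v0.
rewrite expr0n => -> // t.
by rewrite natr1 ebessel_rec ?sqr_ge0.
Qed.

Lemma ebessel_bounded p : exists2 C : R, 0 <= C & forall y, 0 <= y -> `|ebessel p y| <= C.
Proof.
exists `|ebessel p 0| => // y y0.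
have := ebessel_energy p (sqrtr_ge0 y); rewrite sqr_sqrtr// => h.
rewrite -(ler_pXn2r (n := 2)) ?nnegrE// !real_normK ?num_real//; apply: le_trans h.
by rewrite lerDl mulr_ge0 ?sqr_ge0// divr_ge0.
Qed.

Let sqrt_decay_alg (a b c : R) : c / 4 * a <= b -> c * a <= 2 ^+ 2 * b.
Proof. by move=> h; rewrite -natrX; lra. Qed.

Let decay_alg (E1 E2 E3 C1 C2 C3 Y y c : R) : 0 <= c -> 0 < Y ->
  y * E3 <= 4 * (c * E2 + E1) -> E1 * Y <= C1 -> E2 * Y <= C2 -> E3 * Y <= C3 ->
  E3 * (1 + y) * Y <= C3 + 4 * (c * C2 + C1).
Proof.
move=> c0 Y0 h e1 e2 e3; rewrite mulrDr mulr1 mulrDl; apply: lerD => //.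
rewrite (mulrC E3); apply: (le_trans (ler_wpM2r (ltW Y0) h)).
by rewrite -mulrA ler_pM2l// mulrDl lerD// -mulrA ler_wpM2l.
Qed.

(** The derivative part of the energy bound: half a power of y is gained by raising p by 2. It
    serves index 3, where [ebessel_decay] gives boundedness only. *)
Lemma ebessel_sqrt_decay p : exists2 C : R, 0 <= C & forall v, 0 <= v -> v * `|ebessel p.+2 (v ^+ 2)| <= C.
Proof.
exists (2 * `|ebessel p 0|) => [|v v0]; first by rewrite mulr_ge0.
have h := ebessel_energy p v0.
rewrite -(ler_pXn2r (n := 2)) ?nnegrE ?mulr_ge0// !exprMn !real_normK ?num_real//.
have : v ^+ 2 / 4 * ebessel p.+2 (v ^+ 2) ^+ 2 <= ebessel p 0 ^+ 2.
  by apply: le_trans h; rewrite lerDr sqr_ge0.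
exact: sqrt_decay_alg.
Qed.

(** Solving the recurrence for y E_(p+4) gains a full power of 1 / y at the cost of raising p by 4,
    starting from the energy bound. The true rate of E_p is y^(- p / 4). *)
Lemma ebessel_decay p j : exists2 C : R, 0 <= C & forall y, 0 <= y ->
  `|ebessel (p + 4 * j)%N y| <= C / (1 + y) ^+ j.
Proof.
elim: j p => [|j IH] p.
  have [C C0 h] := ebessel_bounded p; exists C => // y y0.
  by rewrite muln0 addn0 expr0 divr1; exact: h.
have [C1 C10 h1] := IH p; have [C2 C20 h2] := IH p.+2; have [C3 C30 h3] := IH p.+4.
pose q := (p + 4 * j)%N.
exists (C3 + 4 * (q.+1%:R / 2 * C2 + C1)).
  by rewrite !(addr_ge0, mulr_ge0).
move=> y y0; have -> : (p + 4 * j.+1 = q.+4)%N by rewrite /q mulnS; lia.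
have y1 : 0 < 1 + y by rewrite ltr_pwDl.
have e3 := h3 y y0; have e2 := h2 y y0; have e1 := h1 y y0.
rewrite !addSn -/q in e3 e2 e1.
have Y0 : 0 < (1 + y) ^+ j by rewrite exprn_gt0.
rewrite exprS invfM mulrA -(ler_pM2r y1) mulrAC -[X in _ <= X / _]mulrA mulVf ?gt_eqF// mulr1.
rewrite ler_pdivlMr//.
have rec := ebessel_rec q y0.
rewrite ler_pdivlMr// in e1; rewrite ler_pdivlMr// in e2; rewrite ler_pdivlMr// in e3.
have : y * `|ebessel q.+4 y| <= 4 * (q.+1%:R / 2 * `|ebessel q.+2 y| + `|ebessel q y|).
  rewrite -[X in X * _ <= _](ger0_norm y0) -normrM.
  have alg (c a b d : R) : a = c / 2 * b - y / 4 * d -> y * d = 4 * (c / 2 * b - a) by move=> ->; field.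
  rewrite (alg _ _ _ _ rec).
  rewrite normrM ger0_norm// ler_pM2l// (le_trans (ler_normB _ _))// lerD2r normrM ger0_norm//.
move=> h; have c0 : 0 <= q.+1%:R / 2 :> R by rewrite divr_ge0.
exact: (decay_alg c0 Y0 h e1 e2 e3).
Qed.

End RealBessel.

(** * The Bessel kernel integrated along a line *)

Section Slices.
Context {R : realType}.
Implicit Types (x y t a b c u v : R) (p q k j N : nat).
Local Notation mu := (@lebesgue_measure R).
Local Notation ibl D f := (mu.-integrable D (EFin \o f)).

Lemma sqr_add_continuous v : continuous (fun u : R => v ^+ 2 + u ^+ 2).
Proof. by move=> u; apply: cvgD; [exact: cvg_cst|exact: exprn_continuous]. Qed.

Lemma ebessel_slice_continuous p v : continuous (fun u => ebessel p (v ^+ 2 + u ^+ 2)).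
Proof.
move=> u; apply: (@continuous_comp _ _ _ (fun u : R => v ^+ 2 + u ^+ 2) (ebessel p)).
  exact: sqr_add_continuous.
exact: ebessel_continuous.
Qed.

Lemma ebessel4_decay q : exists2 C : R, 0 <= C & forall v u, `|ebessel q.+4 (v ^+ 2 + u ^+ 2)| <= C * (1 + u ^+ 2)^-1.
Proof.
have [C C0 h] := @ebessel_decay R q 1%N; exists C => // v u.
have vu : 0 <= v ^+ 2 + u ^+ 2 by rewrite addr_ge0 ?sqr_ge0.
have := h _ vu; rewrite muln1 addn4 expr1 => /le_trans; apply; rewrite ler_wpM2l//.
rewrite lef_pV2 ?posrE ?ltr_pwDl ?sqr_ge0// lerD2l lerDr sqr_ge0//.
Qed.

Lemma ebessel_slice_integrable q v : ibl setT (fun u => ebessel q.+4 (v ^+ 2 + u ^+ 2)).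
Proof.
have [C C0 h] := ebessel4_decay q.
apply: (@integrable_dominated _ setT _ (fun u => C * (1 + u ^+ 2)^-1)) => //.
  exact: continuous_measurable_fun (@ebessel_slice_continuous _ _).
by apply: integrable_scale => //; exact: cauchy_integrable.
Qed.

Lemma integrable_linear2 (D : set (measurableTypeR R)) (f g : R -> R) a b : measurable D ->
  ibl D f -> ibl D g -> ibl D (fun u => a * f u + b * g u).
Proof. by move=> mD fi gi; apply: integrable_add => //; exact: integrable_scale. Qed.

Lemma Rintegral_linear2 (D : set (measurableTypeR R)) (f g : R -> R) a b : measurable D ->
  ibl D f -> ibl D g ->
  \int[mu]_(u in D) (a * f u + b * g u) = a * \int[mu]_(u in D) f u + b * \int[mu]_(u in D) g u.
Proof.
move=> mD fi gi; rewrite RintegralD//; [|exact: integrable_scale|exact: integrable_scale].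
by rewrite !RintegralZl.
Qed.

(* The index is at least [4] so that the integral converges absolutely. *)
Definition slice q v : R := (\int[mu]_u ebessel q.+4 (v ^+ 2 + u ^+ 2))%R.

Lemma is_derive_slice q v : is_derive v (1 : R) (slice q) (- (v / 2) * slice q.+2 v).
Proof.
have [C C0 h] := ebessel4_decay q.+2.
rewrite /slice -RintegralZl//; last exact: ebessel_slice_integrable.
set V := `|v| + 1; have V0 : 0 <= V by rewrite addr_ge0.
apply: (@is_derive_under_integral _ setT (fun x u => ebessel q.+4 (x ^+ 2 + u ^+ 2))
  (fun x u => - (x / 2) * ebessel q.+2.+4 (x ^+ 2 + u ^+ 2)) (fun u => V * (C * (1 + u ^+ 2)^-1))
  v (- V) V) => //.
- by rewrite -ltr_norml ltrDl.
- by move=> x _; exact: ebessel_slice_integrable.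
- by move=> x u _ _; exact: is_derive_ebessel_sqr.
- by do 2!apply: integrable_scale => //; exact: cauchy_integrable.
- move=> x u; rewrite -ltr_norml => xv _; rewrite normrM ler_pM ?h//.
  rewrite normrN normrM [X in _ * X]ger0_norm// ler_pdivrMr// (le_trans (ltW xv))// ler_peMr//.
  by rewrite ler1n.
Qed.

Lemma inv_bound_cvg0 (F : R -> R) C : (forall u, `|F u| <= C * `|u|^-1) ->
  F u @[u --> (+oo : set_system R)] --> 0.
Proof.
move=> h; apply/norm_cvg0P; apply: (@squeeze_cvgr _ _ _ _ (fun=> 0) (fun u => C * u^-1)).
- near=> u; have u0 : 0 <= u by near: u; apply: nbhs_pinfty_ge; exact: num_real.
  by rewrite normr_ge0 (le_trans (h u))// ger0_norm.
- exact: cvg_cst.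
- by rewrite -[X in _ --> X](mulr0 C); apply: cvgM; [exact: cvg_cst|exact: cvg_inv_pinfty].
Unshelve. all: by end_near. Qed.

(** In the recurrence of E_(q+4) the term u^2 E_(q+8) is integrated by parts through the primitive u
    E_(q+6); it returns slices of index q + 2 and lowers the coefficient (q + 5) / 2 to (q + 4) / 2,
    the one belonging to E_(q+3). *)
Lemma slice_rec q v : slice q v = (q%:R + 3 + 1) / 2 * slice q.+2 v - v ^+ 2 / 4 * slice q.+4 v.
Proof.
have i4 := ebessel_slice_integrable q v; have i6 := ebessel_slice_integrable q.+2 v.
have i8 := ebessel_slice_integrable q.+4 v.
have [C C0 h8] := @ebessel_decay R q 2%N; have [C' C0' h6] := ebessel4_decay q.+2.
have iu8 : ibl setT (fun u => u ^+ 2 * ebessel q.+4.+4 (v ^+ 2 + u ^+ 2)).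
  apply: (@integrable_dominated _ setT _ (fun u => C * (1 + u ^+ 2)^-1)) => //.
  - apply: continuous_measurable_fun => u; apply: cvgM; first exact: exprn_continuous.
    exact: ebessel_slice_continuous.
  - by apply: integrable_scale => //; exact: cauchy_integrable.
  - move=> u _; have vu : 0 <= v ^+ 2 + u ^+ 2 by rewrite addr_ge0 ?sqr_ge0.
    have := h8 _ vu; rewrite (_ : (q + 4 * 2 = q.+4.+4)%N); last by lia.
    have Y1 : 1 + u ^+ 2 <= 1 + (v ^+ 2 + u ^+ 2) by rewrite lerD2l lerDr sqr_ge0.
    have Y0 : 0 < 1 + u ^+ 2 by rewrite ltr_pwDl ?sqr_ge0.
    move=> h; rewrite normrM ger0_norm ?sqr_ge0//.
    rewrite ler_pdivlMr ?exprn_gt0 ?(lt_le_trans Y0)// in h.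
    rewrite ler_pdivlMr//; apply: le_trans h; rewrite mulrAC mulrC ler_wpM2l//.
    by rewrite expr2 ler_pM ?sqr_ge0 ?(ltW Y0)// (le_trans _ Y1)// lerDr.
pose F u := u * ebessel q.+2.+4 (v ^+ 2 + u ^+ 2).
pose f u := 1 * ebessel q.+2.+4 (v ^+ 2 + u ^+ 2) + (- 2^-1) * (u ^+ 2 * ebessel q.+4.+4 (v ^+ 2 + u ^+ 2)).
have iF : ibl setT f := integrable_linear2 1 (- 2^-1) measurableT i6 iu8.
have limF u : `|F u| <= C' * `|u|^-1.
  rewrite /F normrM; have [->|u0] := eqVneq u 0; first by rewrite normr0 invr0 mul0r mulr0.
  have un : 0 < `|u| by rewrite normr_gt0.
  rewrite ler_pdivlMr// mulrAC -expr2 real_normK ?num_real// mulrC.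
  apply: (le_trans (ler_wpM2r (sqr_ge0 _) (h6 v u))); rewrite -mulrA -[leRHS]mulr1 ler_wpM2l//.
  by rewrite mulrC ler_pdivrMr ?mul1r ?lerDr// ltr_pwDl ?sqr_ge0.
have I0 : \int[mu]_u f u = 0 - 0.
  apply: (@FTC2_line _ F f 0 0) => //.
  - move=> u; have h1 := is_derive_ebessel_sqr q.+2.+4 (v ^+ 2) u.
    have h := is_deriveM (is_derive_id u 1) h1.
    move: h; rewrite !fctE /F; under eq_fun do rewrite addrC.
    move=> h; apply: (is_derive_eq h); rewrite /GRing.scale /= /f [u ^+ 2 + _]addrC.
    by move: (ebessel _ _) (ebessel _ _) => a b; field.
  - move=> u; apply: cvgD; apply: cvgM; [exact: cvg_cst|exact: ebessel_slice_continuous|exact: cvg_cst|].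
    apply: cvgM; first exact: exprn_continuous.
    exact: ebessel_slice_continuous.
  - apply/cvgNy_compNP; apply: inv_bound_cvg0 => u.
    by rewrite -[`|u|]normrN; exact: limF.
  - exact: inv_bound_cvg0 limF.
move: I0; rewrite subrr /f (Rintegral_linear2 _ _ measurableT i6 iu8) -/(slice q.+2 v) mul1r => I0.
have E u : ebessel q.+4 (v ^+ 2 + u ^+ 2) = 1 * (q.+4.+1%:R / 2 * ebessel q.+2.+4 (v ^+ 2 + u ^+ 2) +
   (- (v ^+ 2 / 4)) * ebessel q.+4.+4 (v ^+ 2 + u ^+ 2)) + (- 4^-1) * (u ^+ 2 * ebessel q.+4.+4 (v ^+ 2 + u ^+ 2)).
  have vu : 0 <= v ^+ 2 + u ^+ 2 by rewrite addr_ge0 ?sqr_ge0.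
  have := @ebessel_rec R q.+4 _ vu.
  by move: (ebessel q.+4.+2 _) (ebessel q.+4.+4 _) => a b ->; field.
have i68 : ibl setT (fun u => q.+4.+1%:R / 2 * ebessel q.+2.+4 (v ^+ 2 + u ^+ 2) +
   (- (v ^+ 2 / 4)) * ebessel q.+4.+4 (v ^+ 2 + u ^+ 2)).
  exact: (integrable_linear2 _ _ measurableT i6 i8).
have -> : slice q v = q.+4.+1%:R / 2 * slice q.+2 v + (- (v ^+ 2 / 4)) * slice q.+4 v +
    (- 4^-1) * \int[mu]_u (u ^+ 2 * ebessel q.+4.+4 (v ^+ 2 + u ^+ 2)).
  rewrite -(Rintegral_linear2 _ _ measurableT i6 i8) -[X in X + _]mul1r -(Rintegral_linear2 _ _ measurableT i68 iu8).
  by apply: eq_Rintegral => u _; exact: E.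
move: I0; move: (slice _ _) (slice _ _) (Rintegral _ _ _) => a b c h.
have -> : q.+4.+1%:R = q%:R + 5 :> R by rewrite -natrD addnC.
have -> : c = 2 * b - 2 * (b + - 2^-1 * c) by field.
by rewrite h; field.
Qed.

(** Both sides solve the Bessel system with a = q + 3 and agree at 0, so their difference has zero
    energy at 0 and hence at every v >= 0. Integrating out u lowers the index from q + 4 to q +
    3. *)
Lemma slice_ebessel q v : 0 <= v -> slice q v = slice q 0 / ebessel q.+3 0 * ebessel q.+3 (v ^+ 2).
Proof.
move=> v0; set c := slice q 0 / _.
have e0 : ebessel q.+3 (0 : R) != 0 by rewrite (@ebessel0 R q.+3) invr_eq0 gt_eqF// gamma_half_gt0.
have dE p t : is_derive t (1 : R) (fun t => c * ebessel p (t ^+ 2)) (c * (- (t / 2) * ebessel p.+2 (t ^+ 2))).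
  have h : is_derive t (1 : R) (fun t => ebessel p (t ^+ 2)) (- (t / 2) * ebessel p.+2 (t ^+ 2)).
    by have := is_derive_ebessel_sqr p 0 t; under eq_fun do rewrite addr0; rewrite addr0.
  apply: (is_derive_eq (is_deriveM (is_derive_cst c t 1) h)).
  by rewrite /GRing.scale /= mulr0 addr0.
have d p t : is_derive t (1 : R) (fun t => slice p t - c * ebessel p.+3 (t ^+ 2))
    (- (t / 2) * (slice p.+2 t - c * ebessel p.+3.+2 (t ^+ 2))).
  apply: (is_derive_eq (is_deriveB (is_derive_slice p t) (dE p.+3 t))).
  by move: (slice _ _) (ebessel _ _) => a b; ring.
have a0 : 0 <= q%:R + 3 :> R by rewrite addr_ge0.
have F0 : slice q 0 - c * ebessel q.+3 (0 ^+ 2) = 0 by rewrite expr0n /= /c divfK// subrr.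
have h := energy_le a0 (d q) (d q.+2) _ v0; rewrite F0 expr0n in h.
have {h} : (slice q v - c * ebessel q.+3 (v ^+ 2)) ^+ 2 <= 0.
  apply: (le_trans _ (h _)) => [|t]; first by rewrite lerDl mulr_ge0 ?sqr_ge0// divr_ge0 ?sqr_ge0.
  rewrite slice_rec; have := @ebessel_rec R q.+3 _ (sqr_ge0 t).
  have -> : q.+3.+1%:R = q%:R + 3 + 1 :> R by rewrite -natr1 -(addn3 q) natrD.
  have alg (a b a' b' e w z : R) : e = w * a' - z * b' -> w * a - z * b - c * e = w * (a - c * a') - z * (b - c * b').
    by move=> ->; ring.
  exact: alg.
by rewrite le_eqVlt ltNge sqr_ge0 orbF sqrf_eq0 subr_eq0 => /eqP.
Qed.

End Slices.

Section RealFubini.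
Context {R : realType}.
Local Notation mu := (@lebesgue_measure R).
Local Notation ibl D f := (mu.-integrable D (EFin \o f)).

Lemma Rintegral_swap (f : R -> R -> R) (g h : R -> R) :
  measurable_fun [set: (measurableTypeR R * measurableTypeR R)] (fun z => f z.1 z.2) ->
  ibl setT g -> ibl setT h -> (forall x y, `|f x y| <= g x * h y) ->
  \int[mu]_x \int[mu]_y f x y = \int[mu]_y \int[mu]_x f x y.
Proof.
move=> mf gi hi fgh.
have m1 x : measurable_fun [set: measurableTypeR R] (fun y => f x y).
  by have := measurableT_comp mf (pair1_measurable x).
have m2 y : measurable_fun [set: measurableTypeR R] (fun x => f x y).
  by have := measurableT_comp mf (pair2_measurable y).
have i1 x : ibl setT (fun y => f x y).
  by apply: (@integrable_dominated _ setT _ (fun y => g x * h y)) => //; exact: integrable_scale.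
have i2 y : ibl setT (fun x => f x y).
  apply: (@integrable_dominated _ setT _ (fun x => h y * g x)) => //; first exact: integrable_scale.
  by move=> x _; rewrite mulrC.
pose F (z : measurableTypeR R * measurableTypeR R) : \bar R := (f z.1 z.2)%:E.
have mF : measurable_fun setT F by exact/measurable_EFinP.
have e1 x : (\int[mu]_y F (x, y) = (\int[mu]_y f x y)%R%:E)%E.
  by rewrite /F /Rintegral fineK//; apply: integrable_fin_num => //; exact: i1.
have e2 y : (\int[mu]_x F (x, y) = (\int[mu]_x f x y)%R%:E)%E.
  by rewrite /F /Rintegral fineK//; apply: integrable_fin_num => //; exact: i2.
have iF : (mu \x mu)%E.-integrable setT F.
  apply/(integrable12ltyP _ _ mF).2.
  pose H := \int[mu]_y h y.
  have gH x : (\int[mu]_y `|F (x, y)| <= (H * g x)%:E)%E.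
    have -> : (H * g x)%:E = (\int[mu]_y (g x * h y)%:E)%E.
      have <- : \int[mu]_y (g x * h y) = H * g x by rewrite RintegralZl// mulrC.
      rewrite /Rintegral fineK//.
      by apply: integrable_fin_num => //; exact: integrable_scale.
    apply: ge0_le_integral => //.
    - have mx : measurable_fun [set: measurableTypeR R] (EFin \o f x) by have /integrableP[] := i1 x.
      by apply: (measurableT_comp (f := abse)) => //; exact: mx.
    - by have /integrableP[] := integrable_scale (g x) measurableT hi.
    - by move=> y _; rewrite /F lee_fin.
  have iH := integrable_scale H measurableT gi.
  apply: (le_lt_trans _ (integrableP _ _ _ iH).2).
  apply: ge0_le_integral => //.
  - by move=> x _; exact: integral_ge0.
  - apply: (measurable_fun_fubini_tonelli_F (abse \o F)) => //; first exact: measurableT_comp.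
    by move=> z; exact: abse_ge0.
  - have mH : measurable_fun [set: measurableTypeR R] (EFin \o (fun x => H * g x)) by have /integrableP[] := iH.
    by apply: (measurableT_comp (f := abse)) => //; exact: mH.
  - by move=> x _; rewrite (le_trans (gH x))// lee_fin ler_norm.
have := Fubini iF.
under eq_integral do rewrite e1.
under [X in _ = X -> _]eq_integral do rewrite e2.
by rewrite /Rintegral => ->.
Qed.

End RealFubini.

(** * Bessel transforms of an exponentially decaying weight *)

Section WeightedBessel.
Context {R : realType}.
Implicit Types (x y t s u v : R) (p q r k j : nat).
Local Notation mu := (@lebesgue_measure R).
Local Notation ibl D f := (mu.-integrable D (EFin \o f)).
Variables (W : R -> R) (K a : R).
Hypotheses (mW : measurable_fun [set: measurableTypeR R] W) (a0 : 0 < a) (K0 : 0 <= K)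
  (W0 : forall s, s <= 0 -> W s = 0) (Wb : forall s, `|W s| <= K * expR (- (a * `|s|))).

Lemma weight_moment_measurable r : measurable_fun [set: measurableTypeR R] (fun s => W s * s ^+ r).
Proof. by apply: measurable_funM => //; apply: continuous_measurable_fun; exact: exprn_continuous. Qed.

Lemma weight_moment_integrable r : ibl setT (fun s => W s * s ^+ r).
Proof.
have a2 : 0 < a / 2 by rewrite divr_gt0.
have [C C0 h] := expr_le_expR r a2.
apply: (@integrable_le_expR _ _ _ (a / 2) (K * C)) => //; first exact: weight_moment_measurable.
move=> s _; rewrite normrM normrX.
apply: (le_trans (ler_pM (normr_ge0 _) _ (Wb s) (h s))); first by rewrite exprn_ge0.
rewrite mulrACA -expRD ler_wpM2l ?mulr_ge0 ?(ltW C0)// ler_expR; lra.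
Qed.

Lemma weight_moment_abs_integrable r : ibl setT (fun s => `|W s * s ^+ r|).
Proof. exact: integrable_norm (weight_moment_integrable r). Qed.

(** The exponent [r] is independent of [p] because the three-term recurrence also produces terms in
    which [p] alone is raised. *)
Definition weighted p r y : R := (\int[mu]_s (W s * s ^+ r * ebessel p (s ^+ 2 * y)))%R.

Lemma ebessel_scaled_continuous p y : continuous (fun s : R => ebessel p (s ^+ 2 * y)).
Proof.
move=> s; apply: (@continuous_comp _ _ _ (fun s : R => s ^+ 2 * y) (ebessel p)).
  by apply: cvgM; [exact: exprn_continuous|exact: cvg_cst].
exact: ebessel_continuous.
Qed.

Lemma weighted_integrable p r y : 0 <= y -> ibl setT (fun s => W s * s ^+ r * ebessel p (s ^+ 2 * y)).
Proof.
move=> y0; have [C C0 h] := @ebessel_bounded R p.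
apply: (@integrable_dominated _ setT _ (fun s => C * `|W s * s ^+ r|)) => //.
- apply: measurable_funM; first exact: weight_moment_measurable.
  exact: continuous_measurable_fun (@ebessel_scaled_continuous p y).
- by apply: integrable_scale => //; exact: weight_moment_abs_integrable.
- by move=> s _; rewrite normrM mulrC ler_wpM2r// h// mulr_ge0// sqr_ge0.
Qed.

(** Separates s from y at the price of a factor s^2, which is why two powers of s are reserved in
    [weighted_decay]. *)
Lemma weight_tail_le s y : 0 <= y -> s ^+ 2 / (1 + s ^+ 2 * y) <= (1 + s ^+ 2) / (1 + y).
Proof.
move=> y0; have s0 := sqr_ge0 s; have sy : 0 <= s ^+ 2 * y by rewrite mulr_ge0.
rewrite ler_pdivrMr ?ltr_pwDl// mulrAC ler_pdivlMr ?ltr_pwDl//.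
rewrite !mulrDr !mulrDl !mulr1 !mul1r.
have : 0 <= s ^+ 2 * (s ^+ 2 * y) by rewrite mulr_ge0.
move: (s ^+ 2) s0 sy => S S0 sy hh; lra.
Qed.

Lemma weighted_decay q r : exists2 C : R, 0 <= C & forall y, 0 <= y ->
  `|weighted q.+4 r.+2 y| <= C * (1 + y)^-1.
Proof.
have [C C0 h] := @ebessel_decay R q 1.
have ia := integrable_add measurableT (weight_moment_abs_integrable r) (weight_moment_abs_integrable r.+2).
exists (C * \int[mu]_s (`|W s * s ^+ r| + `|W s * s ^+ r.+2|)) => [|y y0].
  by rewrite mulr_ge0// Rintegral_ge0// => s _; rewrite addr_ge0.
have iw := weighted_integrable q.+4 r.+2 y0.
rewrite /weighted (le_trans (le_normr_Rintegral _ iw))//.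
rewrite mulrAC -RintegralZl//; apply: le_Rintegral => //.
- exact: integrable_norm iw.
- exact: integrable_scale.
- move=> s _; have sy : 0 <= s ^+ 2 * y by rewrite mulr_ge0// sqr_ge0.
  have := h _ sy; rewrite muln1 addn4 expr1 => hs.
  rewrite normrM; apply: (le_trans (ler_wpM2l (normr_ge0 _) hs)).
  have -> : `|W s * s ^+ r.+2| = `|W s * s ^+ r| * s ^+ 2.
    by rewrite -addn2 exprD mulrA normrM [X in _ * X]ger0_norm// sqr_ge0.
  have := ler_wpM2l (mulr_ge0 C0 (normr_ge0 (W s * s ^+ r))) (weight_tail_le s y0).
  move: (`|W s * s ^+ r|) (1 + s ^+ 2 * y) => M X hh.
  have e1 : M * s ^+ 2 * (C / X) = C * M * (s ^+ 2 / X) by ring.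
  rewrite e1; apply: (le_trans hh); rewrite le_eqVlt; apply/orP; left; apply/eqP.
  by ring.
Qed.

Lemma is_derive_weighted p r v u : 0 <= u -> is_derive v (1 : R)
  (fun t => weighted p r (t ^+ 2 + u)) (- (v / 2) * weighted p.+2 r.+2 (v ^+ 2 + u)).
Proof.
move=> u0; have pos x : 0 <= x ^+ 2 + u by rewrite addr_ge0 ?sqr_ge0.
have [C C0 h] := @ebessel_bounded R p.+2.
set V := `|v| + 1; have V0 : 0 <= V by rewrite addr_ge0.
have -> : - (v / 2) * weighted p.+2 r.+2 (v ^+ 2 + u) =
    \int[mu]_s (- (v / 2) * (W s * s ^+ r.+2 * ebessel p.+2 (s ^+ 2 * (v ^+ 2 + u)))).
  by rewrite RintegralZl//; exact: weighted_integrable.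
apply: (@is_derive_under_integral _ setT (fun x s => W s * s ^+ r * ebessel p (s ^+ 2 * (x ^+ 2 + u)))
  (fun x s => - (x / 2) * (W s * s ^+ r.+2 * ebessel p.+2 (s ^+ 2 * (x ^+ 2 + u))))
  (fun s => V * (C * `|W s * s ^+ r.+2|)) v (- V) V) => //.
- by rewrite -ltr_norml ltrDl.
- by move=> x _; exact: weighted_integrable.
- move=> x s _ _.
  have h1 : is_derive x (1 : R) (fun t => s ^+ 2 * (t ^+ 2 + u)) (s ^+ 2 * (2 * x)).
    apply: (is_derive_eq (is_deriveM (is_derive_cst (s ^+ 2) x 1) (is_deriveD (is_derive_expr 1 x) (is_derive_cst u x 1)))).
    by rewrite /GRing.scale /= mulr0 !addr0 expr1.
  have h2 := @is_derive1_comp R (ebessel p) (fun t => s ^+ 2 * (t ^+ 2 + u)) x _ _ (is_derive_ebessel p _) h1.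
  apply: (is_derive_eq (is_deriveM (is_derive_cst (W s * s ^+ r) x 1) h2)).
  rewrite /GRing.scale /= mulr0 addr0 -[r.+2]addn2 exprD.
  by move: (ebessel _ _) (W s) => e w; field.
- by do 2!apply: integrable_scale => //; exact: weight_moment_abs_integrable.
- move=> x s; rewrite -ltr_norml => xv _; rewrite normrM ler_pM//.
    rewrite normrN normrM [X in _ * X]ger0_norm// ler_pdivrMr// (le_trans (ltW xv))// ler_peMr//.
    by rewrite ler1n.
  by rewrite normrM mulrC ler_wpM2r// h// mulr_ge0// sqr_ge0.
Qed.

(** Fubini brings the u-integral inside; for fixed s > 0 the scaling u -> s u turns it into the
    slice at s v and absorbs one power of s, and [slice_ebessel] lowers the index. *)
Lemma weighted_descent q r v : 0 <= v ->
  \int[mu]_u weighted q.+4 r.+3 (v ^+ 2 + u ^+ 2) =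
  (slice q 0 / ebessel q.+3 0) * weighted q.+3 r.+2 (v ^+ 2).
Proof.
move=> v0; have [C C0 h] := @ebessel_decay R q 1.
pose g s := C * (`|W s * s ^+ r.+1| + `|W s * s ^+ r.+3|).
have gi : ibl setT g.
  by apply: integrable_scale => //; apply: integrable_add => //; exact: weight_moment_abs_integrable.
pose f s u := W s * s ^+ r.+3 * ebessel q.+4 (s ^+ 2 * (v ^+ 2 + u ^+ 2)).
have mf : measurable_fun [set: (measurableTypeR R * measurableTypeR R)] (fun z => f z.1 z.2).
  apply: measurable_funM.
    exact: measurableT_comp (weight_moment_measurable r.+3) measurable_fst.
  have mE : measurable_fun [set: measurableTypeR R] (ebessel q.+4).
    exact: continuous_measurable_fun (@ebessel_continuous _ _).
  apply: (measurableT_comp mE); apply: measurable_funM.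
    by apply: measurable_funX; exact: measurable_fst.
  by apply: measurable_funD; [exact: measurable_cst|apply: measurable_funX; exact: measurable_snd].
have fgh s u : `|f s u| <= g s * (1 + u ^+ 2)^-1.
  have pos : 0 <= s ^+ 2 * (v ^+ 2 + u ^+ 2) by rewrite mulr_ge0 ?addr_ge0 ?sqr_ge0.
  have := h _ pos; rewrite muln1 addn4 expr1 => hs.
  rewrite /f normrM; apply: (le_trans (ler_wpM2l (normr_ge0 _) hs)).
  have e1 : `|W s * s ^+ r.+3| = `|W s * s ^+ r.+1| * s ^+ 2.
    by rewrite -addn2 exprD mulrA normrM [X in _ * X]ger0_norm// sqr_ge0.
  have t1 := weight_tail_le s (sqr_ge0 u).
  have t2 : s ^+ 2 / (1 + s ^+ 2 * (v ^+ 2 + u ^+ 2)) <= s ^+ 2 / (1 + s ^+ 2 * u ^+ 2).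
    have su : 0 <= s ^+ 2 * u ^+ 2 by rewrite mulr_ge0 ?sqr_ge0.
    rewrite ler_wpM2l ?sqr_ge0// lef_pV2 ?posrE ?ltr_pwDl//.
    by rewrite lerD2l ler_wpM2l ?sqr_ge0// lerDr sqr_ge0.
  have := ler_wpM2l (mulr_ge0 C0 (normr_ge0 (W s * s ^+ r.+1))) (le_trans t2 t1).
  rewrite /g e1; move: (`|W s * s ^+ r.+1|) (1 + s ^+ 2 * _) => M X hh.
  have -> : M * s ^+ 2 * (C / X) = C * M * (s ^+ 2 / X) by ring.
  apply: (le_trans hh); rewrite le_eqVlt; apply/orP; left; apply/eqP; ring.
have := Rintegral_swap mf gi cauchy_integrable fgh.
rewrite /weighted /f => <-.
rewrite -RintegralZl//; last by apply: weighted_integrable; exact: sqr_ge0.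
apply: eq_Rintegral => s _.
have [s0|s0] := leP s 0.
  rewrite W0// !mul0r mulr0; under eq_Rintegral do rewrite mul0r.
  by rewrite /Rintegral integral0.
pose F u := W s * s ^+ r.+2 * ebessel q.+4 ((s * v) ^+ 2 + u ^+ 2).
have E u : W s * s ^+ r.+3 * ebessel q.+4 (s ^+ 2 * (v ^+ 2 + u ^+ 2)) = s * F (s * u).
  by rewrite /F !exprMn -mulrDr exprS; move: (ebessel _ _) => e; ring.
have cF : continuous F.
  by move=> u; apply: cvgM; [exact: cvg_cst|exact: ebessel_slice_continuous].
under eq_Rintegral do rewrite E.
rewrite (Rintegral_scale s0 cF) /F RintegralZl//; last exact: ebessel_slice_integrable.
rewrite -/(slice q (s * v)) slice_ebessel; last by rewrite mulr_ge0// ltW.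
rewrite exprMn; exact: mulrCA.
Qed.

End WeightedBessel.

Opaque weighted.

(** * The Gaussian weight and the constant of the descent *)

Section HalfWeight.
Context {R : realType}.
Implicit Types (x y t s u v : R) (p q r k j : nat) (w : R -> R).
Local Notation mu := (@lebesgue_measure R).
Local Notation ibl D f := (mu.-integrable D (EFin \o f)).
Local Notation half_line := (`]0%R, +oo[%classic : set (measurableTypeR R)).

Definition half_weight w s : R := if 0 < s then w s else 0.

Lemma half_weight_restrict w : half_weight w = w \_ half_line.
Proof. by apply/funext => s; rewrite patchE mem_setE in_itv/= andbT. Qed.

Lemma half_weight_measurable w : (forall s, 0 < s -> {for s, continuous w}) ->
  measurable_fun [set: measurableTypeR R] (half_weight w).
Proof.
move=> cw; rewrite half_weight_restrict.
apply/(measurable_restrictT _ _).1; first exact: measurable_itv.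
apply: open_continuous_measurable_fun; first exact: interval_open.
by move=> s; rewrite inE/= in_itv/= andbT; exact: cw.
Qed.

Lemma half_weight_le0 w s : s <= 0 -> half_weight w s = 0.
Proof. by rewrite /half_weight leNgt => /negbTE ->. Qed.

Lemma half_weight_gt0 w s : 0 < s -> half_weight w s = w s.
Proof. by rewrite /half_weight => ->. Qed.

Lemma half_weight_bound w K a : 0 <= K -> (forall s, 0 < s -> `|w s| <= K * expR (- (a * `|s|))) ->
  forall s, `|half_weight w s| <= K * expR (- (a * `|s|)).
Proof.
move=> K0 h s; rewrite /half_weight; case: ifP => [/h//|_].
by rewrite normr0 mulr_ge0// expR_ge0.
Qed.

Lemma Rintegral_half_weight w (G : R -> R) :
  \int[mu]_s (half_weight w s * G s) = \int[mu]_(s in half_line) (w s * G s).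
Proof.
rewrite [RHS]Rintegral_mkcond half_weight_restrict; apply: eq_Rintegral => s _.
by rewrite !patchE; case: ifP => // _; rewrite mul0r.
Qed.

(* For the weight [e^(- s^2)] all kernels are equal to [e^(- y / 4) / 2], which
   determines the constant of the descent. *)
Let gaussW := half_weight (fun s => expR (- s ^+ 2)).

Let gaussW_measurable : measurable_fun [set: measurableTypeR R] gaussW.
Proof.
by apply: half_weight_measurable => s _; exact: (@continuous_gauss_fun R).
Qed.

Let gaussW_bound s : `|gaussW s| <= expR 1 * expR (- (1 * `|s|)).
Proof.
apply: half_weight_bound => [|{}s _]; first exact: expR_ge0.
rewrite ger0_norm ?expR_ge0// -expRD ler_expR mul1r.
have := sqr_ge0 (`|s| - 1 / 2); rewrite sqrrB real_normK ?num_real//.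
move: (s ^+ 2) (`|s|) => S A; lra.
Qed.

Local Notation gaussA := (weighted gaussW).
Let gw0 s : s <= 0 -> gaussW s = 0. Proof. exact: half_weight_le0. Qed.
Let K0 : 0 <= expR 1 :> R. Proof. exact: expR_ge0. Qed.

(** The function s^(p+1) e^(-s^2) E_(p+2)(s^2 y) vanishes at both ends and, by the three-term
    recurrence, has derivative 2 e^(-s^2) (s^p E_p - s^(p+2) E_(p+2)). *)
Let gauss_ibp p y : 0 <= y -> gaussA p.+2 p.+2 y = gaussA p p y.
Proof.
move=> y0.
have cE q : continuous (fun s : R => s ^+ q * expR (- s ^+ 2)) := @continuous_expr_gauss R q.
have iw q := weighted_integrable gaussW_measurable (ltr01 : 0 < (1 : R)) K0 gaussW_bound q.
pose F s := (s ^+ p.+1 * expR (- s ^+ 2)) * ebessel p.+2 (s ^+ 2 * y).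
pose f s := (-2) * (expR (- s ^+ 2) * (s ^+ p.+2 * ebessel p.+2 (s ^+ 2 * y))) +
   2 * (expR (- s ^+ 2) * (s ^+ p * ebessel p (s ^+ 2 * y))).
have mh : measurable half_line by exact: measurable_itv.
have ih q : ibl half_line (fun s => expR (- s ^+ 2) * (s ^+ q * ebessel q (s ^+ 2 * y))).
  have := integrable_subset measurableT mh (@subsetT _ _) (iw q q y y0).
  apply: eq_integrable => // s; rewrite inE/= in_itv/= andbT => s0.
  by rewrite /gaussW half_weight_gt0// mulrA.
have : \int[mu]_(s in half_line) f s = 0 - 0.
  apply: (@FTC2_half_line _ F f).
  - move=> s s0.
    have h1 : is_derive s (1 : R) (fun t => t ^+ 2 * y) (2 * s * y).
      apply: (is_derive_eq (is_deriveM (is_derive_expr 1 s) (is_derive_cst y s 1))).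
      by rewrite /GRing.scale /= mulr0 add0r expr1 mulrC.
    have h2 := @is_derive1_comp R (ebessel p.+2) (fun t => t ^+ 2 * y) s _ _ (is_derive_ebessel p.+2 _) h1.
    apply: (is_derive_eq (is_deriveM (is_deriveM (is_derive_expr p s) (is_derive_gauss s)) h2)).
    have := @ebessel_rec R p (s ^+ 2 * y); rewrite mulr_ge0 ?sqr_ge0// => /(_ isT).
    rewrite !fctE /GRing.scale /= /f !exprS expr0; move: (ebessel _ _) (ebessel _ _) (ebessel _ _) (expR _) => E2 E0 E4 e ->.
    by field.
  - move=> s s0; apply: cvgD; (apply: cvgM; first exact: cvg_cst); apply: cvgM;
      try (exact: continuous_gauss_fun); apply: cvgM; try exact: exprn_continuous;
      exact: ebessel_scaled_continuous.
  - by apply: integrable_add => //; exact: integrable_scale.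
  - have F00 : F 0 = 0 by rewrite /F exprS !mul0r.
    rewrite -[X in _ --> X]F00; apply: cvg_at_right_filter.
    by apply: cvgM; [exact: cE|exact: ebessel_scaled_continuous].
  - have [C C0 h] := @ebessel_bounded R p.+2.
    apply/norm_cvg0P; apply: (@squeeze_cvgr _ _ _ _ (fun=> 0) (fun s => C * `|s ^+ p.+1 * expR (- s ^+ 2)|)).
    + apply: nearW => s; by rewrite normr_ge0 /F normrM mulrC ler_wpM2r// h// mulr_ge0// sqr_ge0.
    + exact: cvg_cst.
    + rewrite -[X in _ --> X](mulr0 C); apply: cvgM; first exact: cvg_cst.
      by apply/norm_cvg0P; exact: expr_gauss_cvg0.
rewrite subrr /f (Rintegral_linear2 _ _ mh (ih p.+2) (ih p)).
have wE q : gaussA q q y = \int[mu]_(s in half_line) (expR (- s ^+ 2) * (s ^+ q * ebessel q (s ^+ 2 * y))).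
  by rewrite -Rintegral_half_weight; apply: eq_Rintegral => s _; rewrite mulrA.
have alg (A B I2 I0 : R) : A = I2 -> B = I0 -> -2 * I2 + 2 * I0 = 0 -> A = B by move=> -> -> h; lra.
exact: (alg _ _ _ _ (wE p.+2) (wE p)).
Qed.

Let gaussA0 p : gaussA p p 0 = 1 / 2.
Proof.
Transparent weighted.
rewrite /weighted; under eq_Rintegral do rewrite mulr0 ebessel0 -mulrA.
rewrite Rintegral_half_weight.
have E (s : R) : expR (- s ^+ 2) * (s ^+ p * (gamma_half p)^-1) = (gamma_half p)^-1 * (s ^+ p * expR (- s ^+ 2)) by ring.
under eq_Rintegral do rewrite E.
rewrite RintegralZl//; last first.
  apply: integrable_subset measurableT _ _ (expr_gauss_integrable p) => //.
rewrite -/(gauss_moment p) /gamma_half Gamma_half.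
by have := @gauss_moment_gt0 R p; move: (gauss_moment p) => G G0; field; rewrite gt_eqF.
Qed.

(** With [gauss_ibp] the derivative formula closes up into the linear equation A' = - (t / 2) A. *)
Let gaussA_value p v : gaussA p p (v ^+ 2) = 1 / 2 * expR (- (v ^+ 2 / 4)).
Proof.
have dA t : is_derive t (1 : R) (fun t => gaussA p p (t ^+ 2)) (- (t / 2) * gaussA p p (t ^+ 2)).
  have := @is_derive_weighted _ _ _ _ gaussW_measurable ltr01 K0 gaussW_bound p p t 0 (lexx _).
  by under eq_fun do rewrite addr0; rewrite addr0 gauss_ibp// sqr_ge0.
pose G t := gaussA p p (t ^+ 2) * expR (t ^+ 2 / 4).
have dG t : is_derive t (1 : R) G 0.
  have h1 : is_derive t (1 : R) (fun t => t ^+ 2 / 4) (t / 2).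
    apply: (is_derive_eq (is_deriveM (is_derive_expr 1 t) (is_derive_cst (4^-1 : R) t 1))).
    by rewrite /GRing.scale /= mulr0 add0r expr1; field.
  have h2 := @is_derive1_comp R expR (fun t => t ^+ 2 / 4) t _ _ (is_derive_expR _) h1.
  apply: (is_derive_eq (is_deriveM (dA t) h2)); rewrite !fctE /GRing.scale /=.
  by move: (weighted _ _ _ _) (expR _) => A e; ring.
have := is_derive_0_is_cst v 0 dG; rewrite /G expr0n /= mul0r expR0 mulr1 gaussA0 => h.
by rewrite expRN -h mulfK// gt_eqF// expR_gt0.
Qed.

(** For the Gaussian weight the descent at v = 0 says that the integral of e^(- u^2 / 4) / 2, which
    is sqrt pi, equals the constant times 1 / 2. *)
Lemma slice0_value q : slice q 0 / ebessel q.+3 0 = 2 * Num.sqrt pi :> R.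
Proof.
have := weighted_descent gaussW_measurable ltr01 K0 gw0 gaussW_bound q q.+1 (lexx 0).
rewrite expr0n /= gaussA0.
under eq_Rintegral do rewrite add0r gaussA_value.
have E u : 1 / 2 * expR (- (u ^+ 2 / 4)) = 2^-1 * gauss_fun (2^-1 * u) :> R.
  by rewrite mul1r /gauss_fun; congr (_ * expR _); field.
under eq_Rintegral do rewrite E.
have h2 : 0 < 2^-1 :> R by rewrite invr_gt0.
rewrite (Rintegral_scale h2 (@continuous_gauss_fun R)) /Rintegral integralT_gauss /=.
move: (slice q 0 / _) => c; lra.
Qed.

End HalfWeight.

(** * The weight (s / sinh s)^n *)

Section SinhWeight.
Context {R : realType}.
Implicit Types (x y t s u v w : R) (p q r k j : nat).
Local Notation mu := (@lebesgue_measure R).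
Local Notation ibl D f := (mu.-integrable D (EFin \o f)).
Local Notation half_line := (`]0%R, +oo[%classic : set (measurableTypeR R)).
Variable n : nat.
Hypothesis n0 : (0 < n)%N.

Definition sinh_weight : R -> R := half_weight (fun s => (s / sinh s) ^+ n).

Lemma sinh_gt0 s : 0 < s -> 0 < sinh s.
Proof. by move=> s0; rewrite (lt_le_trans s0)// sinh_ge_id// ltW. Qed.

Lemma sinh_weight_measurable : measurable_fun [set: measurableTypeR R] sinh_weight.
Proof.
apply: half_weight_measurable => s s0.
have h : {for s, continuous (fun s : R => s / sinh s)}.
  apply: cvgM; first exact: cvg_id.
  apply: cvgV; first by rewrite gt_eqF// sinh_gt0.
  exact: (is_derive_continuous_at (is_derive_sinh s)).
exact: (@continuous_comp _ _ _ (fun s : R => s / sinh s) (fun z => z ^+ n) s h (@exprn_continuous _ n _)).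
Qed.

(** Half of the decay of 1 / sinh s absorbs the factor s, hence the rate n / 2. *)
Lemma sinh_weight_bound : exists2 K : R, 0 <= K & forall s, `|sinh_weight s| <= K * expR (- (n%:R / 2 * `|s|)).
Proof.
have h2 : 0 < 2^-1 :> R by rewrite invr_gt0.
have [C C0 hC] := expr_le_expR 1 h2.
pose K1 := expR 2^-1 + 4 * C.
have K10 : 0 <= K1 by rewrite addr_ge0 ?expR_ge0// mulr_ge0// ltW.
exists (K1 ^+ n); first by rewrite exprn_ge0.
apply: half_weight_bound => [|s s0]; first by rewrite exprn_ge0.
have -> : expR (- (n%:R / 2 * `|s|)) = expR (- (2^-1 * `|s|)) ^+ n.
  by rewrite -expRM_natl; congr expR; ring.
rewrite -exprMn normrX lerXn2r ?nnegrE ?normr_ge0 ?mulr_ge0 ?expR_ge0//.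
rewrite ger0_norm; last by rewrite divr_ge0 ?ltW// sinh_gt0.
have [s1|s1] := leP 1 s.
  have sh := sinh_gt0 s0; have es : `|s| = s by rewrite ger0_norm// ltW.
  have := @sinh_ge_expR R s; rewrite es (ger0_norm (ltW sh)) => /(_ s1) hs.
  have := hC s; rewrite expr1 es => hs'.
  rewrite ler_pdivrMr ?sinh_gt0//; apply: (le_trans hs').
  have -> : C * expR (2^-1 * s) = 4 * C * expR (- (2^-1 * s)) * (expR s / 4).
    rewrite (_ : expR s = expR (2^-1 * s) * expR (2^-1 * s)); last by rewrite -expRD; congr expR; field.
    rewrite expRN; have := expR_gt0 (2^-1 * s); move: (expR _) => e e0; field; rewrite gt_eqF//.
  apply: ler_pM => //; first by rewrite mulr_ge0 ?expR_ge0// mulr_ge0// ltW.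
  by rewrite ler_wpM2r ?expR_ge0// lerDr expR_ge0.
rewrite (@le_trans _ _ 1)//; first by rewrite ler_pdivrMr ?sinh_gt0// mul1r sinh_ge_id// ltW.
rewrite ger0_norm ?(ltW s0)// (@le_trans _ _ (expR 2^-1 * expR (- (2^-1 * s))))//.
  rewrite -expRD -[leLHS]expR0 ler_expR; lra.
by rewrite ler_wpM2r ?expR_ge0// lerDl mulr_ge0// ltW.
Qed.

Lemma sinh_weight_le0 s : s <= 0 -> sinh_weight s = 0. Proof. exact: half_weight_le0. Qed.

Definition sinh_bessel p v : R := weighted sinh_weight p p (v ^+ 2).

Lemma cintegral_bessel_real p v :
  cintegral half_line (fun s => (s ^+ p * (s / sinh s) ^+ n)%:C * bessel_series ((p.+1%:R - 2) / 2) (s%:C * v%:C)) =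
  (sinh_bessel p v)%:C.
Proof.
have E s : (s ^+ p * (s / sinh s) ^+ n)%:C * bessel_series ((p.+1%:R - 2) / 2) (s%:C * v%:C) =
   ((s / sinh s) ^+ n * (s ^+ p * ebessel p (s ^+ 2 * v ^+ 2)))%:C :> R[i].
  have -> : s%:C * v%:C = (s * v)%:C :> R[i] by rewrite rmorphM.
  rewrite bessel_real -rmorphM [(s * v) ^+ 2]exprMn; congr (_%:C).
  by rewrite -mulrA mulrCA.
rewrite (eq_cintegral (fun s _ => E s)) /sinh_bessel.
Transparent weighted.
have -> : weighted sinh_weight p p (v ^+ 2) =
    \int[mu]_(s in half_line) ((s / sinh s) ^+ n * (s ^+ p * ebessel p (s ^+ 2 * v ^+ 2))).
  by rewrite -Rintegral_half_weight; apply: eq_Rintegral => s _; rewrite mulrA.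
Opaque weighted.
by apply: cplx_eq => //=; rewrite /Rintegral integral0.
Qed.

Definition odd_limit k : R := (2 * pi) ^+ k * (2 * pi ^+ n.+1 / (n.-1)`!%:R) / (2 * Num.sqrt pi).

Lemma bessel_limit_real k : bessel_limit n k 0 = (odd_limit k)%:C :> R[i].
Proof.
rewrite /bessel_limit double0 half_limit0// /odd_limit.
have h2 : (2 : R[i]) = (2 : R)%:C by rewrite rmorph_nat.
by rewrite h2 -!rmorphM -rmorphXn -fmorphV -!rmorphM.
Qed.

Lemma sinh_bessel_asymptotic k :
  sinh_bessel (k.*2) v / (expR (- (pi * v)) * v ^+ n.-1 * v^-1 ^+ k) @[v --> (+oo : set_system R)] --> odd_limit k.
Proof.
have h := (@bessel_moment_asymptotic R n n0 k 0%N).2.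
have Fv : (v%:C @[v --> (+oo : set_system R)]) `=>` strip_pinfty (1 / 2 : R).
  move=> A [M _ MA]; exists M; split; first exact: num_real.
  by move=> v Mv; apply: MA => //=; rewrite normr0; lra.
have {h} := cvg_trans (cvg_app _ Fv) h.
move=> h.
have E v : Normc.normc (cintegral half_line (bessel_moment_fun n k 0 v%:C) / (cexp (- (pi%:C * v%:C)) * v%:C ^+ n.-1 * v%:C^-1 ^+ k)
    - bessel_limit n k 0) = `|sinh_bessel (k.*2) v / (expR (- (pi * v)) * v ^+ n.-1 * v^-1 ^+ k) - odd_limit k|.
  have -> : cintegral half_line (bessel_moment_fun n k 0 v%:C) = (sinh_bessel (k.*2) v)%:C.
    by rewrite -cintegral_bessel_real.
  have -> : cexp (- (pi%:C * v%:C)) = (expR (- (pi * v)))%:C by rewrite -rmorphM -rmorphN cexp_real.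
  by rewrite bessel_limit_real -rmorphXn -fmorphV -rmorphXn -!rmorphM -fmorphV -rmorphM -rmorphB normc_real.
apply/subr_cvg0/norm_cvg0P.
rewrite -(funext E); exact: h.
Qed.

Lemma sinh_bessel_bound k : exists C V0 : R, [/\ 0 <= C, 0 < V0 &
  forall v, V0 <= v -> `|sinh_bessel (k.*2) v| <= C * (expR (- (pi * v)) * v ^+ n.-1 * v^-1 ^+ k)].
Proof.
pose C := `|odd_limit k| + 1.
have h := @sinh_bessel_asymptotic k.
have : \forall v \near +oo, `|sinh_bessel (k.*2) v / (expR (- (pi * v)) * v ^+ n.-1 * v^-1 ^+ k)| < C.
  by apply: (cvgr_lt _ (cvg_norm h)); rewrite /C ltrDl.
move=> [M [_ hM]]; exists C, (Num.max M 0 + 1); split.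
- by rewrite addr_ge0.
- by rewrite ltr_wpDl// le_max lexx orbT.
- move=> v Mv; have Mv' : M < v by rewrite (lt_le_trans _ Mv)// ltr_pwDr// le_max lexx.
  have v0 : 0 < v by rewrite (lt_le_trans _ Mv)// ltr_wpDl// le_max lexx orbT.
  have S0 : 0 < expR (- (pi * v)) * v ^+ n.-1 * v^-1 ^+ k.
    by rewrite !mulr_gt0 ?expR_gt0 ?exprn_gt0 ?invr_gt0.
  have /= := hM v Mv'; rewrite normrM normfV (gtr0_norm S0) ltr_pdivrMr// => /ltW; exact.
Qed.

End SinhWeight.

(** * Descent for the weight (s / sinh s)^n *)

Section PlanarDescent.
Context {R : realType}.
Implicit Types (x y t s u v w : R) (p q r k j : nat).
Local Notation mu := (@lebesgue_measure R).
Local Notation ibl D f := (mu.-integrable D (EFin \o f)).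
Variable n : nat.
Hypothesis n0 : (0 < n)%N.
Local Notation W := (@sinh_weight R n).
Local Notation A p r y := (weighted W p r y).

Let halfn : 0 < n%:R / 2 :> R. Proof. by rewrite divr_gt0// ltr0n. Qed.

Lemma is_derive_sinh_weighted p r v u : 0 <= u -> is_derive v (1 : R)
  (fun t => A p r (t ^+ 2 + u)) (- (v / 2) * A p.+2 r.+2 (v ^+ 2 + u)).
Proof.
have [K K0 hK] := @sinh_weight_bound R n; move=> u0.
exact: (is_derive_weighted (sinh_weight_measurable n) halfn K0 hK p r v u0).
Qed.

Lemma sinh_weighted_slice_continuous p r v : continuous (fun u => A p r (v ^+ 2 + u ^+ 2)).
Proof.
have -> : (fun u => A p r (v ^+ 2 + u ^+ 2)) = (fun t => A p r (t ^+ 2 + v ^+ 2)).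
  by apply/funext => u; rewrite addrC.
move=> u; exact: (is_derive_continuous_at (is_derive_sinh_weighted p r u (sqr_ge0 v))).
Qed.

Lemma sinh_weighted_decay q r : exists2 C : R, 0 <= C & forall y, 0 <= y ->
  `|A q.+4 r.+2 y| <= C * (1 + y)^-1.
Proof.
have [K K0 hK] := @sinh_weight_bound R n.
exact: (weighted_decay (sinh_weight_measurable n) halfn K0 hK).
Qed.

Lemma sinh_weighted_descent q r v : 0 <= v ->
  \int[mu]_u A q.+4 r.+3 (v ^+ 2 + u ^+ 2) = 2 * Num.sqrt pi * A q.+3 r.+2 (v ^+ 2).
Proof.
have [K K0 hK] := @sinh_weight_bound R n; move=> v0; rewrite -(slice0_value q).
exact: (weighted_descent (sinh_weight_measurable n) halfn K0 (@sinh_weight_le0 R n) hK).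
Qed.

Lemma sinh_weighted_integrable p r y : 0 <= y -> ibl setT (fun s => W s * s ^+ r * ebessel p (s ^+ 2 * y)).
Proof.
have [K K0 hK] := @sinh_weight_bound R n; move=> y0.
exact: (weighted_integrable (sinh_weight_measurable n) halfn K0 hK).
Qed.

Lemma sinh_weighted_rec p r y : 0 <= y ->
  A p r y = p.+1%:R / 2 * A p.+2 r y + (- (y / 4)) * A p.+4 r.+2 y.
Proof.
Transparent weighted.
move=> y0; rewrite /weighted -(Rintegral_linear2 _ _ measurableT (sinh_weighted_integrable p.+2 r y0)
  (sinh_weighted_integrable p.+4 r.+2 y0)).
apply: eq_Rintegral => s _; have := @ebessel_rec R p (s ^+ 2 * y).
rewrite mulr_ge0 ?sqr_ge0// => /(_ isT) ->; rewrite !exprS.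
by move: (ebessel _ _) (ebessel _ _) (W s) => a b w; ring.
Opaque weighted.
Qed.

(** Index 3 is too small for [weighted_decay]; one power of v comes from [ebessel_sqrt_decay] at s
    v, whose factor s is the s of the integrand. *)
Lemma sinh_weighted31_decay : exists2 C : R, 0 <= C & forall v, 0 < v -> v * `|A 3 1 (v ^+ 2)| <= C.
Proof.
have [K K0 hK] := @sinh_weight_bound R n.
have ia := weight_moment_abs_integrable (sinh_weight_measurable n) halfn K0 hK 0.
have [C C0 h] := @ebessel_sqrt_decay R 1.
exists (C * \int[mu]_s `|W s * s ^+ 0|) => [|v v0]; first by rewrite mulr_ge0// Rintegral_ge0.
have iw := sinh_weighted_integrable 3 1 (sqr_ge0 v).
rewrite mulrC -ler_pdivlMr// mulrAC -RintegralZl//.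
Transparent weighted.
rewrite /weighted (le_trans (le_normr_Rintegral _ iw))//.
Opaque weighted.
apply: le_Rintegral => //.
- exact: integrable_norm iw.
- exact: integrable_scale.
move=> s _; have [s0|s0] := leP s 0.
  by rewrite sinh_weight_le0// !mul0r normr0 mulr0.
have sv : 0 <= s * v by rewrite mulr_ge0// ltW.
have := h _ sv; rewrite exprMn => hs.
rewrite expr0 mulr1 expr1 !normrM (gtr0_norm s0) -mulrA [leRHS]mulrC ler_wpM2l//.
by rewrite ler_pdivlMr// mulrAC.
Qed.

Lemma sqrt_ge_mean v u : 0 <= v -> (v + `|u|) / 2 <= Num.sqrt (v ^+ 2 + u ^+ 2).
Proof.
move=> v0; rewrite ler_pdivrMr//.
have s0 := sqrtr_ge0 (v ^+ 2 + u ^+ 2).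
have h1 : v <= Num.sqrt (v ^+ 2 + u ^+ 2).
  by rewrite -[leLHS](ger0_norm v0) -sqrtr_sqr ler_wsqrtr// lerDl sqr_ge0.
have h2 : `|u| <= Num.sqrt (v ^+ 2 + u ^+ 2).
  by rewrite -sqrtr_sqr ler_wsqrtr// lerDr sqr_ge0.
lra.
Qed.

(** Since pi >= 2, e^(- pi v) provides two factors e^(- v), one of which absorbs v^(n-1). *)
Lemma sinh_bessel_exp_bound k : exists C V0 : R, [/\ 0 <= C, 0 < V0 &
  forall v, V0 <= v -> `|sinh_bessel n (k.*2) v| <= C * expR (- v)].
Proof.
have [C [V0 [C0 V00 h]]] := @sinh_bessel_bound R n n0 k.
have [D D0 hD] := expr_le_expR n.-1 (ltr01 : 0 < (1 : R)).
exists (C * D), (Num.max V0 1); split; first by rewrite mulr_ge0 ?(ltW D0).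
  by rewrite lt_max V00.
move=> v; rewrite ge_max => /andP[Vv v1].
have v0 : 0 < v by rewrite (lt_le_trans _ v1).
rewrite (le_trans (h v Vv))// -[leRHS]mulrA ler_wpM2l//.
have h1 : v ^+ n.-1 <= D * expR v.
  by have := hD v; rewrite mul1r ger0_norm// ltW.
have vi0 : 0 <= v^-1 by rewrite invr_ge0 ltW.
have h2 : v^-1 ^+ k <= 1 by apply: exprn_ile1 => //; rewrite invf_le1.
have h3 : expR (- (pi * v)) <= expR (- v) * expR (- v).
  rewrite -expRD ler_expR -opprD lerN2 -mulr2n -mulr_natl ler_wpM2r ?(ltW v0)//.
  exact: pi_ge2.
rewrite -[D * _]mulr1; apply: ler_pM => //.
- by rewrite mulr_ge0 ?expR_ge0// exprn_ge0// ltW.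
- exact: exprn_ge0.
apply: (le_trans (ler_pM (expR_ge0 _) _ h3 h1)); first by rewrite exprn_ge0// ltW.
have e1 : expR (- v) * expR v = 1 by rewrite -expRD addNr expR0.
have -> : expR (- v) * expR (- v) * (D * expR v) = D * expR (- v) * (expR (- v) * expR v) by ring.
by rewrite e1 mulr1.
Qed.

(** By [sqrt_ge_mean], e^(- sqrt (v^2 + u^2)) splits into a factor in v and an integrable factor in
    u. *)
Lemma sinh_slice_bound k : exists C V0 : R, [/\ 0 <= C, 0 < V0 & forall v u, V0 < v ->
  `|A (k.*2) (k.*2) (v ^+ 2 + u ^+ 2)| <= C * expR (- (v / 2)) * expR (- (2^-1 * `|u|))].
Proof.
have [C [V0 [C0 V00 hC]]] := sinh_bessel_exp_bound k; exists C, V0; split => // v u Vv.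
have v0 : 0 <= v by rewrite ltW// (lt_trans V00).
have vu : 0 <= v ^+ 2 + u ^+ 2 by rewrite addr_ge0 ?sqr_ge0.
have := hC (Num.sqrt (v ^+ 2 + u ^+ 2)); rewrite /sinh_bessel sqr_sqrtr// => h.
have Vs : V0 <= Num.sqrt (v ^+ 2 + u ^+ 2).
  by rewrite (le_trans (ltW Vv))// -[leLHS](ger0_norm v0) -sqrtr_sqr ler_wsqrtr// lerDl sqr_ge0.
rewrite (le_trans (h Vs))// -mulrA ler_wpM2l// -expRD ler_expR.
have := sqrt_ge_mean u v0; lra.
Qed.

Let h2 : 0 < 2^-1 :> R. Proof. by rewrite invr_gt0. Qed.

Lemma sinh_slice_integrable k : exists2 V0 : R, 0 < V0 & forall v, V0 < v ->
  ibl setT (fun u => A (k.*2) (k.*2) (v ^+ 2 + u ^+ 2)).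
Proof.
have [C [V0 [C0 V00 bound]]] := sinh_slice_bound k; exists V0 => // v Vv.
apply: (integrable_le_expR measurableT _ h2) => [|u _]; last exact: bound.
exact: continuous_measurable_fun (@sinh_weighted_slice_continuous _ _ v).
Qed.

(* The integral of [ebessel 2 (v^2 + u^2)] over [u] is not absolutely convergent, so
   [weighted_descent] does not apply.  Here the two sides have equal derivatives by
   the descent from [A 4 4] to [A 3 3], and differ by [2 sqrt pi * kap].  As
   [Q v = v^2 A 3 1 (v^2)] is [O(v)] while [Q' = 2 v A 1 1 (v^2)], the mean value
   theorem forces [kap = 0]. *)
Lemma planar_descent : exists2 V0 : R, 0 < V0 & forall v, V0 < v ->
  \int[mu]_u A 2 2 (v ^+ 2 + u ^+ 2) = 2 * Num.sqrt pi * A 1 1 (v ^+ 2).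
Proof.
have [C [V1 [C0 V10 bound1]]] := sinh_slice_bound 1; have [V2 V20 iA2] := sinh_slice_integrable 1.
pose V0 := Num.max V1 V2; have V00 : 0 < V0 by rewrite lt_max V10.
exists V0 => //.
have bound v u : V0 < v -> `|A 2 2 (v ^+ 2 + u ^+ 2)| <= C * expR (- (v / 2)) * expR (- (2^-1 * `|u|)).
  by rewrite gt_max => /andP[Vv _]; exact: (bound1 v u Vv).
have iA v : V0 < v -> ibl setT (fun u => A 2 2 (v ^+ 2 + u ^+ 2)).
  by rewrite gt_max => /andP[_ Vv]; exact: (iA2 v Vv).
clearbody V0.
(* The kernel of index 2 decays too slowly in u, but after integration in s the odd asymptotics make
   it exponentially small, so [Psi] converges and decays exponentially. *)
pose Psi v := \int[mu]_u A 2 2 (v ^+ 2 + u ^+ 2).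
have dPsi v : V0 < v -> is_derive v (1 : R) Psi (- (v / 2) * \int[mu]_u A 4 4 (v ^+ 2 + u ^+ 2)).
  move=> Vv; have [C4 C40 h4] := sinh_weighted_decay 0 2.
  have bA x u : `|A 4 4 (x ^+ 2 + u ^+ 2)| <= C4 * (1 + u ^+ 2)^-1.
    have xu : 0 <= x ^+ 2 + u ^+ 2 by rewrite addr_ge0 ?sqr_ge0.
    rewrite (le_trans (h4 _ xu))// ler_wpM2l// lef_pV2 ?posrE ?ltr_pwDl ?sqr_ge0//.
    by rewrite lerD2l lerDr sqr_ge0.
  have i4 x : ibl setT (fun u => A 4 4 (x ^+ 2 + u ^+ 2)).
    apply: (@integrable_dominated _ setT _ (fun u => C4 * (1 + u ^+ 2)^-1)) => //.
      exact: continuous_measurable_fun (@sinh_weighted_slice_continuous 4 4 x).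
    by apply: integrable_scale => //; exact: cauchy_integrable.
  have v0 : 0 <= v by rewrite ltW// (lt_trans V00).
  rewrite -RintegralZl//.
  apply: (@is_derive_under_integral _ setT (fun x u => A 2 2 (x ^+ 2 + u ^+ 2))
    (fun x u => - (x / 2) * A 4 4 (x ^+ 2 + u ^+ 2)) (fun u => (v + 1) * (C4 * (1 + u ^+ 2)^-1))
    v V0 (v + 1)) => //.
  - by rewrite Vv/= ltrDl.
  - by move=> x /andP[Vx _]; exact: iA.
  - by move=> x u _ _; apply: is_derive_sinh_weighted; exact: sqr_ge0.
  - by do 2!apply: integrable_scale => //; exact: cauchy_integrable.
  - move=> x u /andP[Vx xv] _; rewrite normrM ler_pM//.
    have x0 : 0 < x by rewrite (lt_trans V00).
    rewrite normrN ger0_norm ?divr_ge0 ?(ltW x0)// ler_pdivrMr// (le_trans (ltW xv))//.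
    by rewrite ler_peMr ?addr_ge0// ler1n.
have dA p r v : is_derive v (1 : R) (fun t => A p r (t ^+ 2)) (- (v / 2) * A p.+2 r.+2 (v ^+ 2)).
  by have := is_derive_sinh_weighted p r v (lexx 0); under eq_fun do rewrite addr0; rewrite addr0.
pose D v := 2 * Num.sqrt pi * A 1 1 (v ^+ 2) - Psi v.
have dD v : V0 < v -> is_derive v (1 : R) D 0.
  move=> Vv; have v0 : 0 <= v by rewrite ltW// (lt_trans V00).
  apply: (is_derive_eq (is_deriveB (is_deriveM (is_derive_cst (2 * Num.sqrt pi : R) v 1) (dA 1 1 v)) (dPsi v Vv))).
  rewrite (@sinh_weighted_descent 0 1 v v0) /GRing.scale /= mulr0 addr0.
  by move: (weighted _ _ _ _) (Num.sqrt pi) => a b; ring.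
have cD x y : V0 < x -> V0 < y -> D x = D y.
  move=> Vx Vy; apply: (@cst_on_itv_derive0 _ D V0 (Num.max x y + 1)).
  - by move=> t /andP[Vt _]; exact: dD.
  - by rewrite Vx ltr_pwDr// le_max lexx.
  - by rewrite Vy ltr_pwDr// le_max lexx orbT.
pose kap := D (V0 + 1) / (2 * Num.sqrt pi).
have c0 : 0 < 2 * Num.sqrt pi :> R by rewrite mulr_gt0// sqrtr_gt0 pi_gt0.
have A1 v : V0 < v -> A 1 1 (v ^+ 2) = kap + Psi v / (2 * Num.sqrt pi).
  move=> Vv; have := cD v (V0 + 1) Vv; rewrite ltrDl => /(_ ltr01).
  by rewrite /kap => <-; rewrite /D; move: c0; move: (2 * Num.sqrt pi) => c c0; field; rewrite gt_eqF.
clearbody kap.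
pose I := \int[mu]_u expR (- (2^-1 * `|u|)).
have iI : ibl setT (fun u => expR (- (2^-1 * `|u|))).
  apply: (integrable_le_expR (C := 1) measurableT _ h2) => [|u _]; last first.
    by rewrite mul1r ger0_norm// expR_ge0.
  apply: continuous_measurable_fun => u; apply: continuous_comp; last exact: continuous_expR.
  by apply: cvgN; apply: cvgM; [exact: cvg_cst|exact: norm_continuous].
have Psi_le v : V0 < v -> `|Psi v| <= C * I * expR (- (v / 2)).
  move=> Vv; rewrite (le_trans (le_normr_Rintegral _ (iA v Vv)))//.
  rewrite mulrAC -RintegralZl//; apply: le_Rintegral => //.
  - exact: integrable_norm (iA v Vv).
  - exact: integrable_scale.
  - by move=> u _; exact: bound.
suff k0 : kap = 0.
  move=> v Vv; rewrite A1// k0 add0r -/(Psi v); move: c0; move: (2 * Num.sqrt pi) => c c0; field.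
  by rewrite gt_eqF.
pose Q v := v ^+ 2 * A 3 1 (v ^+ 2).
(* Differentiating A 3 1 produces A 5 3, and the recurrence at p = r = 1 folds both into A 1 1. *)
have dQ v : V0 < v -> is_derive v (1 : R) Q (2 * v * A 1 1 (v ^+ 2)).
  move=> Vv; apply: (is_derive_eq (is_deriveM (is_derive_expr 1 v) (dA 3 1 v))).
  rewrite (sinh_weighted_rec 1 1 (sqr_ge0 v)) /GRing.scale /= expr1.
  by move: (weighted _ _ _ _) (weighted _ _ _ _) => a b; field.
have [C3 C30 hQ] : exists2 C3, 0 <= C3 & forall v, 0 < v -> `|Q v| <= C3 * v.
  have [C3 C30 h3] := sinh_weighted31_decay; exists C3 => // v v0.
  rewrite /Q normrM (ger0_norm (sqr_ge0 v)) expr2 -mulrA [leRHS]mulrC ler_wpM2l ?(ltW v0)//.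
  exact: h3.
pose c0' := (2 * Num.sqrt pi)^-1 : R.
have I0 : 0 <= I by rewrite Rintegral_ge0// => u _; exact: expR_ge0.
(* At a mean value point c between v and 2 v, v |A 1 1 (c^2)| is bounded by the linear growth of [Q]
   and v |Psi c| by exponential decay; so v |kap| is bounded for arbitrarily large v. *)
have kap_le v : V0 < v -> `|kap| * v <= 3 / 2 * C3 + 2 * (C * I) * c0'.
  move=> Vv; have v0 : 0 < v by exact: lt_trans Vv.
  have vv : v < 2 * v by rewrite mulr_natl mulr2n ltrDl.
  have [||c] := @MVT R Q (fun t => 2 * t * A 1 1 (t ^+ 2)) v (2 * v) vv.
  - by move=> t; rewrite in_itv/= => /andP[vt _]; apply: dQ; exact: lt_trans vt.
  - apply: continuous_in_subspaceT => t; rewrite inE/= in_itv/= => /andP[vt _].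
    apply: (@is_derive_continuous_at _ Q); apply: dQ; exact: lt_le_trans vt.
  rewrite in_itv/= => /andP[vc _] hc; have c1 : 0 < c := lt_trans v0 vc.
  have Vc : V0 < c := lt_trans Vv vc.
  have hA : `|A 1 1 (c ^+ 2)| * v <= 3 / 2 * C3.
    have vc2 : 0 < 2 * v by rewrite mulr_gt0.
    have h : `|A 1 1 (c ^+ 2) * (2 * c * v)| <= 3 * C3 * v.
      have -> : A 1 1 (c ^+ 2) * (2 * c * v) = Q (2 * v) - Q v by rewrite hc; ring.
      apply: (le_trans (ler_normB _ _)); have := hQ _ v0; have := hQ _ vc2.
      by move: `|Q (2 * v)| `|Q v|; clear => a b; lra.
    have v0' : 0 <= `|A 1 1 (c ^+ 2)| * v by rewrite mulr_ge0// ltW.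
    rewrite normrM (gtr0_norm (mulr_gt0 (mulr_gt0 _ c1) v0)) // in h.
    have {}h : `|A 1 1 (c ^+ 2)| * 2 * c <= 3 * C3.
      by rewrite -(ler_pM2r v0); apply: le_trans h; rewrite -!mulrA.
    have : `|A 1 1 (c ^+ 2)| * v <= `|A 1 1 (c ^+ 2)| * c by rewrite ler_wpM2l// ltW.
    by move: h; rewrite mulrAC; move: (`|_| * c) (`|_| * v); clear => x y; lra.
  have hP : `|Psi c| * c0' * v <= 2 * (C * I) * c0'.
    rewrite mulrAC ler_wpM2r ?invr_ge0 ?(ltW c0)//.
    apply: (le_trans (ler_pM _ (ltW v0) (Psi_le c Vc) (ltW vc))) => //.
    have CI : 0 <= C * I by exact: mulr_ge0.
    rewrite -[leLHS]mulrA [leRHS]mulrC; apply: (ler_wpM2l CI).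
    rewrite expRN mulrC ler_pdivrMr ?expR_gt0//.
    by rewrite -ler_pdivrMl// mulrC (le_trans _ (expR_ge1Dx _))// lerDr.
  have := ler_normB (A 1 1 (c ^+ 2)) (Psi c * c0').
  rewrite {1}A1// addrK normrM (gtr0_norm (_ : 0 < c0')) ?invr_gt0// => h.
  by apply: (le_trans (ler_wpM2r (ltW v0) h)); rewrite mulrDl lerD.
apply/eqP; apply: contraT => k0; have kp : 0 < `|kap| by rewrite normr_gt0.
set M := 3 / 2 * C3 + _ in kap_le.
have M0 : 0 <= M by rewrite addr_ge0 ?mulr_ge0// ?invr_ge0 ltW.
have /kap_le : V0 < V0 + (M + 1) / `|kap| by rewrite ltrDl divr_gt0// ltr_wpDl.
rewrite mulrDr [X in _ + X]mulrC divfK ?gt_eqF//.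
have : 0 < `|kap| * V0 by rewrite mulr_gt0.
by move: (`|kap| * V0); clear => a a0; lra.
Qed.

(** Index 2 is the only one here below the absolutely convergent range; from 4 on the general
    descent applies. *)
Lemma even_descent k : (0 < k)%N -> exists2 V0 : R, 0 < V0 & forall v, V0 < v ->
  \int[mu]_u A (k.*2) (k.*2) (v ^+ 2 + u ^+ 2) = 2 * Num.sqrt pi * sinh_bessel n (k.*2).-1 v.
Proof.
case: k => // -[|j] _; first exact: planar_descent.
exists 1 => // v v1; rewrite !doubleS.
by rewrite (@sinh_weighted_descent (j.*2) (j.*2).+1 v)// ltW// (lt_trans ltr01).
Qed.

End PlanarDescent.

(** * Laplace's method and even dimensions *)

Section Laplace.
Context {R : realType}.
Implicit Types (x y t s u v w : R).
Local Notation mu := (@lebesgue_measure R).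
Local Notation ibl D f := (mu.-integrable D (EFin \o f)).
(* With [u = sqrt v * t] one has [sqrt (v^2 + u^2) = v * rho v t]. *)
Local Notation rho v t := (Num.sqrt (1 + t ^+ 2 / v)).

(** Source of the factor sqrt 2 that distinguishes even from odd dimensions. *)
Lemma Rintegral_gauss_pi l : \int[mu]_t (l * expR (- (pi * (t ^+ 2 / 2)))) = Num.sqrt 2 * l.
Proof.
have a0 : 0 < Num.sqrt (pi / 2) :> R by rewrite sqrtr_gt0 divr_gt0// pi_gt0.
have E t : l * expR (- (pi * (t ^+ 2 / 2))) =
    Num.sqrt (pi / 2) * (l / Num.sqrt (pi / 2) * gauss_fun (Num.sqrt (pi / 2) * t)).
  rewrite [RHS]mulrA [Num.sqrt _ * _]mulrC divfK ?gt_eqF// /gauss_fun exprMn sqr_sqrtr ?divr_ge0 ?pi_ge0//.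
  by congr (_ * expR _); ring.
under eq_Rintegral do rewrite E.
have cg : continuous (fun x : R => l / Num.sqrt (pi / 2) * gauss_fun x).
  by move=> x; apply: cvgM; [exact: cvg_cst|exact: continuous_gauss_fun].
rewrite (Rintegral_scale a0 cg) RintegralZl//; last first.
  apply: (integrable_le_expR (a := 1) (C := expR 1) measurableT _ ltr01) => [|x _].
    exact: continuous_measurable_fun (@continuous_gauss_fun R).
  rewrite mul1r /gauss_fun ger0_norm ?expR_ge0// -expRD ler_expR.
  have := sqr_ge0 (`|x| - 1); rewrite -[x ^+ 2]real_normK ?num_real//.
  move: `|x| => y; rewrite !expr2; nra.
rewrite /Rintegral integralT_gauss /= sqrtrM ?pi_ge0// sqrtrV//.
have p0 : Num.sqrt pi != 0 :> R by rewrite gt_eqF// sqrtr_gt0 pi_gt0.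
have s0 : Num.sqrt 2 != 0 :> R by rewrite gt_eqF// sqrtr_gt0.
move: (Num.sqrt pi) (Num.sqrt 2) p0 s0 => p s p0 s0.
by field; rewrite p0 s0.
Qed.

Lemma rho_ge1 v t : 0 < v -> 1 <= rho v t.
Proof. by move=> v0; rewrite -{1}sqrtr1 ler_wsqrtr// lerDl divr_ge0 ?sqr_ge0// ltW. Qed.

Lemma rho_le v t : 1 <= v -> rho v t <= 1 + `|t|.
Proof.
move=> v1; have v0 : 0 < v by rewrite (lt_le_trans _ v1).
rewrite -[leRHS]ger0_norm ?addr_ge0// -sqrtr_sqr ler_wsqrtr//.
have h : t ^+ 2 / v <= t ^+ 2 by rewrite ler_pdivrMr// ler_peMr// sqr_ge0.
rewrite (le_trans (lerD (lexx 1) h))// sqrrD expr1n mul1r real_normK ?num_real//.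
by rewrite -addrA lerD2l lerDr mulrn_wge0.
Qed.

Lemma sqrt_slice_rho v t : 0 < v -> Num.sqrt (v ^+ 2 + (Num.sqrt v * t) ^+ 2) = v * rho v t.
Proof.
move=> v0; rewrite exprMn sqr_sqrtr ?(ltW v0)//.
have -> : v ^+ 2 + v * t ^+ 2 = v ^+ 2 * (1 + t ^+ 2 / v) by field; rewrite gt_eqF.
by rewrite sqrtrM ?sqr_ge0// sqrtr_sqr gtr0_norm.
Qed.

(** The root is rationalised: as v grows the excess tends to t^2 / 2, which leaves the Gaussian of
    [Rintegral_gauss_pi]. *)
Lemma rho_excess v t : 0 < v -> v * rho v t - v = t ^+ 2 / (1 + rho v t).
Proof.
move=> v0; have r1 := rho_ge1 t v0.
have rr : rho v t ^+ 2 = 1 + t ^+ 2 / v by rewrite sqr_sqrtr// addr_ge0// divr_ge0 ?sqr_ge0// ltW.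
have r0 : 1 + rho v t != 0 by rewrite gt_eqF// ltr_wpDr// (le_trans _ r1).
have : v * rho v t ^+ 2 = v + t ^+ 2 by rewrite rr; field; rewrite gt_eqF.
move: (rho v t) r0 => r r0 {rr r1} rr.
by apply: (mulIf r0); rewrite divfK//; rewrite -(addrK v (t ^+ 2)) [_ + v]addrC -rr; ring.
Qed.

(** From rho <= 1 + |t|, because t^2 / (2 + |t|) >= |t| - 2. This linear bound, uniform in v, gives
    the integrable majorant. *)
Lemma rho_excess_ge v t : 1 <= v -> `|t| - 2 <= t ^+ 2 / (1 + rho v t).
Proof.
move=> v1; have v0 : 0 < v by rewrite (lt_le_trans _ v1).
have := rho_le t v1; have := rho_ge1 t v0; rewrite -[t ^+ 2]real_normK ?num_real//.
move: (normr_ge0 t); move: `|t| (rho v t) => a r a0 r1 ra.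
rewrite ler_pdivlMr; last by rewrite ltr_wpDr// (le_trans _ r1).
have [a2|a2] := leP a 2; first nra.
nra.
Qed.

Lemma cvg_rho t : rho v t @[v --> (+oo : set_system R)] --> (1 : R).
Proof.
have h : 1 + t ^+ 2 / v @[v --> (+oo : set_system R)] --> (1 : R).
  rewrite -[X in _ --> X]addr0 -[X in _ + X](mulr0 (t ^+ 2)).
  apply: cvgD; first exact: cvg_cst.
  apply: cvgM; first exact: cvg_cst.
  exact: cvg_inv_pinfty.
rewrite -[X in _ --> X]sqrtr1.
apply: (cvg_comp _ _ h); exact: sqrt_continuous.
Qed.

Section LaplaceAsymptotic.
Variables (f : R -> R) (q k : nat) (l C V0 : R).
Local Notation den v := (expR (- (pi * v)) * v ^+ q * v^-1 ^+ k).
Hypothesis cf : continuous f.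
Hypothesis C0 : 0 <= C.
Hypothesis f_le : forall v, V0 <= v -> `|f v| <= C * den v.
Hypothesis f_lim : f v / den v @[v --> (+oo : set_system R)] --> l.
Hypothesis f_int : forall v, V0 <= v -> ibl setT (fun u => f (Num.sqrt (v ^+ 2 + u ^+ 2))).

Let den_gt0 v : 0 < v -> 0 < den v.
Proof. by move=> v0; rewrite !mulr_gt0 ?expR_gt0 ?exprn_gt0 ?invr_gt0. Qed.

Let den_rho v t : 0 < v -> den (v * rho v t) / den v =
  expR (- (pi * (t ^+ 2 / (1 + rho v t)))) * rho v t ^+ q * (rho v t)^-1 ^+ k.
Proof.
move=> v0; have r0 : 0 < rho v t by rewrite (lt_le_trans _ (rho_ge1 t v0)).
rewrite -rho_excess//; move: (rho v t) r0 => r r0.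
have -> : - (pi * (v * r - v)) = - (pi * (v * r)) + pi * v by ring.
rewrite expRD !expRN !exprVn !exprMn.
move: (expR_gt0 (pi * v)) (expR_gt0 (pi * (v * r))) (exprn_gt0 q v0) (exprn_gt0 k v0) (exprn_gt0 q r0) (exprn_gt0 k r0).
move: (expR _) (expR _) (v ^+ q) (v ^+ k) (r ^+ q) (r ^+ k) => a c v1 v2 r1 r2 *.
by field; rewrite !gt_eqF.
Qed.

Let ker v t := f (v * rho v t) / den v.

Let kerE v t : 0 < v -> ker v t = f (v * rho v t) / den (v * rho v t) *
  (expR (- (pi * (t ^+ 2 / (1 + rho v t)))) * rho v t ^+ q * (rho v t)^-1 ^+ k).
Proof.
move=> v0; have r0 : 0 < rho v t by rewrite (lt_le_trans _ (rho_ge1 t v0)).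
have vr0 : 0 < v * rho v t by rewrite mulr_gt0.
rewrite -den_rho// /ker.
have := den_gt0 v0; have := den_gt0 vr0; move: (den (v * rho v t)) (den v) => a c a0 c0.
by field; rewrite !gt_eqF.
Qed.

Let le_rho v t : 0 < v -> v <= v * rho v t.
Proof. by move=> v0; rewrite ler_pMr// rho_ge1. Qed.

(** The excess is nonnegative and at least |t| - 2, and pi >= 2, so the exponential is at most e^(4
    - 2 |t|); the power of rho costs a multiple of e^(1 + |t|). Hence e^5 and the rate 1. *)
Let ker_le : exists2 D : R, 0 <= D & forall v t, V0 <= v -> 1 <= v -> `|ker v t| <= D * expR (- (1 * `|t|)).
Proof.
have [D D0 hD] := expr_le_expR q (ltr01 : 0 < (1 : R)).
exists (C * (D * expR 5)); first by rewrite mulr_ge0// mulr_ge0 ?expR_ge0// ltW.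
move=> v t Vv v1; have v0 : 0 < v by rewrite (lt_le_trans _ v1).
have r1 := rho_ge1 t v0; have r0 : 0 < rho v t by rewrite (lt_le_trans _ r1).
have vr0 : 0 < v * rho v t by rewrite mulr_gt0.
rewrite kerE// normrM -[leRHS]mulrA; apply: ler_pM => //.
  rewrite normrM normfV (gtr0_norm (den_gt0 vr0)) ler_pdivrMr ?den_gt0//.
  by rewrite f_le// (le_trans Vv)// le_rho.
have hr : rho v t ^+ q <= D * expR (1 + `|t|).
  have := hD (rho v t); rewrite mul1r (gtr0_norm r0) => h.
  by rewrite (le_trans h)// ler_pM2l// ler_expR rho_le.
have hk : (rho v t)^-1 ^+ k <= 1.
  by apply: exprn_ile1; [rewrite invr_ge0 ltW|rewrite invf_le1].
have he : expR (- (pi * (t ^+ 2 / (1 + rho v t)))) <= expR (4 - 2 * `|t|).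
  rewrite ler_expR; have := rho_excess_ge t v1; have := @pi_ge2 R.
  have : 0 <= t ^+ 2 / (1 + rho v t) by rewrite divr_ge0 ?sqr_ge0// addr_ge0// ltW.
  move: (pi : R) (t ^+ 2 / _) `|t| => p x a x0 p2 ax; nra.
have rq0 : 0 <= rho v t ^+ q by rewrite exprn_ge0// ltW.
have rk0 : 0 <= (rho v t)^-1 ^+ k by rewrite exprn_ge0// invr_ge0 ltW.
rewrite ger0_norm; last by do 2!apply: mulr_ge0 => //; exact: expR_ge0.
rewrite -[leRHS]mulr1; apply: (ler_pM _ rk0 _ hk); first by apply: mulr_ge0 => //; exact: expR_ge0.
apply: (le_trans (ler_pM (expR_ge0 _) rq0 he hr)).
rewrite mulrCA -mulrA ler_pM2l// -!expRD ler_expR.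
by move: `|t| => a; lra.
Qed.

Let ker_cvg t : ker v t @[v --> (+oo : set_system R)] --> l * expR (- (pi * (t ^+ 2 / 2))).
Proof.
have hr := cvg_rho t.
have h1 : f (v * rho v t) / den (v * rho v t) @[v --> (+oo : set_system R)] --> l.
  have h : v * rho v t @[v --> (+oo : set_system R)] --> (+oo : set_system R).
    apply/cvgryPge => A; near=> v.
    have Av : A <= v by near: v; apply: nbhs_pinfty_ge; exact: num_real.
    by apply: (le_trans Av); apply: le_rho; near: v; exact: nbhs_pinfty_gt.
  exact: (cvg_comp _ _ h f_lim).
have h2 : expR (- (pi * (t ^+ 2 / (1 + rho v t)))) @[v --> (+oo : set_system R)] --> expR (- (pi * (t ^+ 2 / 2))).
  have h : - (pi * (t ^+ 2 / (1 + rho v t))) @[v --> (+oo : set_system R)] --> - (pi * (t ^+ 2 / (1 + 1))).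
    apply: cvgN; apply: cvgM; first exact: cvg_cst.
    apply: cvgM; first exact: cvg_cst.
    apply: cvgV; first by rewrite gt_eqF// addr_gt0.
    by apply: cvgD hr; exact: cvg_cst.
  exact: (cvg_comp _ _ h (@continuous_expR R _)).
have h3 : rho v t ^+ q @[v --> (+oo : set_system R)] --> (1 : R).
  by have := cvg_comp _ _ hr (@exprn_continuous R q 1); rewrite expr1n.
have h4 : (rho v t)^-1 ^+ k @[v --> (+oo : set_system R)] --> (1 : R).
  have h : (rho v t)^-1 @[v --> (+oo : set_system R)] --> (1 : R)^-1 by apply: cvgV => //; exact: oner_neq0.
  by rewrite invr1 in h; have := cvg_comp _ _ h (@exprn_continuous R k 1); rewrite expr1n.
have := cvgM h1 (cvgM (cvgM h2 h3) h4); rewrite !mulr1 => /(_ _ _ _).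
apply: cvg_trans; apply: near_eq_cvg; near=> v.
rewrite kerE//; near: v; exact: nbhs_pinfty_gt.
Unshelve. all: by end_near. Qed.

Let ker_continuous v : continuous (ker v).
Proof.
move=> t; apply: cvgM; last exact: cvg_cst.
apply: (@continuous_comp _ _ _ (fun t => v * rho v t) f); last exact: cf.
apply: cvgM; first exact: cvg_cst.
apply: (@continuous_comp _ _ _ (fun t => 1 + t ^+ 2 / v) (@Num.sqrt R)); last exact: sqrt_continuous.
apply: cvgD; first exact: cvg_cst.
by apply: cvgM; [exact: exprn_continuous|exact: cvg_cst].
Qed.

Let kerI v : V0 <= v -> 0 < v ->
  \int[mu]_u f (Num.sqrt (v ^+ 2 + u ^+ 2)) / (Num.sqrt v * den v) = \int[mu]_t ker v t.
Proof.
move=> Vv v0; have s0 : 0 < Num.sqrt v by rewrite sqrtr_gt0.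
pose g u := (Num.sqrt v * den v)^-1 * f (Num.sqrt (v ^+ 2 + u ^+ 2)).
have cg : continuous g.
  move=> u; apply: cvgM; first exact: cvg_cst.
  apply: (@continuous_comp _ _ _ (fun u => Num.sqrt (v ^+ 2 + u ^+ 2)) f); last exact: cf.
  apply: (@continuous_comp _ _ _ (fun u => v ^+ 2 + u ^+ 2) (@Num.sqrt R)); last exact: sqrt_continuous.
  by apply: cvgD; [exact: cvg_cst|exact: exprn_continuous].
have -> : \int[mu]_t ker v t = \int[mu]_t (Num.sqrt v * g (Num.sqrt v * t)).
  apply: eq_Rintegral => t _; rewrite /g sqrt_slice_rho// /ker.
  have := den_gt0 v0; move: (den v) (Num.sqrt v) s0 (f _) => d s s0 y d0.
  by field; rewrite !gt_eqF.
by rewrite (Rintegral_scale s0 cg) /g RintegralZl ?f_int// mulrC.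
Qed.

Lemma laplace_slice :
  \int[mu]_u f (Num.sqrt (v ^+ 2 + u ^+ 2)) / (Num.sqrt v * den v) @[v --> (+oo : set_system R)] --> Num.sqrt 2 * l.
Proof.
rewrite -Rintegral_gauss_pi.
have [D D0 hD] := ker_le.
suff h : \int[mu]_t ker v t @[v --> (+oo : set_system R)] --> \int[mu]_t (l * expR (- (pi * (t ^+ 2 / 2)))).
  apply: cvg_trans h; apply: near_eq_cvg; near=> v.
  have Vv : V0 <= v by near: v; apply: nbhs_pinfty_ge; exact: num_real.
  by rewrite kerI//; near: v; exact: nbhs_pinfty_gt.
apply/cvg_pinftyP => u uy.
(* The majorant is valid for v >= V1, whereas dominated convergence asks for it at every index: the
   sequence is raised to V1, which changes finitely many terms. *)
pose V1 := Num.max V0 1; pose w m := Num.max (u m) V1.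
have wV m : V0 <= w m /\ 1 <= w m by rewrite /w /V1 !le_max !lexx !orbT.
have uw : \forall m \near \oo, u m = w m.
  have /cvgryPge/(_ V1) := uy; apply: filterS => m h.
  by rewrite /w; apply/esym/max_idPl.
have wy : w m @[m --> \oo] --> (+oo : set_system R).
  by apply: cvg_trans uy; apply: near_eq_cvg; apply: filterS uw => m ->.
have h : \int[mu]_t ker (w m) t @[m --> \oo] --> \int[mu]_t (l * expR (- (pi * (t ^+ 2 / 2)))).
  apply: (@Rintegral_dominated_cvg _ setT (fun m t => ker (w m) t) _ (fun t => D * expR (- (1 * `|t|)))) => //.
  - by move=> m; exact: continuous_measurable_fun (@ker_continuous (w m)).
  - by move=> t _; have /cvg_pinftyP h := @ker_cvg t; exact: h.
  - apply: (integrable_le_expR (C := D) measurableT _ ltr01) => [|t _]; last first.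
      by rewrite ger0_norm// mulr_ge0 ?expR_ge0.
    apply: continuous_measurable_fun => t; apply: cvgM; first exact: cvg_cst.
    apply: continuous_comp; last exact: continuous_expR.
    by apply: cvgN; apply: cvgM; [exact: cvg_cst|exact: norm_continuous].
  - by move=> m t _; have [? ?] := wV m; exact: hD.
apply: cvg_trans h; apply: near_eq_cvg.
by apply: filterS uw => m ->.
Unshelve. all: by end_near. Qed.

End LaplaceAsymptotic.
End Laplace.

(** * Even dimensions on the real line *)

Section EvenTheorem.
Context {R : realType}.
Implicit Types (x y t s u v w : R) (p q r k j : nat).
Local Notation mu := (@lebesgue_measure R).
Local Notation half_line := (`]0%R, +oo[%classic : set (measurableTypeR R)).
Variable n : nat.
Hypothesis n0 : (0 < n)%N.

Lemma sinh_bessel_continuous p : continuous (@sinh_bessel R n p).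
Proof.
move=> v; have := is_derive_continuous_at (@is_derive_sinh_weighted R n n0 p p v 0 (lexx 0)).
have -> : (fun t => weighted (sinh_weight n) p p (t ^+ 2 + 0)) = sinh_bessel n p.
  by apply/funext => t; rewrite addr0.
exact.
Qed.

(** Laplace's method applied to the left side of the descent, whose integrand belongs to dimension 2
    k + 1 and has known asymptotics. *)
Lemma sinh_bessel_odd_asymptotic k : (0 < k)%N ->
  sinh_bessel n (k.*2).-1 v / (Num.sqrt v * (expR (- (pi * v)) * v ^+ n.-1 * v^-1 ^+ k))
    @[v --> (+oo : set_system R)] --> Num.sqrt 2 * odd_limit n k / (2 * Num.sqrt pi).
Proof.
move=> k0; have [C [V0 [C0 _ hC]]] := @sinh_bessel_bound R n n0 k.
have [V1 _ hI] := @sinh_slice_integrable R n n0 k.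
have [V2 _ hD] := @even_descent R n n0 k k0.
have sliceE v u : sinh_bessel n (k.*2) (Num.sqrt (v ^+ 2 + u ^+ 2)) =
    weighted (sinh_weight n) (k.*2) (k.*2) (v ^+ 2 + u ^+ 2).
  by rewrite /sinh_bessel sqr_sqrtr// addr_ge0 ?sqr_ge0.
have := @laplace_slice R _ n.-1 k (odd_limit n k) C (Num.max V0 (V1 + 1)) (@sinh_bessel_continuous (k.*2)) C0.
move=> /(_ _ (@sinh_bessel_asymptotic R n n0 k)) h.
have {h} : \int[mu]_u sinh_bessel n (k.*2) (Num.sqrt (v ^+ 2 + u ^+ 2)) /
    (Num.sqrt v * (expR (- (pi * v)) * v ^+ n.-1 * v^-1 ^+ k))
    @[v --> (+oo : set_system R)] --> Num.sqrt 2 * odd_limit n k.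
  apply: h => v; rewrite ge_max => /andP[Vv Vv1]; first exact: hC.
  under eq_fun do rewrite sliceE.
  by apply: hI; apply: lt_le_trans Vv1; rewrite ltrDl.
move=> h; have c0 : 2 * Num.sqrt pi != 0 :> R by rewrite gt_eqF// mulr_gt0// sqrtr_gt0 pi_gt0.
have hc : (fun=> (2 * Num.sqrt pi)^-1) v @[v --> (+oo : set_system R)] --> ((2 * Num.sqrt pi)^-1 : R) by exact: cvg_cst.
have := cvgM h hc => /(_ _).
apply: cvg_trans; apply: near_eq_cvg; near=> v.
have Vv : V2 < v by near: v; apply: nbhs_pinfty_gt; exact: num_real.
rewrite /=; under eq_Rintegral do rewrite sliceE.
rewrite hD//; move: (sinh_bessel _ _ _) (Num.sqrt v * _) (2 * Num.sqrt pi) c0 => a d c c0.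
by rewrite mulrC !mulrA mulVf// mul1r.
Unshelve. all: by end_near. Qed.

Lemma b_even k v : (0 < k)%N ->
  b n (2 * k)%N v%:C = (2 / (4 * pi) ^+ (n + k) * sinh_bessel n (k.*2).-1 v)%:C.
Proof.
move=> k0; rewrite /b [RHS](rmorphM (real_complex R)) /= -cintegral_bessel_real.
have -> : (4 * pi : R) `^ (n%:R + (2 * k)%:R / 2) = (4 * pi) ^+ (n + k).
  have -> : n%:R + (2 * k)%:R / 2 = (n + k)%:R :> R by rewrite natrD natrM; field.
  by rewrite powR_mulrn// mulr_ge0// pi_ge0.
congr (_ * _); apply: eq_cintegral => s _.
by rewrite besselJ_entireE mul2n prednK// double_gt0.
Qed.

(** The factor 2 sqrt pi of the descent is the (4 pi)^(1 / 2) by which the normalisations of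
    dimensions 2 k + 1 and 2 k differ. The odd constant is therefore reused, multiplied by sqrt 2,
    and the power of v gains sqrt v. *)
Lemma b_even_asymptotic k : (1 <= k)%N ->
  equiv_at (+oo : set_system R)
       (fun v : R => b n (2 * k)%N v%:C)
       (fun v : R =>
          (Num.sqrt 2 / (2 ^+ k * 4 ^+ n * (n.-1)`!%:R) *
           v `^ (n%:R - k%:R - 2^-1) * expR (- (pi * v)))%:C).
Proof.
move=> k0; set K : R := 2 ^+ k * 4 ^+ n * _.
have K0 : K != 0 by rewrite !mulf_neq0 ?expf_neq0 ?pnatr_eq0// -lt0n fact_gt0.
have s0 : Num.sqrt 2 != 0 :> R by rewrite gt_eqF// sqrtr_gt0.
have sp0 : Num.sqrt pi != 0 :> R by rewrite gt_eqF// sqrtr_gt0 pi_gt0.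
have p0 : (4 * pi) ^+ (n + k) != 0 :> R by rewrite expf_neq0// mulf_neq0 ?pnatr_eq0// gt_eqF// pi_gt0.
have cK : 2 / ((4 * pi) ^+ (n + k) * (2 * Num.sqrt pi)) * odd_limit n k = K^-1 :> R.
  have /eqP := @odd_constant R n n0 k; rewrite bessel_limit_real// -rmorphM.
  by rewrite eq_complex /= => /andP[/eqP].
have hc : (fun=> 2 / (4 * pi) ^+ (n + k) * K / Num.sqrt 2) v @[v --> (+oo : set_system R)] -->
    (2 / (4 * pi) ^+ (n + k) * K / Num.sqrt 2 : R) by exact: cvg_cst.
have h := cvgM hc (sinh_bessel_odd_asymptotic k0) _.
have E : 2 / (4 * pi) ^+ (n + k) * K / Num.sqrt 2 *
    (Num.sqrt 2 * odd_limit n k / (2 * Num.sqrt pi)) = 1 :> R.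
  apply: (@etrans _ _ (K * K^-1)); last exact: mulfV.
  rewrite -cK; move: (odd_limit n k) K0 s0 sp0 p0 => l.
  move: ((4 * pi) ^+ (n + k)) (Num.sqrt pi) (Num.sqrt 2) K {cK h hc} => a b c d d0 c0 b0 a0.
  by field; rewrite a0 b0 c0.
rewrite E in h; have {}h := h _.
apply/climP; rewrite /clim.
have : `|2 / (4 * pi) ^+ (n + k) * K / Num.sqrt 2 *
    (sinh_bessel n (k.*2).-1 v / (Num.sqrt v * (expR (- (pi * v)) * v ^+ n.-1 * v^-1 ^+ k))) - 1|
    @[v --> (+oo : set_system R)] --> (0 : R).
  apply/norm_cvg0P; apply/subr_cvg0; exact: h.
apply: cvg_trans; apply: near_eq_cvg; near=> v.
have v0 : 0 < v by near: v; exact: nbhs_pinfty_gt.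
have -> : v `^ (n%:R - k%:R - 2^-1) = Num.sqrt v * v ^+ n.-1 * v^-1 ^+ k.
  have -> : n%:R - k%:R - 2^-1 = 2^-1 + n.-1%:R - k%:R :> R.
    by rewrite -[in LHS](prednK n0) -natr1; field.
  rewrite powRD ?(gt_eqF v0) ?implybT// powRD ?(gt_eqF v0) ?implybT// powR12_sqrt ?(ltW v0)//.
  by rewrite powRN !powR_mulrn ?(ltW v0)// exprVn.
rewrite b_even// -fmorphV -rmorphM -rmorphB normc_real; congr (`|_ - 1|).
have := sqrtr_gt0 v; rewrite v0 => sv0; have e0 := expR_gt0 (- (pi * v)).
have vn0 := exprn_gt0 n.-1 v0; have vk0 : 0 < v^-1 ^+ k by rewrite exprn_gt0// invr_gt0.
move: (v ^+ n.-1) (v^-1 ^+ k) (expR _) (Num.sqrt v) (sinh_bessel _ _ _) vn0 vk0 e0 sv0 => a c e d g.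
move: K0 s0 p0; move: ((4 * pi) ^+ (n + k)) (Num.sqrt 2) K {cK h hc E} => x y z z0 y0 x0 *.
by field; rewrite ?x0 ?y0 ?z0 ?gt_eqF.
Unshelve. all: by end_near. Qed.

End EvenTheorem.

Theorem mainTheorem3 (R : realType) (n : nat) (hn : (1 <= n)%N) :
  (exists2 delta : R, 0 < delta &
    forall k : nat,
      equiv_at (strip_pinfty ((2 / 3) ^+ k * delta))
        (fun v : R[i] => b n (2 * k + 1)%N v)
        (fun v : R[i] =>
           ((2 ^+ k * 4 ^+ n * (n.-1)`!%:R)^-1 : R)%:C *
           v ^ (n%:Z - k%:Z - 1) * cexp (- (pi%:C * v))))
  /\
  (forall k : nat, (1 <= k)%N ->
     equiv_at (+oo : set_system R)
       (fun v : R => b n (2 * k)%N v%:C)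
       (fun v : R =>
          (Num.sqrt 2 / (2 ^+ k * 4 ^+ n * (n.-1)`!%:R) *
           v `^ (n%:R - k%:R - 2^-1) * expR (- (pi * v)))%:C)).
Proof.
split; last by move=> k k0; exact: b_even_asymptotic.
by exists (1 / 2) => [|k]; [rewrite divr_gt0|exact: b_odd_asymptotic].
Qed.
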